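(* Let $(V,\|\cdot\|_u)$ be a Euclidean Jordan algebra with its order-unit norm. Then the map $\phi\colon\overline{V}^h\to B_1^*$ (defined in the context) is a homeomorphism. Moreover, the part $\mathcal{P}_h$, with $h$ the horofunction given by $$h(x)=\max\Big\{\Lambda_{V(p_I)}\Big(-U_{p_I}x-\sum_{i\in I}\alpha_ip_i\Big),\ \Lambda_{V(p_J)}\Big(U_{p_J}x-\sum_{j\in J}\alpha_jp_j\Big)\Big\},\quad x\in V,\qquad(\ast)$$ is mapped onto the relative interior of the closed boundary face $$\mathrm{conv}\big((U_{p_I}(V)\cap S(V))\cup(U_{p_J}(V)\cap -S(V))\big)$$ of $B_1^*$. Here $p_1,\dots,p_r$ is a Jordan frame, $I,J\subseteq\{1,\dots,r\}$ are disjoint with $I\cup J\ne\emptyset$, and $\alpha\in\mathbb{R}^{I\cup J}$ with $\min\{\alpha_i\colon i\in I\cup J\}=0$; a term with empty index set is omitted from the maximum.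
   Context: Euclidean Jordan algebra: a finite dimensional real Jordan algebra $(V,\bullet)$ with unit $u$ and an inner product for which every $L_x\colon y\mapsto x\bullet y$ is self-adjoint. Its cone is $V_+=\{x^2\colon x\in V\}$, inducing the order $x\le y\iff y-x\in V_+$, and $\|x\|_u=\inf\{\lambda\ge0\colon-\lambda u\le x\le\lambda u\}=\max\{|\lambda|\colon\lambda\in\sigma(x)\}$. A Jordan frame is a set $p_1,\dots,p_r$ of mutually orthogonal primitive idempotents with $p_1+\dots+p_r=u$, where $r$ is the rank; every $x\in V$ has a spectral decomposition $x=\sum_{i=1}^r\lambda_ip_i$ with $p_1,\dots,p_r$ a Jordan frame, and $\mathrm{tr}(x)=\sum_i\lambda_i$. The inner product is fixed to be $(x|y)=\mathrm{tr}(x\bullet y)$. The quadratic representation is $U_xy=2x\bullet(x\bullet y)-x^2\bullet y$. Put $p_I=\sum_{i\in I}p_i$ ($p_\emptyset=0$), $V(p_I)=U_{p_I}(V)$ (a subalgebra with unit $p_I$), and let $\Lambda_{V(p_I)}(z)$ be the maximal eigenvalue of $z$ in $V(p_I)$. Dual ball: $V^*$ is identified with $V$ via $(\cdot|\cdot)$; $S(V)=\{w\in V_+\colon(u|w)=1\}$ is the state space, and $B_1^*=\mathrm{conv}(S(V)\cup -S(V))$ is the closed unit ball of the dual norm of $\|\cdot\|_u$. Horofunction compactification: basepoint $0$. With $h_y(z)=\|z-y\|_u-\|y\|_u$, $\overline{V}^h$ is the closure of $\{h_y\colon y\in V\}$ in $\mathbb{R}^V$ (pointwise convergence), $V$ is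 identified with $\{h_y\}$, and horofunctions are the elements of $\partial\overline{V}^h=\overline{V}^h\setminus\{h_y\colon y\in V\}$. The horofunctions are precisely the functions $(\ast)$, and all are Busemann points. The detour cost is $H(h,h')=\sup_W\inf_{x\colon h_x\in W}(\|x\|_u+h'(x))$ ($W$ ranging over the neighbourhoods of $h$ in $\overline{V}^h$), the detour distance is $\delta(h,h')=H(h,h')+H(h',h)$, and the part $\mathcal{P}_h$ consists of the horofunctions $h'$ with $\delta(h,h')<\infty$. The map $\phi$: for $x=\sum_{i=1}^r\lambda_ip_i\in V$ (spectral decomposition), $$\phi(x)=\frac{e^x-e^{-x}}{(e^x+e^{-x}|u)}=\frac{\sum_{i=1}^r(e^{\lambda_i}-e^{-\lambda_i})p_i}{\sum_{i=1}^r(e^{\lambda_i}+e^{-\lambda_i})},$$ and for $h\in\partial\overline{V}^h$ given by $(\ast)$, $$\phi(h)=\frac{\sum_{i\in I}e^{-\alpha_i}p_i-\sum_{j\in J}e^{-\alpha_j}p_j}{\sum_{i\in I}e^{-\alpha_i}+\sum_{j\in J}e^{-\alpha_j}};$$ this does not depend on the chosen representation of $h$. *)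

(* Defs.v *)
From HB Require Import structures.
From mathcomp Require Import all_boot all_order all_algebra.
From mathcomp Require Import all_classical all_reals all_analysis.

Set Implicit Arguments.
Unset Strict Implicit.
Unset Printing Implicit Defensive.

Import Order.TTheory GRing.Theory Num.Theory.
Import numFieldNormedType.Exports.

Local Open Scope classical_set_scope.
Local Open Scope ring_scope.

(* [jip] is an arbitrary associative inner product; the one used from [tip] on
   is the trace form. The axiom [junit_neq0] excludes only the algebra {0}, in
   which the state space is empty. Linearity in the right-hand argument follows
   from [jmulC] and [jipC]. *)
HB.mixin Record isEuclideanJordan (R : realType) V & Vector R V := {
  jmul : V -> V -> V;
  junit : V;
  jip : V -> V -> R;
  jmulC : forall x y, jmul x y = jmul y x;
  jmulDl : forall x y z, jmul (x + y) z = jmul x z + jmul y z;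
  jmulZl : forall a x y, jmul (a *: x) y = a *: jmul x y;
  jmul_jordan : forall x y,
    jmul x (jmul (jmul x x) y) = jmul (jmul x x) (jmul x y);
  jmul1 : forall x, jmul junit x = x;
  junit_neq0 : junit != 0;
  jipC : forall x y, jip x y = jip y x;
  jipDl : forall x y z, jip (x + y) z = jip x z + jip y z;
  jipZl : forall a x y, jip (a *: x) y = a * jip x y;
  jip_gt0 : forall x, x != 0 -> 0 < jip x x;
  jip_selfadj : forall x y z, jip (jmul x y) z = jip y (jmul x z)
}.

#[short(type="euclideanJordanType")]
HB.structure Definition EuclideanJordan (R : realType) :=
  {V of isEuclideanJordan R V & Vector R V}.

(* A finite-dimensional space with its unique Hausdorff vector space topology,
   which is also the topology of every norm on it. *)
Definition fdtop (R : realType) (V : vectType R) : Type := V.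

HB.instance Definition _ (R : realType) (V : vectType R) :=
  Topological.copy (fdtop V)
    (initial_topology (fun v : V => \row_i coord (vbasis {:V}) i v)).

Definition homeomorphism_on (T U : topologicalType) (A : set T) (B : set U)
    (f : T -> U) : Prop :=
  [/\ set_bij A B f, {within A, continuous f} &
      exists2 g : U -> T, (forall x, A x -> g (f x) = x) &
                          {within B, continuous g}].

Section ConvexGeometry.
Context {R : realType} {V : vectType R}.

Definition conv (A : set V) : set V := smallest (@convex_set R V) A.

Definition affine_set (A : set V) : Prop :=
  forall x y (t : R), A x -> A y -> A (t *: x + (1 - t) *: y).

Definition aff (A : set V) : set V := smallest affine_set A.

Definition relint (A : set V) : set V :=
  [set x | A x /\
    exists2 W : set V, nbhs (x : fdtop V) W & W `&` aff A `<=` A].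

Definition topological_boundary (A : set V) : set V :=
  closure (A : set (fdtop V)) `\` interior (A : set (fdtop V)).

Definition is_face (F C : set V) : Prop :=
  [/\ F `<=` C, convex_set (F : set (convex_lmodType V)) &
      forall x y (t : R), C x -> C y -> 0 < t -> t < 1 ->
        F (t *: x + (1 - t) *: y) -> F x /\ F y].

Definition closed_boundary_face (F C : set V) : Prop :=
  [/\ closed (F : set (fdtop V)), is_face F C &
      F `<=` topological_boundary C].

End ConvexGeometry.

Section JordanTheory.
Context {R : realType} {V : euclideanJordanType R}.
Implicit Types (x y z e c w : V).

Local Notation "x • y" := (jmul x y) (at level 40, left associativity).

Definition quad x y : V := 2 *: (x • (x • y)) - (x • x) • y.

(* V(e), for an idempotent e. *)
Definition peirce1 e : set V := range (quad e).

Definition idempotent_in e c : Prop := peirce1 e c /\ c • c = c.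

Definition primitive_in e c : Prop :=
  [/\ idempotent_in e c, c != 0 &
      ~ exists a b, [/\ idempotent_in e a, idempotent_in e b, a != 0, b != 0 &
                        c = a + b]].

(* Jordan frames of the algebra V(e), whose unit is e; for e = junit this is
   V itself. All frames of V(e) have the same length, the rank of V(e). *)
Definition jordan_frame e (r : nat) (p : 'I_r -> V) : Prop :=
  [/\ forall i, primitive_in e (p i),
      forall i j, i != j -> p i • p j = 0 &
      \sum_i p i = e].

Definition spectral_decomposition e z (r : nat) (p : 'I_r -> V)
    (lam : 'I_r -> R) : Prop :=
  jordan_frame e p /\ z = \sum_i lam i *: p i.

Definition spectrum_in e z : set R :=
  [set mu | exists r (p : 'I_r -> V) lam,
     spectral_decomposition e z p lam /\ exists i, mu = lam i].

(* Lambda_{V(e)}(z); the spectrum is a nonempty finite set, so the supremum is a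
   maximum. *)
Definition max_eigenvalue e z : R := sup (spectrum_in e z).

(* The eigenvalues of x, with multiplicities, do not depend on the
   decomposition, so the set has a single element. *)
Definition jtrace x : R :=
  xget 0 [set t | exists r (p : 'I_r -> V) lam,
    spectral_decomposition junit x p lam /\ t = \sum_i lam i].

Definition tip x y : R := jtrace (x • y).

Definition cone : set V := [set x • x | x in [set: V]].

Definition jle x y : Prop := cone (y - x).

Definition unorm x : R :=
  inf [set lam | 0 <= lam /\
    jle (- (lam *: junit)) x /\ jle x (lam *: junit)].

Definition state_space : set V := [set w | cone w /\ tip junit w = 1].

Definition neg_state_space : set V := [set - w | w in state_space].

(* B_1^*, with V^* identified with V through the trace form. *)
Definition dual_ball : set V := conv (state_space `|` neg_state_space).

Definition internal_metric y : {ptws V -> R} :=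
  fun z => unorm (z - y) - unorm y.

Definition horo_compactification : set {ptws V -> R} :=
  closure (range internal_metric).

Definition horo_boundary : set {ptws V -> R} :=
  horo_compactification `\` range internal_metric.

Definition detour_cost (h h' : {ptws V -> R}) : \bar R :=
  ereal_sup [set ereal_inf [set (unorm x + h' x)%:E
                           | x in [set x | W (internal_metric x)]]
            | W in within horo_compactification (nbhs h)].

Definition detour_dist (h h' : {ptws V -> R}) : \bar R :=
  (detour_cost h h' + detour_cost h' h)%E.

Definition part (h : {ptws V -> R}) : set {ptws V -> R} :=
  [set h' | horo_boundary h' /\ (detour_dist h h' < +oo)%E].

Definition psum (r : nat) (p : 'I_r -> V) (I : {set 'I_r}) : V :=
  \sum_(i in I) p i.

(* Only the values of [alpha] on I :|: J matter; the last two conditions say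
   that their minimum is 0. *)
Definition horo_data (r : nat) (p : 'I_r -> V) (I J : {set 'I_r})
    (alpha : 'I_r -> R) : Prop :=
  [/\ jordan_frame junit p, [disjoint I & J]%B, (I :|: J)%SET != finset.set0,
      (forall i, i \in I :|: J -> 0 <= alpha i) &
      (exists2 i, i \in I :|: J & alpha i = 0)].

Definition horo_fun (r : nat) (p : 'I_r -> V) (I J : {set 'I_r})
    (alpha : 'I_r -> R) : {ptws V -> R} :=
  fun x =>
    let hI := max_eigenvalue (psum p I)
                (- quad (psum p I) x - \sum_(i in I) alpha i *: p i) in
    let hJ := max_eigenvalue (psum p J)
                (quad (psum p J) x - \sum_(j in J) alpha j *: p j) in
    if J == finset.set0 then hI else if I == finset.set0 then hJ
    else Num.max hI hJ.

Definition phi_point (r : nat) (p : 'I_r -> V) (lam : 'I_r -> R) : V :=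
  (\sum_i (expR (lam i) + expR (- lam i)))^-1 *:
  (\sum_i (expR (lam i) - expR (- lam i)) *: p i).

Definition phi_horo (r : nat) (p : 'I_r -> V) (I J : {set 'I_r})
    (alpha : 'I_r -> R) : V :=
  (\sum_(i in I) expR (- alpha i) + \sum_(j in J) expR (- alpha j))^-1 *:
  (\sum_(i in I) expR (- alpha i) *: p i -
   \sum_(j in J) expR (- alpha j) *: p j).

Definition phi_graph (h : {ptws V -> R}) : set V :=
  [set w |
    (exists x r (p : 'I_r -> V) lam,
       [/\ spectral_decomposition junit x p lam, h = internal_metric x &
           w = phi_point p lam]) \/
    (exists r (p : 'I_r -> V) I J alpha,
       [/\ horo_data p I J alpha, h = horo_fun p I J alpha &
           w = phi_horo p I J alpha])].

(* [phi_graph h] is a singleton for every h in [horo_compactification]; the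
   values of [phi] elsewhere are irrelevant. *)
Definition phi (h : {ptws V -> R}) : fdtop V := xget 0 (phi_graph h).

Definition horo_face (r : nat) (p : 'I_r -> V) (I J : {set 'I_r}) : set V :=
  conv ((peirce1 (psum p I) `&` state_space) `|`
        (peirce1 (psum p J) `&` neg_state_space)).

End JordanTheory.

Arguments dual_ball {R} V.
Arguments horo_compactification {R} V.
Arguments horo_boundary {R} V.

(* Main.v *)
(* Both spaces are images of the same compact family of data: a Jordan frame
   p_1, ..., p_n with coefficients a_i, b_i >= 0 of total sum 1 and with all products
   a_i b_i equal. The data go to the element sum_i (a_i - b_i) p_i of the dual ball
   and to the function z |-> ln N(z) - ln N(0), where
   N(z) = max (e^Lambda(-z + log A), e^Lambda(z + log B)) for A = sum_i a_i p_i and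
   B = sum_i b_i p_i. If a_i b_i = s^2 > 0, this function is the internal metric of
   the y with A = s e^y and B = s e^-y; if a_i b_i = 0, it is a horofunction. Since
   e^Lambda(z + log A) is the maximum over the states w of
   e^(w|z) prod_i a_i^(w|p_i), it is continuous up to singular A, so both maps are
   continuous along limits of frames. They identify the same data, so the induced
   bijection is a homeomorphism.

   The face spanned by the states of V(p_I) and the negated states of V(p_J) is
   exposed by p_I - p_J, and its relative interior consists of the images of the data
   for which a and b have supports exactly p_I and p_J. A finite detour cost forces
   an inclusion of supports, and equality of supports suffices for both costs to be
   finite. *)
Require Import Defs.
From HB Require Import structures.
From mathcomp Require Import all_boot all_order all_algebra.
From mathcomp Require Import all_classical all_reals all_analysis.
From mathcomp Require Import ring lra complex.

Import Order.TTheory GRing.Theory Num.Theory.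
Import numFieldNormedType.Exports.
Local Open Scope classical_set_scope.
Local Open Scope ring_scope.

Set Implicit Arguments.
Unset Strict Implicit.
Unset Printing Implicit Defensive.

(** An element has no unique frame and in general no frame depending continuously on it, so neither
    space comes with a continuous section into the data. Arbitrary sections are chosen instead: an
    ultrafilter is pushed through one, compactness of the data yields a limit datum, and the limit
    is identified because two data agree in one space exactly when they agree in the other.
    Ultrafilters dispense with any countability of the topology of pointwise convergence, and every
    bounded real quantity converges along them.

    The agreement rests on two recoveries. From an element of the ball, the scale s with a_i b_i =
    s^2 is found because sum_i sqrt((a_i - b_i)^2 + 4 s^2) = 1 and the left side is strictly
    increasing in s. From a horofunction, the data are read off its values on test points
    parametrized by a real M.

    Trace and cone are defined by decompositions and squares, so linearity of the trace and
    convexity of the cone must be derived from the spectral theorem. The trace also keeps limits of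
    primitive idempotents primitive. *)

Local Notation "x • y" := (jmul x y) (at level 40, left associativity).
Local Notation "'⟨' x , y '⟩'" := (jip x y) (format "⟨ x ,  y ⟩").
Local Notation "'⟪' x , y '⟫'" := (tip x y) (format "⟪ x ,  y ⟫").

(** * Peirce calculus *)

Section Peirce.
Context {R : realType} {V : euclideanJordanType R}.
Implicit Types (x y z a b c d e : V) (k t : R).

Lemma jmul0 x : 0 • x = 0 :> V.
Proof. by rewrite -[0 in LHS](scale0r 0) jmulZl scale0r. Qed.

Lemma jmulr0 x : x • 0 = 0 :> V.
Proof. by rewrite jmulC jmul0. Qed.

Lemma jmulr1 x : x • junit = x.
Proof. by rewrite jmulC jmul1. Qed.

Lemma jmulDr x y z : x • (y + z) = x • y + x • z.
Proof. by rewrite jmulC jmulDl !(jmulC _ x). Qed.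

Lemma jmulZr k x y : x • (k *: y) = k *: (x • y).
Proof. by rewrite jmulC jmulZl (jmulC x). Qed.

Lemma jmulNl x y : (- x) • y = - (x • y).
Proof. by rewrite -scaleN1r jmulZl scaleN1r. Qed.

Lemma jmulNr x y : x • (- y) = - (x • y).
Proof. by rewrite jmulC jmulNl jmulC. Qed.

Lemma jmulBl x y z : (x - y) • z = x • z - y • z.
Proof. by rewrite jmulDl jmulNl. Qed.

Lemma jmulBr x y z : z • (x - y) = z • x - z • y.
Proof. by rewrite jmulDr jmulNr. Qed.

Lemma jmul_suml (I : Type) (s : seq I) (P : pred I) (F : I -> V) y :
  (\sum_(i <- s | P i) F i) • y = \sum_(i <- s | P i) F i • y.
Proof. by apply: (big_morph (fun x => x • y) _ (jmul0 y)) => u v; exact: jmulDl. Qed.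

Lemma jmul_sumr (I : Type) (s : seq I) (P : pred I) (F : I -> V) y :
  y • (\sum_(i <- s | P i) F i) = \sum_(i <- s | P i) y • F i.
Proof. by rewrite jmulC jmul_suml; apply: eq_bigr => i _; rewrite jmulC. Qed.

Lemma jip0l x : ⟨0, x⟩ = 0 :> R.
Proof. by rewrite -[0 in LHS](scale0r 0) jipZl mul0r. Qed.

Lemma jipNl x y : ⟨- x, y⟩ = - ⟨x, y⟩.
Proof. by rewrite -scaleN1r jipZl mulN1r. Qed.

Lemma jip_inj x y : (forall v, ⟨x, v⟩ = ⟨y, v⟩) -> x = y.
Proof.
move=> eqxy; apply/eqP; rewrite -subr_eq0; apply: contraT => /jip_gt0.
by rewrite jipDl jipNl eqxy subrr ltxx.
Qed.

Definition jexpand :=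
  (@jmulDl R V, jmulDr, jmulNl, jmulNr, @jmulZl R V, jmulZr, jmul0, jmulr0).
Definition jipexpand := (@jipDl R V, jipNl, @jipZl R V, jip0l).

(** The Jordan defect P is cubic in x; the alternating sum of its values at the partial sums of a,
    b, c isolates its symmetric trilinear part. *)
Lemma jordan_polarized a b c y :
  a • ((b • c) • y) + b • ((c • a) • y) + c • ((a • b) • y) =
  (b • c) • (a • y) + (c • a) • (b • y) + (a • b) • (c • y).
Proof.
pose P x := x • ((x • x) • y) - (x • x) • (x • y).
have P0 x : P x = 0 by rewrite /P jmul_jordan subrr.
have : P (a + b + c) - P (a + b) - P (b + c) - P (a + c) + P a + P b + P c = 0.
  by rewrite !P0 !subr0 !addr0.
rewrite /P => /(congr1 (fun x v => ⟨x, v⟩)) H; apply: jip_inj => v.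
move/(congr1 (fun F => F v)): H;
  rewrite !jexpand !(jmulC b a) !(jmulC c a) !(jmulC c b) !jipexpand.
by lra.
Qed.

(** Pairing with an arbitrary vector turns linear identities between products in V into linear
    identities between reals, which [lra] settles. *)
Ltac jlin H := 
  move: H => /(congr1 (fun x v => ⟨x, v⟩)) H; apply: jip_inj => v;
  move/(congr1 (fun F => F v)): H; rewrite ?jexpand ?jipexpand.

(** Read as operators on z: multiplication by a triple product is a polynomial in multiplications by
    products of at most two factors. This drives the induction on powers. *)
Lemma jmul_triple b c y z :
  ((b • c) • y) • z =
  (b • c) • (y • z) + (b • y) • (c • z) + (c • y) • (b • z)
  - b • (y • (c • z)) - c • (y • (b • z)).
Proof.
have H := jordan_polarized z b c y.
rewrite (jmulC z ((b • c) • y)) (jmulC _ (b • y)) (jmulC _ (c • y)) in H.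
rewrite (jmulC (c • z) y) (jmulC (z • b) y) (jmulC z y) (jmulC z b) in H.
jlin H; lra.
Qed.

(** With L the multiplication by c this is L (2L - 1) (L - 1) = 0, so the Peirce eigenvalues are 0,
    1/2 and 1. *)
Lemma idem_poly c x : c • c = c ->
  2 *: (c • (c • (c • x))) + c • x = 3 *: (c • (c • x)).
Proof.
move=> cc; have H := jordan_polarized c c x c.
rewrite !cc (jmulC x c) (jmulC (c • x) c) in H; jlin H; lra.
Qed.

(** [quad c] is 2 L^2 - L, which takes the values 0, 0, 1 at the eigenvalues 0, 1/2, 1 of L: it
    projects onto the eigenspace of 1. *)
Lemma peirce1E c x : c • c = c -> peirce1 c x <-> c • x = x.
Proof.
move=> cc; split=> [[y _ <-]|cx].
  rewrite /quad cc; have H := idem_poly y cc; jlin H; lra.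
by exists x => //; rewrite /quad cc !cx; apply: jip_inj => v; rewrite !jipexpand; lra.
Qed.

Lemma peirce11 c x y : c • c = c -> c • x = x -> c • y = y -> c • (x • y) = x • y.
Proof.
move=> cc cx cy; have H := jordan_polarized c c x y.
rewrite (jmulC x c) !cc !cx cy (jmulC x) in H; rewrite !(jmulC y x) in H.
jlin H; lra.
Qed.

(** One instance of the polarized identity gives c • (x • y) = 0; the instance with x and y
    exchanged gives x • y = c • (x • y). *)
Lemma peirce10 c x y : c • c = c -> c • x = x -> c • y = 0 -> x • y = 0.
Proof.
move=> cc cx cy; have H := jordan_polarized c c x y.
have H2 := jordan_polarized c c y x.
rewrite (jmulC x c) !cc !cx cy !jmulr0 in H.
rewrite (jmulC y c) !cc !cx cy !jmul0 !jmulr0 (jmulC y x) in H2.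
have H3 : c • (x • y) = 0 by jlin H; lra.
by move: H2; rewrite H3 !add0r.
Qed.

Lemma orth_comm c d x : c • c = c -> d • d = d -> c • d = 0 ->
  c • (d • x) = d • (c • x).
Proof.
move=> cc dd cd; have H := jordan_polarized c d d x.
by rewrite (jmulC d c) !dd !cd !jmul0 !jmulr0 !addr0 in H.
Qed.

Lemma peirce1_comm c x y : c • c = c -> c • x = x -> c • (x • y) = x • (c • y).
Proof.
move=> cc cx; have H := jordan_polarized c c x y.
rewrite (jmulC x c) !cc !cx in H; jlin H; lra.
Qed.

Lemma idemB c e : e • e = e -> c • c = c -> e • c = c ->
  (e - c) • (e - c) = e - c /\ c • (e - c) = 0.
Proof.
by move=> ee cc ec; rewrite jmulBl !jmulBr ee cc ec (jmulC c) ec !subrr subr0.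
Qed.

Lemma peirce1_sub c e x : e • e = e -> c • c = c -> e • c = c ->
  c • x = x -> e • x = x.
Proof.
move=> ee cc ec cx; have [_ c0] := idemB ee cc ec.
have := peirce10 cc cx c0; rewrite jmulBr !(jmulC x) cx => /eqP.
by rewrite subr_eq0 => /eqP.
Qed.

Lemma idemD a b : a • a = a -> b • b = b -> a • b = 0 ->
  (a + b) • (a + b) = a + b /\ (a + b) • a = a.
Proof. by move=> aa bb ab; rewrite !jmulDl !jmulDr aa bb (jmulC b a) ab !addr0 add0r. Qed.

Lemma idemD_orth a b : a • a = a -> b • b = b ->
  (a + b) • (a + b) = a + b -> a • b = 0.
Proof.
move=> aa bb H; rewrite jmulDl !jmulDr aa bb (jmulC b a) in H.
jlin H; lra.
Qed.

Lemma quad_idem_proj c x : c • c = c -> c • quad c x = quad c x.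
Proof. by move=> cc; apply/peirce1E => //; exists x. Qed.

Lemma quad_peirce1 c x : c • c = c -> c • x = x -> quad c x = x.
Proof.
by move=> cc cx; rewrite /quad cc !cx; apply: jip_inj => v; rewrite !jipexpand; lra.
Qed.

Lemma quad_peirce0 c x : c • x = 0 -> c • c = c -> quad c x = 0.
Proof. by move=> cx cc; rewrite /quad cc cx jmulr0 scaler0 subr0. Qed.

(** Primitivity without an ambient unit: the summands of an idempotent of V(e) lie in V(e) by
    themselves, so restricting them to V(e) changes nothing. *)
Definition jprim c : Prop :=
  [/\ c • c = c, c != 0 &
      forall a b, a • a = a -> b • b = b -> c = a + b -> a = 0 \/ b = 0].

Lemma primitive_inE e c : e • e = e ->
  primitive_in e c <-> e • c = c /\ jprim c.
Proof.
move=> ee; split=> [[[/peirce1E-/(_ ee) ec cc] c0 nab]|[ec [cc c0 nab]]].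
  split=> //; split=> // a b aa bb cab.
  have ab : a • b = 0 by apply: idemD_orth => //; rewrite -cab.
  have [_ ca] := idemD aa bb ab; have ba : b • a = 0 by rewrite jmulC.
  have [_ cb] := idemD bb aa ba; rewrite addrC in cb.
  rewrite -cab in ca cb.
  have [->|a0] := eqVneq a 0; first by left.
  have [->|b0] := eqVneq b 0; first by right.
  by case: nab; exists a, b; split=> //; split=> //; apply/peirce1E => //;
     apply: (peirce1_sub (c := c)).
split=> //; first by split=> //; apply/peirce1E.
move=> [a [b [[_ aa] [_ bb] a0 b0 cab]]].
by case: (nab a b aa bb cab) => H; [move: a0|move: b0]; rewrite H eqxx.
Qed.

End Peirce.

(** * The spectral theorem *)

Section Spectral.
Context {R : realType} {V : euclideanJordanType R}.
Implicit Types (x y z a b c d e : V) (k t : R).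

Let jmul_is_linear x : linear (jmul x : V -> V).
Proof. by move=> k y z; rewrite jmulDr jmulZr. Qed.

HB.instance Definition _ x :=
  GRing.isLinear.Build R V V _ (jmul x) (jmul_is_linear x).

(** Powers, and the polynomial values built on them, are taken inside V(e): the zeroth power is e
    rather than [junit]. *)
Definition jpow e x n : V := iter n (jmul x) e.

(** [jmul_triple] writes multiplication by x^(n+2) as a polynomial in the multiplications by x, x^2,
    x^n and x^(n+1), so the induction carries two consecutive powers. *)
Lemma jpow_comm e x n : e • e = e -> e • x = x ->
  (forall y, jpow e x n • (x • y) = x • (jpow e x n • y)) /\
  (forall y, jpow e x n • ((x • x) • y) = (x • x) • (jpow e x n • y)).
Proof.
move=> ee ex.
have [] : ((forall y, jpow e x n • (x • y) = x • (jpow e x n • y)) /\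
  (forall y, jpow e x n • ((x • x) • y) = (x • x) • (jpow e x n • y))) /\
  ((forall y, jpow e x n.+1 • (x • y) = x • (jpow e x n.+1 • y)) /\
  (forall y, jpow e x n.+1 • ((x • x) • y) = (x • x) • (jpow e x n.+1 • y)));
  last by [].
elim: n => [|n [[A1 A2] [B1 B2]]].
  rewrite /jpow /= (jmulC x e) ex; split; split=> // y.
  - exact: peirce1_comm.
  - by apply: peirce1_comm => //; exact: peirce11.
  - by rewrite jmul_jordan.
split=> //.
have C y : jpow e x n.+2 • y = 2 *: (jpow e x n.+1 • (x • y))
    + (x • x) • (jpow e x n • y)
    - x • (x • (jpow e x n • y)) - jpow e x n • (x • (x • y)).
  rewrite {1}/jpow !iterS -/(jpow e x n) (jmulC x (_ • _)) (jmul_triple x (jpow e x n) x y).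
  rewrite -/(jpow e x n.+1) (jmulC (jpow e x n) x) -/(jpow e x n.+1).
  by apply: jip_inj => v; rewrite ?jexpand ?jipexpand; lra.
split=> y; rewrite !C !jexpand.
  by rewrite !A1 !B1 -!jmul_jordan.
by rewrite !jmul_jordan !A2 !B2 !jmul_jordan.
Qed.

Lemma jpow_mul e x m n : e • e = e -> e • x = x ->
  jpow e x m • jpow e x n = jpow e x (m + n).
Proof.
move=> ee ex; elim: n => [|n IH].
  have : e • jpow e x m = jpow e x m.
    by elim: m => [//|m IH]; rewrite /jpow iterS; apply: peirce11.
  by rewrite addn0 /= jmulC.
by rewrite addnS {2 3}/jpow !iterS -/(jpow e x n) -/(jpow e x _) (jpow_comm m ee ex).1 IH.
Qed.

Definition jpev e x (p : {poly R}) : V := \sum_(i < size p) p`_i *: jpow e x i.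

Lemma jpevE e x (p : {poly R}) n : (size p <= n)%N ->
  jpev e x p = \sum_(i < n) p`_i *: jpow e x i.
Proof.
move=> lepn; rewrite /jpev (big_ord_widen n (fun i => p`_i *: jpow e x i)) //.
rewrite big_mkcond /=; apply: eq_bigr => i _; case: ltnP => // /(nth_default 0) ->.
by rewrite scale0r.
Qed.

Lemma jpev_XsubC e x (p : {poly R}) k :
  jpev e x (p * ('X - k%:P)) = x • jpev e x p - k *: jpev e x p.
Proof.
have sp : (size (p * ('X - k%:P))%R <= (size p).+1)%N.
  by rewrite (leq_trans (size_polyMleq _ _)) // size_XsubC addn2.
rewrite (jpevE e x sp) (jpevE e x (leqnSn _)) mulrBr.
under eq_bigr => i _ do rewrite coefB coefMC scalerBl (mulrC _ k) -scalerA.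
rewrite big_split /= sumrN -scaler_sumr; congr (_ - _).
rewrite -(jpevE _ _ (leqnSn _)) /jpev big_ord_recl /= coefMX /= scale0r add0r.
rewrite jmul_sumr; apply: eq_bigr => i _.
by rewrite coefMX /= jmulZr.
Qed.

(** Since x^n • y = k^n y, multiplication by y = p(x) scales y by p(k). An eigenvector that is a
    polynomial in x is thus an idempotent up to scaling. *)
Lemma jeigen_mul e x (p : {poly R}) k : e • e = e -> e • x = x ->
  let y := jpev e x p in x • y = k *: y -> y • y = p.[k] *: y.
Proof.
move=> ee ex y xy.
have xny n : jpow e x n • y = k ^+ n *: y.
  transitivity (iter n (jmul x) y).
    rewrite /y /jpev jmul_sumr.
    have -> m : iter m (jmul x) (\sum_(i < size p) p`_i *: jpow e x i) =
        \sum_(i < size p) p`_i *: jpow e x (m + i).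
      elim: m => [//|m IH]; rewrite iterS IH jmul_sumr.
      by apply: eq_bigr => i _; rewrite jmulZr.
    by apply: eq_bigr => i _; rewrite jmulZr jpow_mul.
  elim: n => [|n IH]; first by rewrite expr0 scale1r.
  by rewrite iterS IH jmulZr xy scalerA -exprSr.
rewrite {1}/y /jpev jmul_suml horner_coef scaler_suml.
by apply: eq_bigr => i _; rewrite jmulZl xny scalerA.
Qed.

(** A complex root k + ib with b nonzero is also a root of d = (X - k)^2 + b^2. The remainder modulo
    d is real, of degree at most 1, and vanishes at a nonreal point, hence is 0. *)
Lemma real_factor (p : {poly R}) : (1 < size p)%N ->
  (exists q k, p = q * ('X - k%:P)) \/
  (exists q (k b : R), b != 0 /\ p = q * (('X - k%:P) * ('X - k%:P) + (b ^+ 2)%:P)).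
Proof.
move=> sp; pose f := real_complex R.
have [|z rz] := closed_rootP (map_poly f p) _.
  by rewrite size_map_poly neq_ltn sp orbT.
move: z rz => [k b]; have [->|b0] := eqVneq b 0.
  rewrite -[(_ +i* 0)%C]/(f k) fmorph_root => /factor_theorem [q ->].
  by left; exists q, k.
set z := (k +i* b)%C => /eqP pz.
right; set d := ('X - k%:P) * ('X - k%:P) + (b ^+ 2)%:P.
exists (p %/ d), k, b; split=> //.
have sd : size d = 3%N.
  rewrite size_polyDl ?size_polyC; last first.
    by rewrite size_Mmonic ?monicXsubC ?polyXsubC_eq0 // !size_XsubC; case: eqP.
  by rewrite size_Mmonic ?monicXsubC ?polyXsubC_eq0 // !size_XsubC.
have d0 : d != 0 by rewrite -size_poly_eq0 sd.
have dz : (map_poly f d).[z] = 0.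
  rewrite rmorphD rmorphM /= !rmorphB /= map_polyX !map_polyC /= !hornerE.
  by simpc; congr (_ +i* _)%C; ring.
set r := p %% d; have rz : (map_poly f r).[z] = 0.
  move: pz; rewrite {1}(divp_eq p d) -/r rmorphD rmorphM /= hornerD hornerM dz.
  by rewrite mulr0 add0r.
have sr : (size r <= 2)%N by rewrite -ltnS -sd ltn_modp.
have [r1 r0] : r`_1 = 0 /\ r`_0 = 0.
  move: rz; rewrite (@horner_coef_wide _ 2) ?size_map_poly // !big_ord_recl big_ord0 /=.
  rewrite !coef_map /= expr0 /bump /= expr1 /f /z; simpc.
  move/eqP; rewrite eq_complex /= => /andP[/eqP h1 /eqP h2].
  have r1 : r`_1 = 0.
    by apply/eqP; move/eqP: h2; rewrite !(mulf_eq0, addr0, add0r, mul0r) (negbTE b0)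
      ?orbF ?mulr0 ?addr0.
  by split=> //; move: h1; rewrite r1; lra.
suff -> : p = p %/ d * d + 0 by rewrite addr0 mulpK.
rewrite {1}(divp_eq p d) -/r; congr (_ + _); apply/polyP => i; rewrite coef0.
by case: i => [|[|i]] //; rewrite nth_default // (leq_trans sr).
Qed.

Lemma jpev_linear e x k (p q : {poly R}) :
  jpev e x (k *: p + q) = k *: jpev e x p + jpev e x q.
Proof.
pose n := maxn (size (k *: p + q)%R) (maxn (size p) (size q)).
rewrite !(@jpevE e x _ n) ?leq_max ?leqnn ?orbT // scaler_sumr -big_split /=.
by apply: eq_bigr => i _; rewrite coefD coefZ scalerDl scalerA.
Qed.

Lemma jip_sq x : ⟨x • x, junit⟩ = ⟨x, x⟩.
Proof. by rewrite jip_selfadj jmulr1. Qed.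

Lemma jsq_eq0 x : x • x = 0 -> x = 0.
Proof.
by move=> xx; apply: contraTeq isT => /jip_gt0; rewrite -jip_sq xx jip0l ltxx.
Qed.

Lemma jannihilator e x : exists p : {poly R}, p != 0 /\ jpev e x p = 0.
Proof.
pose n := (\dim {:V}).+1; pose X := [tuple jpow e x i | i < n].
have : ~~ free X.
  apply/negP => /eqP frX; have := dimvS (subvf <<X>>%VS).
  by rewrite frX size_tuple ltnn.
move=> /negP nfr.
have [k [k0 [i ki]]] : exists k : 'I_n -> R, \sum_i k i *: X`_i = 0 /\ exists i, k i != 0.
  apply: contrapT => nex; apply: nfr; apply/freeP => k k0 i; apply/eqP.
  by apply: contrapT => /negP ki; apply: nex; exists k; split=> //; exists i.
exists (\poly_(i < n) k (inord i)); split.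
  apply: contraNneq ki => /(congr1 (fun p : {poly R} => p`_i)).
  by rewrite coef_poly ltn_ord inord_val coef0 => ->.
rewrite (jpevE e x (size_poly _ _)) -[RHS]k0; apply: eq_bigr => l _.
by rewrite coef_poly ltn_ord inord_val -tnth_nth tnth_mktuple.
Qed.

(* A quadratic factor (X - k)^2 + b^2 of the minimal polynomial is excluded: it
   would give y and z = x • y - k y with x • z - k z = - b^2 y, so that
   ⟨z, z⟩ = - b^2 ⟨y, y⟩ by self-adjointness. *)
Lemma jeigen e x : e • e = e -> e • x = x -> e != 0 ->
  exists k (p : {poly R}), jpev e x p != 0 /\ x • jpev e x p = k *: jpev e x p.
Proof.
move=> ee ex e0.
have exP : exists n, `[< exists p : {poly R}, [/\ p != 0, jpev e x p = 0 & size p = n] >].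
  by have [p [p0 pe]] := jannihilator e x; exists (size p); apply/asboolP; exists p.
case: (ex_minnP exP) => n /asboolP [p [p0 pe sp]] minn.
have low (q : {poly R}) : q != 0 -> (size q < size p)%N -> jpev e x q != 0.
  move=> q0; apply: contraTneq => q1; rewrite -leqNgt sp; apply: minn.
  by apply/asboolP; exists q.
have : (1 < size p)%N.
  rewrite ltnNge; apply/negP => /size1_polyC pC; move: pe p0.
  rewrite pC (jpevE _ _ (size_polyC_leq1 _)) big_ord1 coefC /= => /eqP.
  by rewrite scaler_eq0 (negbTE e0) orbF => /eqP ->; rewrite polyC0 eqxx.
move=> /real_factor [[q [k pq]]|[q [k [b [b0 pq]]]]].
  have q0 : q != 0 by apply: contraNneq p0 => q0; rewrite pq q0 mul0r.
  exists k, q; split.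
    by apply: low => //; rewrite pq size_Mmonic ?monicXsubC // size_XsubC addn2.
  by apply/eqP; rewrite -subr_eq0 -jpev_XsubC -pq pe.
have q0 : q != 0 by apply: contraNneq p0 => q0; rewrite pq q0 mul0r.
have yn0 : jpev e x q != 0.
  apply: low => //; rewrite pq; set d := _ + _.
  have sd : size d = 3%N.
    have s2 : size (('X - k%:P) * ('X - k%:P)) = 3%N.
      by rewrite size_Mmonic ?monicXsubC ?polyXsubC_eq0 // !size_XsubC.
    by rewrite size_polyDl s2 // size_polyC; case: eqP.
  have d0 : d != 0 by rewrite -size_poly_eq0 sd.
  by rewrite size_mul // sd addn3.
set y := jpev e x q in yn0; pose z := x • y - k *: y.
have xz : x • z - k *: z = - (b ^+ 2) *: y.
  move: pe; rewrite pq mulrDr mulrA (mulrC q _%:P) mul_polyC addrC jpev_linear.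
  rewrite jpev_XsubC jpev_XsubC -/y -/z => /eqP.
  by rewrite addrC addr_eq0 scaleNr => /eqP.
have : 0 <= ⟨z, z⟩.
  by have [->|/jip_gt0/ltW//] := eqVneq z 0; rewrite jip0l.
have -> : ⟨z, z⟩ = - (b ^+ 2) * ⟨y, y⟩.
  rewrite {1}/z jipDl jipNl jipZl jip_selfadj (jipC y (x • z)) (jipC y z).
  by rewrite -jipZl -jipNl -jipDl xz jipZl.
by rewrite nmulr_rge0 ?leNgt ?jip_gt0 // oppr_lt0 exprn_even_gt0 //= b0.
Qed.

(** The eigenvector y satisfies y • y = p(k) y. Here p(k) is nonzero, as a nonzero element has
    nonzero square, so y / p(k) is idempotent. *)
Lemma jeigen_idem e x : e • e = e -> e • x = x -> e != 0 ->
  exists k c, [/\ c • c = c, c != 0, e • c = c & x • c = k *: c].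
Proof.
move=> ee ex e0; have [k [p [y0 xy]]] := jeigen ee ex e0.
set y := jpev e x p in y0 xy.
have yy : y • y = p.[k] *: y by apply: jeigen_mul.
have ey : e • y = y.
  rewrite /y /jpev jmul_sumr; apply: eq_bigr => i _; rewrite jmulZr; congr (_ *: _).
  by elim: (nat_of_ord i) => [//|m IH]; rewrite /jpow iterS; apply: peirce11.
have pk : p.[k] != 0.
  by apply: contraNneq y0 => pk; apply/eqP/jsq_eq0; rewrite yy pk scale0r.
exists k, (p.[k]^-1 *: y); split.
- by rewrite jmulZl jmulZr yy !scalerA -mulrA mulVf // mulr1.
- by rewrite scaler_eq0 invr_eq0 negb_or pk.
- by rewrite jmulZr ey.
- by rewrite jmulZr xy !scalerA mulrC.
Qed.

Definition jframe e r (p : 'I_r -> V) : Prop :=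
  [/\ forall i, jprim (p i), forall i j, i != j -> p i • p j = 0 &
      \sum_i p i = e].

Lemma jframe_sum_mul e r (p : 'I_r -> V) (k : 'I_r -> R) i : jframe e p ->
  (\sum_j k j *: p j) • p i = k i *: p i.
Proof.
move=> [pp po _]; rewrite jmul_suml (bigD1 i) //= big1 ?addr0.
  by rewrite jmulZl; case: (pp i) => ->.
by move=> j ji; rewrite jmulZl po // scaler0.
Qed.

Lemma jframe_unit_mul e r (p : 'I_r -> V) i : jframe e p -> e • p i = p i.
Proof.
move=> fp; have := jframe_sum_mul (fun=> 1) i fp; rewrite scale1r.
by under eq_bigr do rewrite scale1r; case: fp => _ _ ->.
Qed.

Lemma jframe_idem e r (p : 'I_r -> V) : jframe e p -> e • e = e.
Proof.
move=> fp; have [_ _ pe] := fp; rewrite -{2}pe jmul_sumr -[RHS]pe.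
by apply: eq_bigr => i _; apply: jframe_unit_mul fp.
Qed.

Lemma jordan_frameE e r (p : 'I_r -> V) : e • e = e ->
  jordan_frame e p <-> jframe e p.
Proof.
move=> ee; split=> [[pp po pe]|fp].
  by split=> // i; have /(primitive_inE _ ee)[] := pp i.
have [pp po pe] := fp; split=> // i; apply/primitive_inE => //; split=> //.
exact: jframe_unit_mul fp.
Qed.

Lemma jframe_cat a b r s (p : 'I_r -> V) (q : 'I_s -> V)
    (k : 'I_r -> R) (l : 'I_s -> R) :
  jframe a p -> jframe b q -> a • b = 0 ->
  exists (t : nat) (f : 'I_t -> V) (m : 'I_t -> R), jframe (a + b) f /\
    \sum_i k i *: p i + \sum_i l i *: q i = \sum_i m i *: f i.
Proof.
move=> fp fq ab; have aa := jframe_idem fp; have bb := jframe_idem fq.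
have pq i j : p i • q j = 0.
  have pb : p i • b = 0.
    by apply: (peirce10 aa) => //; exact: jframe_unit_mul fp.
  rewrite jmulC; apply: (peirce10 bb); first exact: jframe_unit_mul fq.
  by rewrite jmulC.
pose F T (u : 'I_r -> T) (v : 'I_s -> T) (i : 'I_(r + s)) :=
  match fintype.split i with inl j => u j | inr j => v j end.
have Fl T u v (j : 'I_r) : F T u v (lshift s j) = u j.
  by rewrite /F -[lshift _ _]/(unsplit (inl j)) unsplitK.
have Fr T u v (j : 'I_s) : F T u v (rshift r j) = v j.
  by rewrite /F -[rshift _ _]/(unsplit (inr j)) unsplitK.
exists (r + s)%N, (F _ p q), (F _ k l); split; last first.
  by rewrite big_split_ord /=; congr (_ + _); apply: eq_bigr => i _; rewrite ?Fl ?Fr.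
have [pp po pe] := fp; have [qq qo qe] := fq.
split.
- by move=> i; rewrite /F; case: (fintype.split i).
- move=> i j; case: (split_ordP i) => i' ->; case: (split_ordP j) => j' -> ij;
    rewrite ?Fl ?Fr //.
  + by apply: po; apply: contraNneq ij => ->.
  + by rewrite jmulC.
  + by apply: qo; apply: contraNneq ij => ->.
- by rewrite big_split_ord /= -[in RHS]pe -[in RHS]qe; congr (_ + _);
  apply: eq_bigr => i _; rewrite ?Fl ?Fr.
Qed.

(** V(e) as a subspace, whose dimension is the induction measure of [jspectral]. *)
Let peirce1_space e : {vspace V} := lker (linfun (jmul e) - \1)%VF.

Let mem_peirce1_space e x : (x \in peirce1_space e) = (e • x == x).
Proof. by rewrite memv_ker !lfun_simp subr_eq0. Qed.

(** Induction on dim V(e): an idempotent eigenvector c of x splits e into c and e - c, and frames of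
    the two pieces are concatenated. If c = e, then x is a multiple of e, and e is either primitive
    or itself a sum of two idempotents. *)
Lemma jspectral e x : e • e = e -> e • x = x ->
  exists r (p : 'I_r -> V) (k : 'I_r -> R), jframe e p /\ x = \sum_i k i *: p i.
Proof.
move: {2}(\dim (peirce1_space e)).+1 (ltnSn (\dim (peirce1_space e))) => n.
elim: n e x => [//|n IH] e x dimn ee ex.
have [e0|e0] := eqVneq e 0.
  have x0 : x = 0 by rewrite -ex e0 jmul0.
  exists 0%N, (fun=> 0), (fun=> 0); rewrite x0 big_ord0; split=> //.
  by split=> [[]//|[]//|]; rewrite big_ord0 e0.
have glue a b y z : a • a = a -> b • b = b -> a != 0 -> b != 0 -> e = a + b ->
    a • y = y -> b • z = z -> x = y + z ->
    exists r (p : 'I_r -> V) (k : 'I_r -> R), jframe e p /\ x = \sum_i k i *: p i.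
  move=> aa bb a0 b0 eab ay bz xyz.
  have ab : a • b = 0 by apply: idemD_orth => //; rewrite -eab.
  (* b' lies in V(e) and is annihilated by a', so V(a') is a proper subspace of V(e). *)
  have sub a' b' : a' • a' = a' -> b' • b' = b' -> b' != 0 -> e = a' + b' ->
      a' • b' = 0 -> (\dim (peirce1_space a') < n)%N.
    move=> aa' bb' b0' eab' ab'; rewrite -ltnS; apply: leq_trans dimn; rewrite ltnS.
    have ea : e • a' = a' by rewrite eab'; case: (idemD aa' bb' ab').
    have ba : b' • a' = 0 by rewrite jmulC.
    have eb : e • b' = b' by rewrite eab' addrC; case: (idemD bb' aa' ba).
    have le : (peirce1_space a' <= peirce1_space e)%VS.
      apply/subvP => v; rewrite !mem_peirce1_space => /eqP av; apply/eqP.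
      exact: (peirce1_sub ee aa').
    rewrite ltn_neqAle dimvS // andbT; apply/negP => dimE.
    have /eqP E : peirce1_space a' == peirce1_space e by rewrite eqEdim le (eqP dimE) leqnn.
    have : b' \in peirce1_space a' by rewrite E mem_peirce1_space eb.
    by rewrite mem_peirce1_space ab' eq_sym (negbTE b0').
  have da := sub _ _ aa bb b0 eab ab.
  have db : (\dim (peirce1_space b) < n)%N.
    by apply: (sub b a) => //; [rewrite addrC|rewrite jmulC].
  have [r [p [k [fp yE]]]] := IH a y da aa ay.
  have [s [q [l [fq zE]]]] := IH b z db bb bz.
  have [t [f [m [ff E]]]] := jframe_cat k l fp fq ab.
  by exists t, f, m; rewrite eab xyz yE zE.
have [k [c [cc c0 ec xc]]] := jeigen_idem ee ex e0.
have [cE|cE] := eqVneq c e.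
  have xE : x = k *: e by rewrite -ex -{1}cE jmulC xc cE.
  have [pe|npe] := pselect (jprim e).
    exists 1%N, (fun=> e), (fun=> k); rewrite big_ord1; split=> //.
    by split=> [//|i j|]; [rewrite !ord1 eqxx|rewrite big_ord1].
  have [a [b [aa bb a0 b0 eab]]] : exists a b,
      [/\ a • a = a, b • b = b, a != 0, b != 0 & e = a + b].
    apply: contrapT => nex; apply: npe; split=> // a b aa bb eab.
    have [->|a0] := eqVneq a 0; first by left.
    have [->|b0] := eqVneq b 0; first by right.
    by case: nex; exists a, b.
  apply: (glue a b (k *: a) (k *: b)) => //; rewrite ?jmulZr ?aa ?bb //.
  by rewrite -scalerDr -eab.
have [bb cb] := idemB ee cc ec.
apply: (glue c (e - c) (k *: c) (x - k *: c)) => //.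
- by rewrite subr_eq0 eq_sym.
- by rewrite addrC subrK.
- by rewrite jmulZr cc.
- have c0x : c • (x - k *: c) = 0 by rewrite jmulBr jmulC xc jmulZr cc subrr.
  by rewrite jmulBl c0x subr0 jmulBr ex jmulZr ec.
- by rewrite addrC subrK.
Qed.

End Spectral.

(** * The trace *)

Section Trace.
Context {R : realType} {V : euclideanJordanType R}.
Implicit Types (x y z a b c d e : V).

Lemma jprim_idem c : jprim c -> c • c = c.
Proof. by case. Qed.

Lemma jprim_neq0 c : jprim c -> c != 0.
Proof. by case. Qed.

(** A frame of V(c) has only one member: otherwise splitting that member off c would contradict
    primitivity. *)
Lemma jprim_peirce1 c x : jprim c -> c • x = x -> exists k : R, x = k *: c.
Proof.
move=> pc cx; have cc := jprim_idem pc.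
have [r [p [k [fp xE]]]] := jspectral cc cx.
have [r0|[i0 _]] : r = 0%N \/ exists i : 'I_r, True.
- by case: r p k fp xE => [|r] *; [left|right; exists ord0].
- subst r; case: fp => _ _; rewrite big_ord0 => c0.
  by case/negP: (jprim_neq0 pc); rewrite -c0.
have [pp po pe] := fp; have pi0 := jprim_idem (pp i0).
have cp : c • p i0 = p i0 by exact: jframe_unit_mul fp.
have [ci c0] := idemB cc pi0 cp.
have cE : c = p i0.
  case: pc => _ _ /(_ (p i0) (c - p i0) pi0 ci); rewrite addrC subrK => /(_ erefl).
  by case=> [p0|/eqP]; [case/negP: (jprim_neq0 (pp i0));
    rewrite p0|rewrite subr_eq0 => /eqP].
exists (k i0); rewrite xE (bigD1 i0) //= big1 ?addr0 ?cE // => j ji.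
by rewrite -(jframe_unit_mul j fp) cE po ?scaler0 // eq_sym.
Qed.

Lemma jip_quad c d : c • c = c -> d • d = d ->
  ⟨quad c d, d⟩ = 2 * ⟨c • d, c • d⟩ - ⟨c, d⟩.
Proof.
move=> cc dd; rewrite /quad cc jipDl jipNl jipZl jip_selfadj; congr (_ - _).
by rewrite jmulC jip_selfadj dd.
Qed.

(* The two projections have the same coefficient, as [jip_quad] is symmetric. *)
Lemma jprim_norm c d : jprim c -> jprim d -> ⟨c, d⟩ != 0 -> ⟨c, c⟩ = ⟨d, d⟩.
Proof.
move=> pc pd cd0; have cc := jprim_idem pc; have dd := jprim_idem pd.
have coef a b : jprim a -> jprim b -> exists2 k, quad a b = k *: a & ⟨a, b⟩ = k * ⟨a, a⟩.
  move=> pa pb; have aa := jprim_idem pa.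
  have [k kE] := jprim_peirce1 pa (quad_idem_proj b aa); exists k => //.
  rewrite -jipZl -kE /quad aa jipDl jipNl jipZl !jip_selfadj !aa jipC; lra.
have [k kE kc] := coef _ _ pc pd; have [l lE lc] := coef _ _ pd pc.
have Hk := jip_quad cc dd; have Hl := jip_quad dd cc.
rewrite kE jipZl in Hk; rewrite lE jipZl (jmulC d c) in Hl.
have kl : k = l.
  by apply: (mulIf cd0); rewrite Hk (jipC c d) Hl (jipC d c).
have k0 : k != 0 by apply: contraNneq cd0 => k0; rewrite kc k0 mul0r.
by apply: (mulfI k0); rewrite -kc kl -lc jipC.
Qed.

Lemma jframe_exists : exists r (p : 'I_r -> V), jframe junit p.
Proof.
have [r [p [k [fp _]]]] := jspectral (jmul1 junit) (jmul1 (junit : V)).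
by exists r, p.
Qed.

(** Linear in x by construction, but a priori dependent on p. Its value 1 on every primitive
    idempotent forces it to be the sum of the eigenvalues in any decomposition, so [jtrace] is well
    defined and linear. *)
Let tau r (p : 'I_r -> V) x := \sum_i ⟨p i, x⟩ / ⟨p i, p i⟩.

Let tauD r (p : 'I_r -> V) x y : tau p (x + y) = tau p x + tau p y.
Proof.
by rewrite /tau -big_split /=; apply: eq_bigr => i _;
  rewrite jipC jipDl mulrDl !(jipC (p i)).
Qed.

Let tauZ r (p : 'I_r -> V) k x : tau p (k *: x) = k * tau p x.
Proof.
by rewrite /tau mulr_sumr; apply: eq_bigr => i _; rewrite jipC jipZl mulrA (jipC x).
Qed.

(* Only the [p i] not orthogonal to [c] contribute, and these have the norm of [c]. *)
Let tau_prim r (p : 'I_r -> V) c : jframe junit p -> jprim c -> tau p c = 1.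
Proof.
move=> [pp po pe] pc; have c0 := jip_gt0 _ (jprim_neq0 pc).
have -> : tau p c = (\sum_i ⟨p i, c⟩) / ⟨c, c⟩.
  rewrite mulr_suml; apply: eq_bigr => i _.
  by have [->|/(jprim_norm (pp i) pc) ->//] := eqVneq ⟨p i, c⟩ 0; rewrite !mul0r.
have -> : \sum_i ⟨p i, c⟩ = ⟨\sum_i p i, c⟩.
  by rewrite (big_morph (fun x => ⟨x, c⟩) (fun x y => jipDl x y c) (jip0l c)).
by rewrite pe -{1}(jprim_idem pc) jipC jip_sq divff // gt_eqF.
Qed.

Let tau_frame r (p : 'I_r -> V) s (q : 'I_s -> V) (k : 'I_s -> R) e :
  jframe junit p -> jframe e q -> tau p (\sum_i k i *: q i) = \sum_i k i.
Proof.
move=> fp [qq _ _].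
have -> : tau p (\sum_i k i *: q i) = \sum_i tau p (k i *: q i).
  apply: (big_morph (tau p) (tauD p)).
  by rewrite -(scale0r 0) tauZ mul0r.
by apply: eq_bigr => i _; rewrite tauZ (tau_prim fp (qq i)) mulr1.
Qed.

Let jtrace_tau r (p : 'I_r -> V) x : jframe junit p -> jtrace x = tau p x.
Proof.
move=> fp; rewrite /jtrace.
have [s [q [k [fq xE]]]] := jspectral (jmul1 junit) (jmul1 x).
apply: xget_unique.
  exists s, q, k; split; last by rewrite xE (tau_frame _ fp fq).
  by split=> //; apply/jordan_frameE; rewrite ?jmul1.
move=> _ [t [f [m [[/jordan_frameE-/(_ (jmul1 _)) ff ->] ->]]]].
by rewrite (tau_frame _ fp ff).
Qed.

Lemma jtraceD x y : jtrace (x + y) = jtrace x + jtrace y.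
Proof. by have [r [p fp]] := jframe_exists; rewrite !(jtrace_tau _ fp). Qed.

Lemma jtraceZ k x : jtrace (k *: x) = k * jtrace x.
Proof. by have [r [p fp]] := jframe_exists; rewrite !(jtrace_tau _ fp). Qed.

Lemma jtrace_prim c : jprim c -> jtrace c = 1.
Proof. by have [r [p fp]] := jframe_exists; rewrite (jtrace_tau _ fp); exact: tau_prim. Qed.

Lemma jtrace_frame e r (p : 'I_r -> V) (k : 'I_r -> R) : jframe e p ->
  jtrace (\sum_i k i *: p i) = \sum_i k i.
Proof. by have [s [q fq]] := jframe_exists; rewrite (jtrace_tau _ fq);
  exact: tau_frame. Qed.

(* The density of the trace with respect to [jip] lies in the span of every
   frame, hence is central. *)
Let jtrace_density : exists z, (forall x, jtrace x = ⟨z, x⟩) /\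
  (forall x y, z • (x • y) = x • (z • y)).
Proof.
pose dens r (p : 'I_r -> V) := \sum_i ⟨p i, p i⟩^-1 *: p i.
have densE r (p : 'I_r -> V) x : jframe junit p -> ⟨dens r p, x⟩ = jtrace x.
  move=> fp; rewrite (jtrace_tau _ fp) /dens.
  rewrite (big_morph (fun z => ⟨z, x⟩) (fun u v => jipDl u v x) (jip0l x)).
  by apply: eq_bigr => i _; rewrite jipZl mulrC.
have [r [p fp]] := jframe_exists.
exists (dens r p); split=> [x|x y]; first by rewrite densE.
have [s [q [k [fq ->]]]] := jspectral (jmul1 junit) (jmul1 x).
have -> : dens r p = dens s q by apply: jip_inj => v; rewrite !densE.
rewrite /dens !jmul_suml; under eq_bigr do rewrite jmulZl jmul_sumr.
under [RHS]eq_bigr do rewrite jmulZl jmul_sumr.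
under eq_bigr do rewrite scaler_sumr; under [RHS]eq_bigr do rewrite scaler_sumr.
rewrite exchange_big /=; apply: eq_bigr => i _; apply: eq_bigr => j _.
rewrite !(jmulZl, jmulZr) scalerA mulrC -scalerA; congr (_ *: (_ *: _)).
have [qq qo _] := fq; have [->//|ij] := eqVneq i j.
by apply: orth_comm; rewrite ?(jprim_idem (qq _)) // qo // eq_sym.
Qed.

Lemma tipC x y : tip x y = tip y x.
Proof. by rewrite /tip jmulC. Qed.

Lemma tipDl x y z : tip (x + y) z = tip x z + tip y z.
Proof. by rewrite /tip jmulDl jtraceD. Qed.

Lemma tipZl k x y : tip (k *: x) y = k * tip x y.
Proof. by rewrite /tip jmulZl jtraceZ. Qed.

(** The trace form is [jip] twisted by multiplication by a central element, so the associativity of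
    [jip] passes over to it. *)
Lemma tip_selfadj x y z : tip (x • y) z = tip y (x • z).
Proof.
have [w [wE wc]] := jtrace_density; rewrite /tip !wE (jmulC (x • y)).
by rewrite -jip_selfadj jipC jip_selfadj (jmulC z) -wc -jip_selfadj (jmulC w) jip_selfadj.
Qed.

Lemma tip1 x : tip junit x = jtrace x.
Proof. by rewrite /tip jmul1. Qed.

(** By the spectral theorem the value is the sum of the squared eigenvalues. *)
Lemma tip_gt0 x : x != 0 -> 0 < tip x x.
Proof.
have [r [p [k [fp xE]]]] := jspectral (jmul1 junit) (jmul1 x).
have E : tip x x = \sum_i k i ^+ 2.
  rewrite -(jtrace_frame (fun i => k i ^+ 2) fp) /tip; congr jtrace.
  rewrite {2}xE jmul_sumr; apply: eq_bigr => i _.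
  by rewrite jmulZr xE (jframe_sum_mul k i fp) scalerA expr2.
move=> x0; rewrite lt_neqAle E sumr_ge0 ?andbT => [|i _]; last exact: sqr_ge0.
apply: contraNneq x0 => /esym/psumr_eq0P k0.
rewrite xE big1 // => i _; have /eqP := k0 (fun i _ => sqr_ge0 _) i isT.
by rewrite sqrf_eq0 => /eqP ->; rewrite scale0r.
Qed.

End Trace.

(** * Cone, states, norm and maximal eigenvalue *)

Section Cone.
Context {R : realType} {V : euclideanJordanType R}.
Implicit Types (x y z a b c d e w : V).

Lemma tip0l y : ⟪0, y⟫ = 0.
Proof. by rewrite -(scale0r 0) tipZl mul0r. Qed.

Lemma tipNl x y : ⟪- x, y⟫ = - ⟪x, y⟫.
Proof. by rewrite -scaleN1r tipZl mulN1r. Qed.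

Lemma tipBl x y z : ⟪x - y, z⟫ = ⟪x, z⟫ - ⟪y, z⟫.
Proof. by rewrite tipDl tipNl. Qed.

Lemma tipDr x y z : ⟪z, x + y⟫ = ⟪z, x⟫ + ⟪z, y⟫.
Proof. by rewrite tipC tipDl !(tipC z). Qed.

Lemma tipZr k x y : ⟪y, k *: x⟫ = k * ⟪y, x⟫.
Proof. by rewrite tipC tipZl tipC. Qed.

Lemma tipNr x y : ⟪y, - x⟫ = - ⟪y, x⟫.
Proof. by rewrite tipC tipNl tipC. Qed.

Lemma tipBr x y z : ⟪z, x - y⟫ = ⟪z, x⟫ - ⟪z, y⟫.
Proof. by rewrite tipDr tipNr. Qed.

Lemma tip_suml (I : Type) (s : seq I) (P : pred I) (F : I -> V) y :
  ⟪\sum_(i <- s | P i) F i, y⟫ = \sum_(i <- s | P i) ⟪F i, y⟫.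
Proof. by apply: (big_morph (fun x => ⟪x, y⟫) _ (tip0l y)) => u v; exact: tipDl. Qed.

Lemma tip_sumr (I : Type) (s : seq I) (P : pred I) (F : I -> V) y :
  ⟪y, \sum_(i <- s | P i) F i⟫ = \sum_(i <- s | P i) ⟪y, F i⟫.
Proof. by rewrite tipC tip_suml; apply: eq_bigr => i _; rewrite tipC. Qed.

Lemma tip_eq0 x : ⟪x, x⟫ = 0 -> x = 0.
Proof. by move=> xx; apply: contraTeq isT => /tip_gt0; rewrite xx ltxx. Qed.

Lemma tip_ge0 x : 0 <= ⟪x, x⟫.
Proof. by have [->|/tip_gt0/ltW//] := eqVneq x 0; rewrite tip0l. Qed.

Lemma tip_inj x y : (forall v, ⟪x, v⟫ = ⟪y, v⟫) -> x = y.
Proof.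
by move=> E; apply/eqP; rewrite -subr_eq0; apply/eqP/tip_eq0; rewrite tipBl E subrr.
Qed.

(* On the eigenvalues 0, 1/2, 1 of the multiplication L by [c] one has
   L - L^2 = 4 (L - L^2)^2. *)
Lemma idem_tip_le c x : c • c = c -> ⟪c • x, c • x⟫ <= ⟪c • x, x⟫.
Proof.
move=> cc; have := idem_poly x cc; set y := c • x; set z := c • y => H.
have H1 := congr1 (fun v => ⟪v, x⟫) H; have H2 := congr1 (fun v => ⟪v, y⟫) H.
move: H1 H2; rewrite !tipDl !tipZl !tip_selfadj -/y -/z => H1 H2.
have := tip_ge0 (y - z); rewrite tipBl !tipBr (tipC z y) => H3.
have E1 : ⟪y, z⟫ = ⟪z, y⟫ by rewrite tipC.
have E2 : ⟪x, y⟫ = ⟪y, x⟫ by rewrite tipC.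
have E3 : ⟪x, z⟫ = ⟪y, y⟫ by rewrite /z -tip_selfadj.
have E4 : ⟪y, c • z⟫ = ⟪z, z⟫ by rewrite -tip_selfadj.
have E5 : ⟪x, c • z⟫ = ⟪y, z⟫ by rewrite -tip_selfadj.
by rewrite ?E4 ?E5 ?E3 -?tip_selfadj -/y -/z ?E1 ?E2 ?E3 in H1 H2 H3 *; lra.
Qed.

Lemma idem_tip_ge0 c x : c • c = c -> 0 <= ⟪c, x • x⟫.
Proof.
move=> cc; rewrite (tipC c) tip_selfadj (jmulC x c) (tipC x).
exact: le_trans (tip_ge0 _) (idem_tip_le x cc).
Qed.

Lemma jprim_tip c : jprim c -> ⟪c, c⟫ = 1.
Proof. by move=> pc; rewrite /tip (jprim_idem pc) jtrace_prim. Qed.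

Lemma jframe_tip e r (p : 'I_r -> V) i j : jframe e p -> ⟪p i, p j⟫ = (i == j)%:R.
Proof.
move=> [pp po _]; have [->|ij] := eqVneq i j; first by rewrite jprim_tip.
by rewrite /tip po // -(scale0r 0) jtraceZ mul0r.
Qed.

Lemma jframe_coef e r (p : 'I_r -> V) (k : 'I_r -> R) i : jframe e p ->
  ⟪\sum_j k j *: p j, p i⟫ = k i.
Proof.
move=> fp; rewrite tip_suml (bigD1 i) //= big1 ?addr0.
  by rewrite tipZl (jframe_tip _ _ fp) eqxx mulr1.
by move=> j ji; rewrite tipZl (jframe_tip _ _ fp) (negbTE ji) mulr0.
Qed.

Lemma jframe_mul e r (p : 'I_r -> V) (k l : 'I_r -> R) : jframe e p ->
  (\sum_j k j *: p j) • (\sum_j l j *: p j) = \sum_j (k j * l j) *: p j.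
Proof.
move=> fp; rewrite jmul_sumr; apply: eq_bigr => i _.
by rewrite jmulZr (jframe_sum_mul _ _ fp) scalerA mulrC.
Qed.

Lemma jframe_nonneg_cone e r (p : 'I_r -> V) (k : 'I_r -> R) : jframe e p ->
  (forall i, 0 <= k i) -> cone (\sum_j k j *: p j).
Proof.
move=> fp k0; exists (\sum_j Num.sqrt (k j) *: p j) => //.
by rewrite (jframe_mul _ _ fp); apply: eq_bigr => i _; rewrite -expr2 sqr_sqrtr.
Qed.

Lemma jspectralT x :
  exists r (p : 'I_r -> V) (k : 'I_r -> R), jframe junit p /\ x = \sum_i k i *: p i.
Proof. by apply: jspectral; rewrite jmul1. Qed.

Lemma cone_tip_idem x c : cone x -> c • c = c -> 0 <= ⟪x, c⟫.
Proof. by move=> [z _ <-] cc; rewrite tipC idem_tip_ge0. Qed.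

Lemma jframe_cone_coef e r (p : 'I_r -> V) (k : 'I_r -> R) : jframe e p ->
  cone (\sum_j k j *: p j) -> forall i, 0 <= k i.
Proof.
move=> fp kp i; rewrite -(jframe_coef k i fp); apply: cone_tip_idem => //.
by have [pp _ _] := fp; exact: jprim_idem.
Qed.

(** The eigenvalues of x are its pairings with the members of a frame, so primitive idempotents
    suffice as tests. Closure of the cone under sums, not visible in its definition by squares,
    follows. *)
Lemma cone_self_dual x : (forall c, jprim c -> 0 <= ⟪x, c⟫) -> cone x.
Proof.
have [r [p [k [fp ->]]]] := jspectralT x => H.
apply: (jframe_nonneg_cone fp) => i; rewrite -(jframe_coef k i fp); apply: H.
by have [pp _ _] := fp.
Qed.

Lemma coneD x y : cone x -> cone y -> cone (x + y).
Proof.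
move=> cx cy; apply: cone_self_dual => c pc.
by rewrite tipDl addr_ge0 // cone_tip_idem // jprim_idem.
Qed.

Lemma coneZ k x : 0 <= k -> cone x -> cone (k *: x).
Proof.
move=> k0 cx; apply: cone_self_dual => c pc.
by rewrite tipZl mulr_ge0 // cone_tip_idem // jprim_idem.
Qed.

Lemma cone_idem c : c • c = c -> cone c.
Proof. by move=> cc; exists c. Qed.

Lemma cone0 : cone (0 : V).
Proof. by exists 0 => //; rewrite jmul0. Qed.

Lemma quad_selfadj c x y : ⟪quad c x, y⟫ = ⟪x, quad c y⟫.
Proof.
by rewrite /quad tipBl tipBr tipZl tipZr !tip_selfadj.
Qed.

Lemma quadD c x y : quad c (x + y) = quad c x + quad c y.
Proof. by rewrite /quad !jmulDr scalerDr opprD addrACA. Qed.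

Lemma quadZ c k x : quad c (k *: x) = k *: quad c x.
Proof. by rewrite /quad !jmulZr scalerBr !scalerA mulrC. Qed.

Lemma quadN c x : quad c (- x) = - quad c x.
Proof. by rewrite -scaleN1r quadZ scaleN1r. Qed.

(** An eigenvalue of [quad c x] in V(c) is ⟪quad c x, p i⟫ = ⟪x, p i⟫, because [quad c] is
    self-adjoint and fixes p i. *)
Lemma cone_quad c x : c • c = c -> cone x -> cone (quad c x).
Proof.
move=> cc cx; have [r [p [k [fp xE]]]] := jspectral cc (quad_idem_proj x cc).
rewrite xE; apply: (jframe_nonneg_cone fp) => i; rewrite -(jframe_coef k i fp) -xE.
rewrite quad_selfadj quad_peirce1 ?(jframe_unit_mul _ fp) //.
by apply: cone_tip_idem => //; have [pp _ _] := fp; exact: jprim_idem.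
Qed.

(** The pairing is a sum of nonnegative terms, so each p i with nonzero coefficient satisfies ⟪c, p
    i⟫ = 0; by [idem_tip_le] this is a bound for the squared length of c • p i. *)
Lemma cone_orth x c : cone x -> c • c = c -> ⟪x, c⟫ = 0 -> c • x = 0.
Proof.
move=> cx cc; have [r [p [k [fp xE]]]] := jspectralT x.
have [pp _ _] := fp; have k0 : forall i, 0 <= k i by apply: (jframe_cone_coef fp);
  rewrite -xE.
 rewrite xE tip_suml => /psumr_eq0P H.
rewrite jmul_sumr big1 // => i _; rewrite jmulZr.
have [->|ki] := eqVneq (k i) 0; first by rewrite scale0r.
have pi0 : ⟪c, p i⟫ = 0.
  have : k i * ⟪p i, c⟫ = 0.
    rewrite -tipZl; apply: H => // j _; rewrite tipZl mulr_ge0 //.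
    by apply: cone_tip_idem => //; apply/cone_idem/jprim_idem.
  by move/eqP; rewrite mulf_eq0 (negbTE ki) /= tipC => /eqP.
suff -> : c • p i = 0 by rewrite scaler0.
apply/tip_eq0/le_anti; rewrite tip_ge0 andbT (le_trans (idem_tip_le _ cc)) //.
by rewrite jmulC tip_selfadj (jprim_idem (pp i)) pi0.
Qed.

Lemma state_spaceE w : state_space w <-> cone w /\ jtrace w = 1.
Proof. by rewrite /state_space /= tip1. Qed.

Lemma state_tip1 w : state_space w -> ⟪junit, w⟫ = 1.
Proof. by case. Qed.

Lemma jprim_state c : jprim c -> state_space c.
Proof.
move=> pc; apply/state_spaceE; rewrite jtrace_prim //; split=> //.
exact/cone_idem/jprim_idem.
Qed.

Lemma jframe_state_le e r (p : 'I_r -> V) w (k : 'I_r -> R) M : jframe e p ->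
  state_space w -> e • w = w -> (forall i, k i <= M) ->
  ⟪\sum_j k j *: p j, w⟫ <= M.
Proof.
move=> fp [cw w1] ew kM; have [pp _ pe] := fp.
have we : ⟪e, w⟫ = 1 by rewrite -[in LHS](jmulr1 e) tip_selfadj ew.
rewrite -[M]mulr1 -we -pe tip_suml mulr_sumr tip_suml; apply: ler_sum => i _.
rewrite tipZl ler_wpM2r // tipC cone_tip_idem //; exact: jprim_idem.
Qed.

Lemma jframe_inhabited e r (p : 'I_r -> V) : jframe e p -> e != 0 ->
  exists i : 'I_r, True.
Proof.
case: r p => [|r] p [_ _ pe] e0; last by exists ord0.
by case/negP: e0; rewrite -pe big_ord0.
Qed.

Lemma fin_argmax r (k : 'I_r -> R) (i0 : 'I_r) : exists i, forall j, k j <= k i.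
Proof.
by case: (@arg_maxP _ _ _ i0 predT k isT) => i _ H; exists i => j; exact: H.
Qed.

Lemma spectral_max_eigenvalue e x r (p : 'I_r -> V) (k : 'I_r -> R) M :
  jframe e p -> x = \sum_i k i *: p i -> (forall i, k i <= M) ->
  (exists i, k i = M) -> max_eigenvalue e x = M.
Proof.
move=> fp xE kM [i kiM]; have ee := jframe_idem fp.
have inM : spectrum_in e x M.
  by exists r, p, k; split; [split=> //; exact/jordan_frameE|exists i].
have ubM : ubound (spectrum_in e x) M.
  move=> _ [s [q [l [[/(jordan_frameE _ ee) fq xE'] [j ->]]]]].
  rewrite -(jframe_coef l j fq) -xE' xE; apply: (jframe_state_le fp) => //.
    by apply: jprim_state; have [] := fq.
  exact: jframe_unit_mul fq.
apply/le_anti/andP; split; first by apply: ge_sup => //; exists M.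
by apply: ub_le_sup => //; exists M.
Qed.

(** The variational form of the maximal eigenvalue; the later limit arguments work with states
    rather than with spectra. *)
Lemma max_eigenvalueP e x : e • e = e -> e != 0 -> e • x = x ->
  (exists c, [/\ jprim c, e • c = c & max_eigenvalue e x = ⟪x, c⟫]) /\
  (forall w, state_space w -> e • w = w -> ⟪x, w⟫ <= max_eigenvalue e x).
Proof.
move=> ee e0 ex; have [r [p [k [fp xE]]]] := jspectral ee ex.
have [i0 _] := jframe_inhabited fp e0; have [i ki] := fin_argmax k i0.
have E : max_eigenvalue e x = k i.
  by apply: (spectral_max_eigenvalue fp xE) => //; exists i.
split; last by move=> w sw ew; rewrite E xE; exact: (jframe_state_le fp).
exists (p i); rewrite E xE (jframe_coef k i fp); split=> //; first by have [] := fp.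
exact: jframe_unit_mul fp.
Qed.

Lemma unorm_spectral x r (p : 'I_r -> V) (k : 'I_r -> R) M :
  jframe junit p -> x = \sum_i k i *: p i -> (forall i, `|k i| <= M) ->
  (exists i, `|k i| = M) -> unorm x = M.
Proof.
move=> fp xE kM [i kiM].
have [_ _ pe] := fp.
have jleE (l : R) : (0 <= l /\ jle (- (l *: junit)) x /\ jle x (l *: junit)) <->
    forall j, `|k j| <= l.
  have E1 : x - - (l *: junit) = \sum_j (k j + l) *: p j.
    rewrite opprK xE -pe scaler_sumr -big_split; apply: eq_bigr => j _.
    by rewrite scalerDl.
  have E2 : l *: junit - x = \sum_j (l - k j) *: p j.
    rewrite xE -pe scaler_sumr -sumrB; apply: eq_bigr => j _.
    by rewrite scalerBl.
  rewrite /jle E1 E2; split=> [[l0 [/(jframe_cone_coef fp) h1 /(jframe_cone_coef fp) h2]]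
    j|h].
    by rewrite ler_norml; have := h1 j; have := h2 j; rewrite subr_ge0 => -> /=; lra.
  split; first exact: le_trans (normr_ge0 _) (h i).
  by split; apply: (jframe_nonneg_cone fp) => j; have := h j; rewrite ler_norml; lra.
rewrite /unorm; set A := [set _ | _].
have AM : A M by apply/jleE.
have lbM : lbound A M by move=> l /jleE /(_ i); rewrite kiM.
apply/le_anti/andP; split; first by apply: ge_inf => //; exists M.
by apply: lb_le_inf => //; exists M.
Qed.

Lemma unormP x : (exists2 c, jprim c & `|⟪x, c⟫| = unorm x) /\
  (forall w, state_space w -> `|⟪x, w⟫| <= unorm x).
Proof.
have [r [p [k [fp xE]]]] := jspectralT x; have [pp _ _] := fp.
have [i0 _] := jframe_inhabited fp junit_neq0.
have [i ki] := fin_argmax (fun i => `|k i|) i0.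
have E : unorm x = `|k i| by apply: (unorm_spectral fp xE) => //; exists i.
split; first by exists (p i) => //; rewrite E xE (jframe_coef k i fp).
move=> w sw; rewrite E xE ler_norml; apply/andP; split; last first.
  apply: (jframe_state_le fp) => //; first by rewrite jmul1.
  by move=> j; rewrite (le_trans _ (ki j)) // ler_norm.
rewrite lerNl -tipNl -sumrN; under eq_bigr do rewrite -scaleNr.
apply: (jframe_state_le fp) => //; first by rewrite jmul1.
by move=> j; rewrite (le_trans _ (ki j)) // -normrN ler_norm.
Qed.

Lemma unorm_ge0 x : 0 <= unorm x.
Proof. by have [[c _ <-] _] := unormP x. Qed.

Lemma unorm0 : unorm (0 : V) = 0.
Proof. by have [[c _ <-] _] := unormP (0 : V); rewrite tip0l normr0. Qed.

Lemma unormN x : unorm (- x) = unorm x.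
Proof.
apply/le_anti/andP; split.
  by have [[c pc <-] _] := unormP (- x); rewrite tipNl normrN; apply: (unormP x).2;
    exact: jprim_state.
by have [[c pc <-] _] := unormP x; rewrite -normrN -tipNl; apply: (unormP _).2;
  exact: jprim_state.
Qed.

Lemma unorm_eq0 x : unorm x = 0 -> x = 0.
Proof.
move=> x0; have [r [p [k [fp xE]]]] := jspectralT x; have [pp _ _] := fp.
rewrite xE big1 // => i _; have := (unormP x).2 _ (jprim_state (pp i)).
by rewrite x0 {1}xE (jframe_coef k i fp) normr_le0 => /eqP ->; rewrite scale0r.
Qed.

End Cone.

(** * Convergence in V along ultrafilters *)

Section UltraCvg.

(** If F misses a neighbourhood W of the limit, some ultrafilter refining F contains the complement
    of the preimage of W. *)
Lemma cvg_ultra (T : Type) (X : topologicalType) (F : set_system T) (f : T -> X) (l : X) :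
  Filter F ->
  (forall U : set_system T, UltraFilter U -> F `<=` U -> f t @[t --> U] --> l) ->
  f t @[t --> F] --> l.
Proof.
move=> FF H W Wl; apply: contrapT => nFW.
have PF : ProperFilter (within (~` (f @^-1` W)) F).
  apply: Build_ProperFilter => // E; apply: nFW.
  by apply: (@filterS _ F _ _ _ _ E) => t h; apply: contrapT => /h.
have [U [UU FU]] := ultraFilterLemma PF.
have FU' : F `<=` U by apply: subset_trans FU => A FA; apply: filterS FA => t At _.
have UW : U (f @^-1` W) by exact: H.
have UnW : U (~` (f @^-1` W)) by apply: FU;
  exact: (@filterS _ F _ setT _ (fun t _ h => h) filterT).
by have [t [? ?]] := @filter_ex _ U _ _ (@filterI _ U _ _ _ UW UnW).
Qed.

Lemma within_nbhs_ultra (X : topologicalType) (A : set X) (x : X) (U : set_system X) :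
  within A (nbhs x) `<=` U -> U A /\ U --> x.
Proof.
move=> FU; split.
  by apply: FU; exact: (@filterS _ (nbhs x) _ setT _ (fun t _ a => a) filterT).
by move=> W Wx; apply: FU; apply: (@filterS _ (nbhs x) _ W _ _ Wx) => t Wt _.
Qed.

Lemma closure_ultra (X : topologicalType) (A : set X) (x : X) : closure A x ->
  exists U : set_system X, [/\ UltraFilter U, U A & U --> x].
Proof.
move=> cA; have PF : ProperFilter (within A (nbhs x)) by exact: within_nbhs_proper.
have [U [UU /within_nbhs_ultra[UA Ux]]] := ultraFilterLemma PF.
by exists U.
Qed.

Lemma eq_near_cvg (T : Type) (X : topologicalType) (F : set_system T) (f g : T ->
  X) (l : X) :
  Filter F -> (\forall t \near F, f t = g t) ->
  f t @[t --> F] --> l -> g t @[t --> F] --> l.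
Proof.
move=> FF fg fl W Wl; have fW := fl W Wl.
by apply: (@filterS2 _ F _ _ _ _ _ fg fW) => t; rewrite /= => ->.
Qed.

(** Compactness of the segment supplies a cluster point, and a cluster point of an ultrafilter is a
    limit. *)
Lemma ultra_cvg_bounded (R : realType) (T : Type) (U : set_system T) (f : T ->
  R) (a b : R) :
  UltraFilter U -> (\forall t \near U, a <= f t <= b) ->
  exists2 l, a <= l <= b & f t @[t --> U] --> l.
Proof.
move=> UU fM.
have [l []] := @segment_compact _ a b (f @ U) _ fM.
rewrite /= in_itv /= => lab cl; exists l => // W Wl.
have [//|nW] := in_ultra_setVsetC (f @^-1` W) UU.
by have [x [/= nx Wx]] := cl (~` W) W nW Wl.
Qed.

Lemma cvg_initialE (S : choiceType) (X : topologicalType) (f : S -> X)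
    (F : set_system S) (s : S) : Filter F ->
  F --> (s : initial_topology f) <-> f t @[t --> F] --> f s.
Proof.
move=> FF; split=> [Fs|Ff W].
  apply: cvg_trans (cvg_app f Fs) _; exact: (@initial_continuous S X f).
rewrite /= (@nbhsE (initial_topology f)) => -[B [[C oC CB] Bs] BW].
rewrite nbhs_filterE; apply: filterS BW _; rewrite -CB; apply: Ff.
by apply: open_nbhs_nbhs; split=> //; rewrite -CB in Bs.
Qed.

Lemma cvg_ptwsE (I : choiceType) (X : topologicalType) (T : Type) (F : set_system T)
    (f : T -> {ptws I -> X}) (g : {ptws I -> X}) : Filter F ->
  f t @[t --> F] --> g <-> forall i, f t i @[t --> F] --> g i.
Proof.
move=> FF; rewrite cvg_sup; split=> H i; have := H i.
  by move=> /cvg_initialE; apply.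
by move=> {}H; apply/cvg_initialE.
Qed.

Lemma cvg_rsum (R : realType) (T I : Type) (F : set_system T) (s : seq I) (P : pred I)
    (f : I -> T -> R) (l : I -> R) : Filter F ->
  (forall i, f i t @[t --> F] --> l i) ->
  \sum_(i <- s | P i) f i t @[t --> F] --> \sum_(i <- s | P i) l i.
Proof.
move=> FF H; elim: s => [|i s IH].
  by under eq_fun do rewrite big_nil; rewrite big_nil; exact: cvg_cst.
under eq_fun do rewrite big_cons; rewrite big_cons; case: (P i) => //.
by apply: cvgD.
Qed.

End UltraCvg.

Section Convergence.
Context {R : realType} {V : euclideanJordanType R}.
Implicit Types (x y z a b c d e w l : V).

(** Pairing with the basis vectors is an injective linear map between spaces of equal dimension,
    hence onto; a is a preimage of the values of f on the basis. *)
Lemma tip_riesz (f : {linear V -> R^o}) : exists a, forall x, f x = ⟪a, x⟫.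
Proof.
pose n : nat := \dim {:V}.
pose G (v : V) : 'rV[R]_n := \row_i ⟪v, (vbasis {:V})`_i⟫.
have Glin : linear G.
  by move=> k u v; apply/rowP => i; rewrite !mxE tipDl tipZl.
pose GL : {linear V -> 'rV[R]_n} := HB.pack G (GRing.isLinear.Build _ _ _ _ G Glin).
pose h := linfun GL.
have hE v : h v = G v by rewrite lfunE.
have basis_sep v : (forall i, ⟪v, (vbasis {:V})`_i⟫ = 0) -> v = 0.
  move=> v0; apply: tip_eq0; rewrite {2}(coord_vbasis (memvf v)) tip_sumr big1 // => i _.
  by rewrite tipZr v0 mulr0.
have kh : lker h == 0%VS.
  apply/lker0P => u v; rewrite !hE => /rowP E; apply/eqP; rewrite -subr_eq0; apply/eqP.
  apply: basis_sep => i; have [ltin|] := ltnP i n.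
    by have := E (Ordinal ltin); rewrite !mxE /= tipBl => ->; rewrite subrr.
  by move=> leni; rewrite nth_default ?size_tuple // tipC tip0l.
have hf : limg h = fullv.
  apply/eqP; rewrite eqEdim subvf /= limg_dim_eq ?(eqP kh) ?capv0 //.
  by rewrite [X in (X <= _)%N]dimvf dim_matrix [X in (X <= _)%N]mul1n.
have : (\row_i f (vbasis {:V})`_i : 'rV[R]_n) \in limg h by rewrite hf memvf.
case/memv_imgP => a _; rewrite hE => /rowP E; exists a => x.
rewrite (coord_vbasis (memvf x)) linear_sum tip_sumr; apply: eq_bigr => i _.
by rewrite linearZ tipZr; congr (_ * _); have := E i; rewrite !mxE.
Qed.

Lemma coord_tip : exists g : 'I_(\dim {:V}) -> V,
  forall x i, coord (vbasis {:V}) i x = ⟪g i, x⟫.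
Proof.
have H i : exists a, forall x, coord (vbasis {:V}) i x = ⟪a, x⟫.
  pose f : V -> R^o := coord (vbasis {:V}) i.
  have flin : linear f by move=> k u v; rewrite /f linearP.
  pose FL : {linear V -> R^o} := HB.pack f (GRing.isLinear.Build _ _ _ _ f flin).
  exact: (tip_riesz FL).
by have [g gE] := choice H; exists g => x i; rewrite gE.
Qed.

(** Convergence tested by the trace form. By [jcvgE] it is convergence in [fdtop V], but all limits
    become limits of reals. *)
Definition jcvg (T : Type) (F : set_system T) (f : T -> V) (l : V) : Prop :=
  forall y, ⟪f t, y⟫ @[t --> F] --> ⟪l, y⟫.

Section Filt.
Context {T : Type} {F : set_system T} {FF : Filter F}.
Implicit Types f g : T -> V.

Lemma jcvgE f l : (f t : fdtop V) @[t --> F] --> (l : fdtop V) <-> jcvg F f l.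
Proof.
have [g gE] := coord_tip.
rewrite cvg_initialE; split=> [H y|H].
  have Hi i : coord (vbasis {:V}) i (f t) @[t --> F] --> coord (vbasis {:V}) i l.
    move=> W Wl; have := H [set M : 'rV[R]_(\dim {:V}) | W (M 0 i)] _.
    move=> /= HW; have : \forall t \near F, W ((\row_j coord (vbasis {:V}) j (f t)) 0 i).
      apply: HW; exists (fun (_ : 'I_1) j => if j == i then W else setT) =>
        [a j|M /(_ 0 i)].
        by rewrite !mxE; case: eqP => [->|_] //; exact: filterT.
      by rewrite eqxx.
    by apply: filterS => t; rewrite mxE.
  have E v : ⟪v, y⟫ = \sum_i coord (vbasis {:V}) i v * ⟪(vbasis {:V})`_i, y⟫.
    rewrite {1}(coord_vbasis (memvf v)) tip_suml; apply: eq_bigr => i _.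
    by rewrite tipZl.
  under eq_fun do rewrite E; rewrite E.
  by apply: cvg_rsum => i; apply: cvgM => //; exact: cvg_cst.
move=> W [P Pl PW]; rewrite nbhs_filterE /=.
suff : \forall t \near F, forall i, P 0 i (coord (vbasis {:V}) i (f t)).
  by apply: filterS => t Pt; apply: PW => a i; rewrite ord1 mxE.
apply: filter_forall => i; have := Pl 0 i; rewrite mxE gE tipC => /(H (g i)) Hi.
by apply: (@filterS _ F _ _ _ _ Hi) => t; rewrite /= gE tipC.
Qed.

Lemma jcvg_unique f l l' : ProperFilter F -> jcvg F f l -> jcvg F f l' -> l = l'.
Proof.
move=> PF H H'; apply: tip_inj => v; exact: (cvg_unique (@Rhausdorff R) (H v) (H' v)).
Qed.

Lemma jcvg_cst l : jcvg F (fun=> l) l.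
Proof. by move=> y; exact: cvg_cst. Qed.

Lemma jcvgD f g l m : jcvg F f l -> jcvg F g m -> jcvg F (fun t => f t + g t) (l + m).
Proof.
move=> H H' y; rewrite tipDl; under eq_fun do rewrite tipDl; exact: cvgD.
Qed.

Lemma jcvgN f l : jcvg F f l -> jcvg F (fun t => - f t) (- l).
Proof.
move=> H y; rewrite tipNl; under eq_fun do rewrite tipNl; exact: cvgN.
Qed.

Lemma jcvgZ (k : T -> R) (k' : R) f l : k t @[t --> F] --> k' -> jcvg F f l ->
  jcvg F (fun t => k t *: f t) (k' *: l).
Proof.
move=> H H' y; rewrite tipZl; under eq_fun do rewrite tipZl; exact: cvgM.
Qed.

Lemma jcvg_sum (I : Type) (s : seq I) (P : pred I) (f : I -> T -> V) (l : I -> V) :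
  (forall i, jcvg F (f i) (l i)) ->
  jcvg F (fun t => \sum_(i <- s | P i) f i t) (\sum_(i <- s | P i) l i).
Proof.
move=> H y; rewrite tip_suml; under eq_fun do rewrite tip_suml.
by apply: cvg_rsum => i; exact: H.
Qed.

Lemma cvg_tip f g l m : jcvg F f l -> jcvg F g m ->
  ⟪f t, g t⟫ @[t --> F] --> ⟪l, m⟫.
Proof.
move=> H H'; have [h hE] := coord_tip.
have E u v : ⟪u, v⟫ = \sum_i ⟪v, h i⟫ * ⟪u, (vbasis {:V})`_i⟫.
  rewrite {1}(coord_vbasis (memvf v)) tip_sumr; apply: eq_bigr => i _.
  by rewrite tipZr hE (tipC (h i)).
under eq_fun do rewrite E; rewrite E.
by apply: cvg_rsum => i; apply: cvgM; [exact: H'|exact: H].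
Qed.

Lemma jcvg_mul f g l m : jcvg F f l -> jcvg F g m ->
  jcvg F (fun t => f t • g t) (l • m).
Proof.
move=> H H' y; rewrite tip_selfadj; under eq_fun do rewrite tip_selfadj.
apply: cvg_tip => // z; rewrite jmulC tip_selfadj.
by under eq_fun do rewrite jmulC tip_selfadj; exact: H.
Qed.

Lemma jcvg_quad f g l m : jcvg F f l -> jcvg F g m ->
  jcvg F (fun t => quad (f t) (g t)) (quad l m).
Proof.
move=> H H'; rewrite /quad; apply: jcvgD; last first.
  by apply: jcvgN; apply: jcvg_mul => //; exact: jcvg_mul.
by apply: jcvgZ; [exact: cvg_cst|apply: jcvg_mul => //; exact: jcvg_mul].
Qed.

End Filt.

Lemma ultra_jcvg_bounded (T : Type) (U : set_system T) (f : T -> V) (M : V -> R) :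
  UltraFilter U -> (forall y, \forall t \near U, `|⟪f t, y⟫| <= M y) ->
  exists l, jcvg U f l.
Proof.
move=> UU fM; have [g gE] := coord_tip.
have H i : exists k : R, ⟪f t, g i⟫ @[t --> U] --> k.
  have [|k _ kl] := @ultra_cvg_bounded R T U (fun t => ⟪f t, g i⟫) (- M (g i)) (M (g i)) UU.
    by apply: filterS (fM (g i)) => t; rewrite ler_norml.
  by exists k.
have [k kl] := choice H.
exists (\sum_i k i *: (vbasis {:V})`_i).
have -> : f = fun t => \sum_i ⟪f t, g i⟫ *: (vbasis {:V})`_i.
  apply: funext => t; rewrite {1}(coord_vbasis (memvf (f t))).
  by apply: eq_bigr => i _; rewrite gE tipC.
by apply: jcvg_sum => i; apply: jcvgZ => //; exact: jcvg_cst.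
Qed.

Lemma ultra_jcvg_state (T : Type) (U : set_system T) (f : T -> V) :
  UltraFilter U -> (\forall t \near U, state_space (f t)) ->
  exists2 l, state_space l & jcvg U f l.
Proof.
move=> UU sf.
have [|l fl] := @ultra_jcvg_bounded T U f unorm UU.
  by move=> y; apply: filterS sf => t sft; rewrite tipC; apply: (unormP y).2.
exists l => //; split.
  apply: cone_self_dual => c pc; apply: (cvgr_to_ge (fl c)).
  by apply: filterS sf => t [ct _]; apply: cone_tip_idem => //; exact: jprim_idem.
rewrite tipC; apply: (cvg_unique (@Rhausdorff R) (fl junit)).
by apply: cvg_near_cst; apply: filterS sf => t [_ <-]; rewrite tipC.
Qed.

End Convergence.

(** * The exponential of the maximal eigenvalue of z + log a *)

Section ExpMax.
Context {R : realType} {V : euclideanJordanType R}.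
Implicit Types (x y z b c d e w : V).

Section Psum.
Context {n : nat} {p : 'I_n -> V} (fp : jframe junit p).
Implicit Types I J : {set 'I_n}.

Lemma psum_mul I (k : 'I_n -> R) :
  psum p I • (\sum_i k i *: p i) = \sum_(i in I) k i *: p i.
Proof.
rewrite jmul_sumr big_mkcond [RHS]big_mkcond; apply: eq_bigr => i _ /=.
rewrite jmulZr /psum jmul_suml; have [pp po _] := fp; case: ifP => iI.
  rewrite (bigD1 i) //= big1 ?addr0 ?(jprim_idem (pp i)) // => j /andP[_ ji].
  exact: po.
rewrite big1 ?scaler0 // => j jI; apply: po.
by apply: contraTneq jI => ->; rewrite iI.
Qed.

Lemma psum_mul1 I i : psum p I • p i = if i \in I then p i else 0.
Proof.
have -> : p i = \sum_j (j == i)%:R *: p j.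
  rewrite (bigD1 i) //= eqxx scale1r big1 ?addr0 // => j /negbTE ->.
  by rewrite scale0r.
rewrite psum_mul; case: ifP => iI.
  rewrite [RHS](bigD1 i) //= [X in _ + X]big1; last by move=> j /negbTE ->; rewrite scale0r.
  rewrite (bigD1 i) //= [X in _ + X]big1 // => j /andP[_ /negbTE ->].
  by rewrite scale0r.
by rewrite big1 // => j jI; case: eqP => [E|_]; rewrite ?scale0r //; rewrite E iI in jI.
Qed.

Lemma psum_idem I : psum p I • psum p I = psum p I.
Proof.
by rewrite {2}/psum jmul_sumr; apply: eq_bigr => i iI; rewrite psum_mul1 iI.
Qed.

(** A state orthogonal to the idempotent p i is annihilated by it ([cone_orth]), so a state that
    vanishes on the frame outside I lives in V(p_I). *)
Lemma psum_state_mul I w : state_space w ->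
  (forall i, i \notin I -> ⟪w, p i⟫ = 0) <-> psum p I • w = w.
Proof.
move=> [cw w1]; have [pp po pe] := fp; split=> [wI|<- i iI]; last first.
  by rewrite tip_selfadj psum_mul1 (negbTE iI) tipC tip0l.
rewrite -[RHS]jmul1 -pe !jmul_suml [LHS]big_mkcond; apply: eq_bigr => i _.
case: ifPn => // iI; rewrite cone_orth ?wI //; exact: jprim_idem.
Qed.

Lemma psum_neq0 I i : i \in I -> psum p I != 0.
Proof.
move=> iI; apply: contraTneq (jprim_neq0 (let: And3 pp _ _ := fp in pp i)) => I0.
by have := psum_mul1 I i; rewrite iI I0 jmul0 => <-; rewrite eqxx.
Qed.

Lemma psum_sum_peirce1 I (k : 'I_n -> R) :
  psum p I • (\sum_(i in I) k i *: p i) = \sum_(i in I) k i *: p i.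
Proof.
by rewrite jmul_sumr; apply: eq_bigr => i iI; rewrite jmulZr psum_mul1 iI.
Qed.

Lemma state_tip_ge0 w i : state_space w -> 0 <= ⟪w, p i⟫.
Proof.
by move=> [cw _]; apply: cone_tip_idem => //; have [pp _ _] := fp; exact: jprim_idem.
Qed.

Lemma state_tip_sum w : state_space w -> \sum_i ⟪w, p i⟫ = 1.
Proof. by move=> sw; rewrite -tip_sumr; have [_ _ ->] := fp; rewrite tipC state_tip1. Qed.

End Psum.

(* With the convention 0 `^ 0 = 1, the supremum of [weight p a z] over the
   states is exp (Lambda (z + log a)), where a = sum_i a_i p_i may be singular:
   it then lives on the support of a. *)
Definition weight n (p : 'I_n -> V) (a : 'I_n -> R) z w : R :=
  expR ⟪w, z⟫ * \prod_i (a i `^ ⟪w, p i⟫).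

Definition expmax n (p : 'I_n -> V) (a : 'I_n -> R) z : R :=
  sup [set weight p a z w | w in state_space].

(** Singles out the states living in V(e), for e the support projection of a ([supportedE]); they
    are those of positive weight. *)
Definition supported n (p : 'I_n -> V) (a : 'I_n -> R) w : Prop :=
  forall i, a i = 0 -> ⟪w, p i⟫ = 0.

Lemma weight_ge0 n (p : 'I_n -> V) (a : 'I_n -> R) z w : 0 <= weight p a z w.
Proof.
by rewrite mulr_ge0 ?expR_ge0 // prodr_ge0 // => i _; exact: powR_ge0.
Qed.

Lemma weight_unsupported n (p : 'I_n -> V) (a : 'I_n -> R) z w :
  ~ supported p a w -> weight p a z w = 0.
Proof.
move=> ns; have [i [ai wi]] : exists i, a i = 0 /\ ⟪w, p i⟫ <> 0.
  apply: contrapT => nex; apply: ns => i ai; apply: contrapT => wi.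
  by apply: nex; exists i.
by rewrite /weight (bigD1 i) //= ai powR0 ?mul0r ?mulr0 //; apply/eqP.
Qed.

Lemma weight_supported n (p : 'I_n -> V) (a : 'I_n -> R) z w :
  supported p a w ->
  weight p a z w = expR (⟪w, z⟫ + \sum_i ln (a i) * ⟪w, p i⟫).
Proof.
move=> s; rewrite /weight expRD; congr (_ * _); rewrite expR_sum.
apply: eq_bigr => i _; rewrite /powR; case: eqP => [ai|_]; last by rewrite mulrC.
by rewrite s // eqxx mulr0 expR0.
Qed.

Lemma weight_gt0 n (p : 'I_n -> V) (a : 'I_n -> R) z w :
  supported p a w <-> 0 < weight p a z w.
Proof.
split=> [s|]; first by rewrite weight_supported // expR_gt0.
by move=> w0; apply: contrapT => /weight_unsupported w0'; rewrite w0' ltxx in w0.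
Qed.

Section Expmax.
Context {n : nat} {p : 'I_n -> V} (fp : jframe junit p) {a : 'I_n -> R}
  (a0 : forall i, 0 <= a i).

Let J : {set 'I_n} := [set i | a i != 0].

Lemma supportedE w : state_space w -> supported p a w <-> psum p J • w = w.
Proof.
move=> sw; rewrite -(psum_state_mul fp J sw); split=> s i.
  by rewrite inE negbK => /eqP; exact: s.
by move=> ai; apply: s; rewrite inE ai eqxx.
Qed.

(** The element z + log a compressed to the support of a. *)
Let X z := quad (psum p J) z + \sum_(i in J) ln (a i) *: p i.

Let X_peirce1 z : psum p J • X z = X z.
Proof.
by rewrite jmulDr quad_idem_proj ?psum_idem // psum_sum_peirce1.
Qed.

Let weight_X z w : state_space w -> psum p J • w = w ->
  weight p a z w = expR ⟪X z, w⟫.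
Proof.
move=> sw ew; have s := (supportedE sw).2 ew.
rewrite weight_supported // tipDl quad_selfadj quad_peirce1 ?psum_idem //.
rewrite (tipC w z) tip_suml big_mkcond [X in _ = expR (_ + X)]big_mkcond.
do 2 f_equal; apply: eq_bigr => i _ /=; rewrite inE; case: eqP => [ai|_] /=.
  by rewrite s // mulr0.
by rewrite tipZl tipC.
Qed.

Lemma expmax_support z i : a i != 0 ->
  expmax p a z = expR (max_eigenvalue (psum p J) (X z)) /\
  exists2 w, state_space w & weight p a z w = expmax p a z.
Proof.
move=> ai; have iJ : i \in J by rewrite inE.
have [[c [pc ec cE]] mx] := max_eigenvalueP (psum_idem fp J) (psum_neq0 fp iJ) (X_peirce1
  z).
have sc := jprim_state pc.
suff E : expmax p a z = expR (max_eigenvalue (psum p J) (X z)).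
  by split=> //; exists c => //; rewrite E cE weight_X.
set M := expR _.
have inM : [set weight p a z w | w in state_space] M.
  by exists c => //; rewrite /M cE weight_X.
have ubM : ubound [set weight p a z w | w in state_space] M.
  move=> _ [w sw <-]; have [s|/weight_unsupported ->] := pselect (supported p a w);
    last exact: expR_ge0.
  have ew := (supportedE sw).1 s.
  by rewrite weight_X // ler_expR mx.
apply/le_anti/andP; split; first by apply: ge_sup => //; exists M.
by apply: ub_le_sup => //; exists M.
Qed.

Lemma state_exists : exists w, state_space w.
Proof.
have [r [q fq]] := @jframe_exists R V.
have [i _] := jframe_inhabited fq junit_neq0.
by exists (q i); apply: jprim_state; have [] := fq.
Qed.

Lemma expmax_attained z : exists2 w, state_space w & weight p a z w = expmax p a z.
Proof.
have [[i ai]|na] := pselect (exists i, a i != 0).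
  by have [_] := expmax_support z ai.
have w0 w : state_space w -> weight p a z w = 0.
  move=> sw; apply: weight_unsupported => s; have := state_tip_sum fp sw.
  rewrite big1 => [/eqP|i _]; first by rewrite eq_sym oner_eq0.
  by apply: s; apply: contrapT => /eqP ai; apply: na; exists i.
have [w sw] := state_exists; exists w => //; rewrite w0 // /expmax.
have -> : [set weight p a z w | w in state_space] = [set 0].
  by apply/seteqP; split=> [_ [v sv <-]|_ ->] /=; [exact: w0|exists w => //; exact: w0].
by rewrite sup1.
Qed.

(** No state is supported, as its pairings with the frame sum to 1. This is how a term with empty
    index set drops out of the maximum. *)
Lemma expmax0 z : (forall i, a i = 0) -> expmax p a z = 0.
Proof.
move=> az; have [w sw <-] := expmax_attained z; apply: weight_unsupported => s.
have := state_tip_sum fp sw.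
by rewrite big1 => [/eqP|i _]; [rewrite eq_sym oner_eq0|exact: s].
Qed.

Lemma weight_le_bound z w : state_space w -> (forall i, a i <= 1) ->
  weight p a z w <= expR (unorm z).
Proof.
move=> sw a1; rewrite -[leRHS]mulr1 ler_pM ?expR_ge0 ?prodr_ge0 //.
- by move=> i _; exact: powR_ge0.
- rewrite ler_expR (le_trans (ler_norm _)) // tipC; exact: (unormP z).2.
- apply: prodr_ile1 => i _; rewrite powR_ge0 /=.
  have := @ge0_ler_powR R ⟪w, p i⟫ (state_tip_ge0 fp i sw) (a i) 1.
  by rewrite powR1 !nnegrE a0 ler01 a1; apply.
Qed.

Lemma weight_le_expmax z w : state_space w -> weight p a z w <= expmax p a z.
Proof.
move=> sw; have [[i ai]|na] := pselect (exists i, a i != 0).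
  have [E _] := expmax_support z ai; rewrite E.
  have [s|/weight_unsupported ->] := pselect (supported p a w); last exact: expR_ge0.
  have ew := (supportedE sw).1 s; rewrite weight_X // ler_expR.
  apply: (max_eigenvalueP _ _ _).2 => //; first exact: psum_idem.
  by apply: (psum_neq0 fp (i := i)); rewrite inE.
rewrite weight_unsupported; last first.
  move=> s; have := state_tip_sum fp sw.
  rewrite big1 => [/eqP|i _]; first by rewrite eq_sym oner_eq0.
  by apply: s; apply: contrapT => /eqP ai; apply: na; exists i.
by have [v sv <-] := expmax_attained z; exact: weight_ge0.
Qed.

Lemma expmax_ge0 z : 0 <= expmax p a z.
Proof. by have [w _ <-] := expmax_attained z; exact: weight_ge0. Qed.

End Expmax.

Lemma weightN_le n (p : 'I_n -> V) (a : 'I_n -> R) x y w : state_space w ->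
  weight p a x w <= expR (unorm (x - y)) * weight p a y w.
Proof.
move=> sw; rewrite /weight mulrA ler_wpM2r ?prodr_ge0 //.
  by move=> i _; exact: powR_ge0.
rewrite -expRD ler_expR -lerBlDr -tipBr (le_trans (ler_norm _)) // tipC.
exact: (unormP _).2.
Qed.

(** For z diagonal in the same frame, the logarithm of a positive weight is an average of the
    numbers ln (a i) + k i, with the pairings ⟪w, p i⟫ as averaging weights. *)
Lemma expmax_diag_le n (p : 'I_n -> V) (a k : 'I_n -> R) M :
  jframe junit p -> (forall i, 0 <= a i) -> 0 < M ->
  (forall i, a i * expR (k i) <= M) -> expmax p a (\sum_i k i *: p i) <= M.
Proof.
move=> fp a0 M0 kM.
have [w sw <-] := expmax_attained (a := a) fp (\sum_i k i *: p i).
have [s|/weight_unsupported ->] := pselect (supported p a w); last exact: ltW.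
rewrite weight_supported // -[M]lnK ?posrE // ler_expR tip_sumr -big_split /=.
rewrite -[ln M]mulr1 -(state_tip_sum fp sw) mulr_sumr.
apply: ler_sum => j _; have [aj|aj] := eqVneq (a j) 0.
  by rewrite tipZr s // !mulr0 addr0.
have aj0 : 0 < a j by rewrite lt_neqAle eq_sym aj a0.
rewrite tipZr -mulrDl ler_wpM2r ?(state_tip_ge0 fp) //.
rewrite -[k j]expRK addrC -lnM ?posrE ?expR_gt0 // ler_ln ?posrE //.
by rewrite mulr_gt0 ?expR_gt0.
Qed.

End ExpMax.

(** * Limits of powers, including the degenerate exponent and base *)

Section PowRCvg.
Context {R : realType} {T : Type}.

Lemma le_cvg (F : set_system T) (f g : T -> R) (l m : R) : ProperFilter F ->
  f t @[t --> F] --> l -> g t @[t --> F] --> m ->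
  (\forall t \near F, f t <= g t) -> l <= m.
Proof.
move=> PF fl gm fg; rewrite -subr_ge0; apply: (cvgr_to_ge (cvgB gm fl)).
by apply: filterS fg => t; rewrite subr_ge0.
Qed.

Lemma cvg_fun_expR (F : set_system T) (f : T -> R) (l : R) : Filter F ->
  f t @[t --> F] --> l -> expR (f t) @[t --> F] --> expR l.
Proof. by move=> FF fl; apply: (@cvg_comp _ _ _ f (@expR R) F (nbhs l) (nbhs (expR l))
  fl); exact: continuous_expR. Qed.

Lemma cvg_fun_ln (F : set_system T) (f : T -> R) (l : R) : Filter F -> 0 < l ->
  f t @[t --> F] --> l -> ln (f t) @[t --> F] --> ln l.
Proof. by move=> FF l0 fl; apply: (@cvg_comp _ _ _ f (@ln R) F (nbhs l) (nbhs (ln l))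
  fl); exact: continuous_ln. Qed.

Lemma cvg_maxr (F : set_system T) (f g : T -> R) (l m : R) : Filter F ->
  f t @[t --> F] --> l -> g t @[t --> F] --> m ->
  Num.max (f t) (g t) @[t --> F] --> Num.max l m.
Proof.
move=> FF fl gm; under eq_fun do rewrite maxr_absE; rewrite maxr_absE.
apply: cvgM; last exact: cvg_cst.
by apply: cvgD; [exact: cvgD|apply: cvg_norm; exact: cvgB].
Qed.

Lemma cvg_powR (F : set_system T) (a x : T -> R) (b y : R) : Filter F -> 0 < b ->
  a t @[t --> F] --> b -> x t @[t --> F] --> y ->
  a t `^ x t @[t --> F] --> b `^ y.
Proof.
move=> FF b0 ab xy; have -> : b `^ y = expR (y * ln b) by rewrite /powR gt_eqF.
have : expR (x t * ln (a t)) @[t --> F] --> expR (y * ln b).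
  apply: cvg_fun_expR; apply: cvgM => //.
  exact: cvg_fun_ln.
apply: cvg_trans; apply: near_eq_cvg.
have : \forall t \near F, 0 < a t by apply: (cvgr_gt b).
by apply: filterS => t at0; rewrite /powR gt_eqF.
Qed.

(* At the discontinuity (0, 0) of the power the bound holds because 0 `^ 0 = 1. *)
Lemma ultra_powR_usc (U : set_system T) (a x : T -> R) (b y : R) : UltraFilter U ->
  (\forall t \near U, 0 <= a t <= 1) -> (\forall t \near U, 0 <= x t) ->
  a t @[t --> U] --> b -> x t @[t --> U] --> y ->
  exists l, [/\ 0 <= l, l <= b `^ y & a t `^ x t @[t --> U] --> l].
Proof.
move=> UU a01 x0 ab xy.
have b0 : 0 <= b by apply: (cvgr_to_ge ab); apply: filterS a01 => t /andP[].
have y0 : 0 <= y by apply: (cvgr_to_ge xy).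
have [|l /andP[l0 l1] al] := @ultra_cvg_bounded R T U (fun t => a t `^ x t) 0 1 UU.
  apply: filterS2 a01 x0 => t /andP[a0 a1] xt0; rewrite powR_ge0 /=.
  by have := @ge0_ler_powR R (x t) xt0 (a t) 1; rewrite powR1 !nnegrE a0 ler01 a1; apply.
exists l; split=> //; have [b00|bn0] := eqVneq b 0; last first.
  have bp : 0 < b by rewrite lt_neqAle eq_sym bn0.
  by rewrite (cvg_unique (@Rhausdorff R) al (cvg_powR _ bp ab xy)).
have [->|yn0] := eqVneq y 0; first by rewrite powRr0.
rewrite b00 powR0 // leNgt; apply/negP => lp.
have yp : 0 < y by rewrite lt_neqAle eq_sym yn0.
(* From a^x > l/2, x > y/2 and ln a <= 0 one gets ln (l/2) <= (y/2) ln a, a positive lower bound for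
   a that contradicts b = 0. *)
suff : expR (2 * ln (l / 2) / y) <= b by rewrite b00 leNgt expR_gt0.
apply: (cvgr_to_ge ab).
have H1 : \forall t \near U, l / 2 < a t `^ x t by apply: (cvgr_gt l) => //; lra.
have H2 : \forall t \near U, y / 2 < x t by apply: (cvgr_gt y) => //; lra.
apply: filterS3 H1 H2 a01 => t h1 h2 /andP[a0 a1].
have l2 : 0 < l / 2 by lra.
have ap : 0 < a t.
  rewrite lt_neqAle a0 andbT eq_sym; apply: contraTneq h1 => ->.
  rewrite powR0; first by rewrite -leNgt ltW.
  by apply/lt0r_neq0; lra.
rewrite -[leRHS]lnK ?posrE // ler_expR ler_pdivrMr //.
have h : ln (l / 2) <= x t * ln (a t).
  by rewrite -ln_powR ler_ln ?posrE ?powR_gt0 // ltW.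
have la : ln (a t) <= 0 by exact: ln_le0.
nra.
Qed.

Lemma cvg_rprod (I : Type) (F : set_system T) (s : seq I) (f : I -> T -> R) (l : I -> R) :
  Filter F -> (forall i, f i t @[t --> F] --> l i) ->
  \prod_(i <- s) f i t @[t --> F] --> \prod_(i <- s) l i.
Proof.
move=> FF H; elim: s => [|i s IH].
  by under eq_fun do rewrite big_nil; rewrite big_nil; exact: cvg_cst.
under eq_fun do rewrite big_cons; rewrite big_cons; exact: cvgM.
Qed.

End PowRCvg.

(** * Continuity of the exponential maximum along varying frames and coefficients *)

Section ExpmaxContinuity.
Context {R : realType} {V : euclideanJordanType R} {T : Type} {n : nat}.
Implicit Types (z w : V).

Section Ultra.
Context {U : set_system T} {UU : UltraFilter U}
  {p : T -> 'I_n -> V} {a : T -> 'I_n -> R} {q : 'I_n -> V} {b : 'I_n -> R}.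
Hypothesis fp : forall t, jframe junit (p t).
Hypothesis fq : jframe junit q.
Hypothesis a01 : forall t i, 0 <= a t i <= 1.
Hypothesis pq : forall i, jcvg U (fun t => p t i) (q i).
Hypothesis ab : forall i, a t i @[t --> U] --> b i.

(** Along the ultrafilter each power converges to at most the power of the limits, and the
    exponential factor is continuous. *)
Lemma weight_usc (z w : V) (wt : T -> V) (c : R) :
  (forall t, state_space (wt t)) -> jcvg U wt w ->
  (\forall t \near U, c <= weight (p t) (a t) z (wt t)) ->
  c <= weight q b z w.
Proof.
move=> sw ww cw.
have H i : exists l, [/\ 0 <= l, l <= b i `^ ⟪w, q i⟫ &
    a t i `^ ⟪wt t, p t i⟫ @[t --> U] --> l].
  apply: ultra_powR_usc => //; [exact: nearW| |exact: cvg_tip].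
  by apply: nearW => t; exact: state_tip_ge0.
have [l lP] := choice H.
have : weight (p t) (a t) z (wt t) @[t --> U] --> expR ⟪w, z⟫ * \prod_i l i.
  by apply: cvgM; [apply: cvg_fun_expR; exact: ww|apply: cvg_rprod => i; case: (lP i)].
move=> /cvgr_to_ge -/(_ _ cw) cl; apply: (le_trans cl).
rewrite ler_wpM2l ?expR_ge0 //; apply: ler_prod => i _.
by have [-> ->] := lP i.
Qed.

(* The frame elements with vanishing limit coefficient are projected away from
   [w], so that their factors stay equal to 0 `^ 0 = 1. *)
Lemma weight_lsc z w : state_space w -> supported q b w ->
  exists2 wt : T -> V, (\forall t \near U, state_space (wt t)) &
    weight (p t) (a t) z (wt t) @[t --> U] --> weight q b z w.
Proof.
move=> sw s; pose J : {set 'I_n} := [set i | b i != 0]%SET.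
have ew : psum q J • w = w by apply/(supportedE fq).
pose v t := quad (psum (p t) J) w.
have vw : jcvg U v w.
  rewrite -[w in jcvg _ _ w](quad_peirce1 (psum_idem fq J) ew).
  by apply: jcvg_quad; [apply: jcvg_sum => i; exact: pq|exact: jcvg_cst].
have tv : ⟪v t, junit⟫ @[t --> U] --> (1 : R).
  by have := vw junit; rewrite (tipC w) state_tip1.
pose wt t := ⟪v t, junit⟫^-1 *: v t.
have wtw : jcvg U wt w.
  rewrite -[w in jcvg _ _ w]scale1r -[1]invr1; apply: jcvgZ => //.
  by apply: cvgV => //; exact: oner_neq0.
have tp : \forall t \near U, 0 < ⟪v t, junit⟫ by apply: (cvgr_gt 1).
exists wt.
  apply: filterS tp => t vt; split.
    apply: coneZ; first by rewrite invr_ge0 ltW.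
    by apply: cone_quad; [exact: psum_idem (fp t) _|case: sw].
  by rewrite tipC tipZl mulVf // gt_eqF.
apply: cvgM; first by apply: cvg_fun_expR; exact: wtw.
apply: cvg_rprod => i; have [bi|bi] := eqVneq (b i) 0.
  rewrite (s i bi) powRr0.
  have -> : (fun t => a t i `^ ⟪wt t, p t i⟫) = fun=> 1.
    apply: funext => t; rewrite tipZl (quad_selfadj _ _ (p t i)).
    have -> : quad (psum (p t) J) (p t i) = 0.
      apply: quad_peirce0; last exact: psum_idem (fp t) _.
      by rewrite (psum_mul1 (fp t)) inE bi eqxx.
    by rewrite (tipC w 0) tip0l mulr0 powRr0.
  exact: cvg_cst.
have b0 : 0 <= b i.
  apply: (cvgr_to_ge (@ab i)); apply: nearW => t; by case/andP: (a01 t i).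
by apply: cvg_powR => //; [rewrite lt_neqAle eq_sym bi|exact: cvg_tip].
Qed.

(** Maximizing states converge by compactness, and [weight_usc] bounds the limit from above. For the
    other inequality, [weight_lsc] approximates a maximizer of the limit problem. *)
Lemma expmax_ultra z : expmax (p t) (a t) z @[t --> U] --> expmax q b z.
Proof.
have H t : exists w, state_space w /\ weight (p t) (a t) z w = expmax (p t) (a t) z.
  by have [w sw wE] := expmax_attained (a := a t) (fp t) z; exists w.
have [wt wtP] := choice H.
have sw t : state_space (wt t) by case: (wtP t).
have [|l /andP[l0 l1] El] := @ultra_cvg_bounded R T U (fun t =>
  expmax (p t) (a t) z) 0 (expR (unorm z)) UU.
  apply: nearW => t; rewrite expmax_ge0 //=; have [_ <-] := wtP t.
  by apply: weight_le_bound => // i; case/andP: (a01 t i).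
suff <- : l = expmax q b z by [].
have [|w _ ww] := ultra_jcvg_state (f := wt) UU; first exact: nearW.
have sw' : state_space w.
  have [|w' sw' ww'] := ultra_jcvg_state (f := wt) UU; first exact: nearW.
  by rewrite (jcvg_unique _ ww ww').
apply/le_anti/andP; split.
  apply/ler_addgt0Pr => e e0; rewrite -lerBlDr.
  apply: le_trans (weight_le_expmax fq z sw').
  apply: (weight_usc sw ww).
  have : \forall t \near U, l - e < expmax (p t) (a t) z by apply: (cvgr_gt l) => //; lra.
  by apply: filterS => t lt; have [_ ->] := wtP t; exact: ltW.
have [u su <-] := expmax_attained (a := b) fq z.
have [s|/weight_unsupported -> //] := pselect (supported q b u).
have [ut sut ul] := weight_lsc z su s.
apply: (le_cvg _ ul El); apply: filterS sut => t sut.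
exact: weight_le_expmax.
Qed.

End Ultra.

Lemma expmax_cvg (F : set_system T) (p : T -> 'I_n -> V) (a : T -> 'I_n -> R)
    (q : 'I_n -> V) (b : 'I_n -> R) z : Filter F ->
  (forall t, jframe junit (p t)) -> jframe junit q ->
  (forall t i, 0 <= a t i <= 1) ->
  (forall i, jcvg F (fun t => p t i) (q i)) ->
  (forall i, a t i @[t --> F] --> b i) ->
  expmax (p t) (a t) z @[t --> F] --> expmax q b z.
Proof.
move=> FF fp fq a01 pq ab; apply: cvg_ultra => U UU FU.
apply: expmax_ultra => // i; last by move=> W Wb; apply: FU; exact: ab.
by move=> y W Wb; apply: FU; exact: pq.
Qed.

End ExpmaxContinuity.

(** * A common parametrization of the compactification and the dual ball *)

Section HPoint.
Context {R : realType} {V : euclideanJordanType R}.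
Implicit Types (x y z w : V).

(** The length of a frame is the trace of the unit. All decompositions can thus be indexed by one
    fixed ['I_n]. *)
Lemma jframe_rank n m (p : 'I_n -> V) (q : 'I_m -> V) :
  jframe junit p -> jframe junit q -> n = m.
Proof.
have H r (f : 'I_r -> V) : jframe junit f -> jtrace (junit : V) = r%:R.
  move=> ff; have := jtrace_frame (fun=> 1) ff.
  rewrite sumr_const card_ord => <-; congr jtrace.
  by have [_ _ <-] := ff; apply: eq_bigr => i _; rewrite scale1r.
by move=> fp fq; apply/eqP; rewrite -(eqr_nat R) -(H _ _ fp) -(H _ _ fq).
Qed.

(** Pairing z • p i with q j in two ways gives (k i - l j) ⟪p i, q j⟫ = 0, and idempotents
    orthogonal for the trace form have product 0. Conversely, each side is multiplied by the unit
    expanded in the other frame. The criterion makes functional calculus independent of the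
    frame. *)
Lemma jframe_eqP n m (p : 'I_n -> V) (q : 'I_m -> V) (k : 'I_n -> R) (l : 'I_m -> R) :
  jframe junit p -> jframe junit q ->
  \sum_i k i *: p i = \sum_j l j *: q j <->
  (forall i j, p i • q j = 0 \/ k i = l j).
Proof.
move=> fp fq; split=> [E i j|H].
  have [pp _ _] := fp; have [qq _ _] := fq.
  have [->|kl] := eqVneq (k i) (l j); [by right|left].
  have pq0 : ⟪p i, q j⟫ = 0.
    have h1 : ⟪(\sum_i k i *: p i) • p i, q j⟫ = k i * ⟪p i, q j⟫.
      by rewrite (jframe_sum_mul k i fp) tipZl.
    have h2 : ⟪(\sum_i k i *: p i) • p i, q j⟫ = l j * ⟪p i, q j⟫.
      by rewrite tip_selfadj E (jframe_sum_mul l j fq) tipZr.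
    have /eqP : (k i - l j) * ⟪p i, q j⟫ = 0 by rewrite mulrBl -h1 -h2 subrr.
    by rewrite mulf_eq0 subr_eq0 (negbTE kl) => /eqP.
  have := @cone_orth _ _ (q j) (p i); rewrite tipC; apply=> //; last exact: jprim_idem.
  exact/cone_idem/jprim_idem.
have [_ _ pe] := fp; have [_ _ qe] := fq.
rewrite -[LHS]jmulr1 -qe -[RHS]jmul1 -pe jmul_suml jmul_suml.
apply: eq_bigr => i _; rewrite !jmul_sumr; apply: eq_bigr => j _.
by rewrite jmulZl jmulZr; have [->|->] := H i j; rewrite ?scaler0.
Qed.

Lemma jframe_funcalc (F : R -> R) n m (p : 'I_n -> V) (q : 'I_m -> V)
    (k : 'I_n -> R) (l : 'I_m -> R) : jframe junit p -> jframe junit q ->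
  \sum_i k i *: p i = \sum_j l j *: q j ->
  \sum_i F (k i) *: p i = \sum_j F (l j) *: q j.
Proof.
move=> fp fq /(jframe_eqP k l fp fq) H.
by apply/jframe_eqP => // i j; have [|->] := H i j; [left|right].
Qed.

Lemma jframe_sum_funcalc (F : R -> R) n m (p : 'I_n -> V) (q : 'I_m -> V)
    (k : 'I_n -> R) (l : 'I_m -> R) : jframe junit p -> jframe junit q ->
  \sum_i k i *: p i = \sum_j l j *: q j -> \sum_i F (k i) = \sum_j F (l j).
Proof.
move=> fp fq E; rewrite -(jtrace_frame _ fp) -(jtrace_frame _ fq).
by congr jtrace; exact: jframe_funcalc.
Qed.

(** The kernel projection of a and log a are both obtained from sum_i a_i p_i by functional
    calculus, with the indicator of 0 and with [ln]. *)
Lemma weight_ext n m (p : 'I_n -> V) (q : 'I_m -> V) (a : 'I_n -> R) (b : 'I_m -> R) z w :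
  jframe junit p -> jframe junit q -> state_space w ->
  \sum_i a i *: p i = \sum_j b j *: q j -> weight p a z w = weight q b z w.
Proof.
move=> fp fq sw E.
have supE r (f : 'I_r -> V) (k : 'I_r -> R) : jframe junit f ->
    supported f k w <-> ⟪w, \sum_i (k i == 0)%:R *: f i⟫ = 0.
  move=> ff; rewrite tip_sumr; under eq_bigr do rewrite tipZr.
  split=> [s|/psumr_eq0P H i ki].
    by rewrite big1 // => i _; case: eqP => [/s ->|_]; rewrite ?mulr0 ?mul0r.
  have := H _ i isT; rewrite ki eqxx mul1r; apply=> j _.
  by rewrite mulr_ge0 ?ler0n // (state_tip_ge0 ff).
have S : supported p a w <-> supported q b w.
  apply: (iff_trans (supE _ _ _ fp)); apply: iff_trans (iff_sym (supE _ _ _ fq)).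
  by rewrite (jframe_funcalc (fun c : R => (c == 0)%:R) fp fq E).
have [s|ns] := pselect (supported p a w); last first.
  by rewrite !weight_unsupported // => /S.
rewrite !weight_supported //; last exact/S.
congr (expR (_ + _)).
under eq_bigr do rewrite -tipZr; under [RHS]eq_bigr do rewrite -tipZr.
by rewrite -!tip_sumr (jframe_funcalc (@ln R) fp fq E).
Qed.

Lemma expmax_ext n m (p : 'I_n -> V) (q : 'I_m -> V) (a : 'I_n -> R) (b : 'I_m -> R) z :
  jframe junit p -> jframe junit q ->
  \sum_i a i *: p i = \sum_j b j *: q j -> expmax p a z = expmax q b z.
Proof.
move=> fp fq E; rewrite /expmax; congr sup; apply/seteqP; split=> _ [w sw <-];
  by exists w => //; rewrite (weight_ext _ fp fq sw E).
Qed.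

(** The exponents ⟪w, p i⟫ sum to 1, so the weight is homogeneous of degree 1. *)
Lemma weight_scale n (p : 'I_n -> V) (a : 'I_n -> R) (c : R) z w :
  jframe junit p -> state_space w -> (forall i, 0 <= a i) -> 0 < c ->
  weight p (fun i => c * a i) z w = c * weight p a z w.
Proof.
move=> fp sw a0 c0; rewrite /weight mulrCA; congr (_ * _).
under eq_bigr do rewrite powRM ?a0 ?ltW //.
rewrite big_split /=; congr (_ * _).
have lnc : ln c = \sum_i ⟪w, p i⟫ * ln c by rewrite -mulr_suml state_tip_sum // mul1r.
rewrite -[RHS]lnK ?posrE // lnc expR_sum.
by apply: eq_bigr => i _; rewrite /powR gt_eqF.
Qed.

Lemma expmax_scale n (p : 'I_n -> V) (a : 'I_n -> R) (c : R) z :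
  jframe junit p -> (forall i, 0 <= a i) -> 0 < c ->
  expmax p (fun i => c * a i) z = c * expmax p a z.
Proof.
move=> fp a0 c0; apply/le_anti/andP; split.
  have [w sw <-] := expmax_attained (a := fun i => c * a i) fp z.
  by rewrite weight_scale // ler_wpM2l ?(ltW c0) // weight_le_expmax.
have [w sw <-] := expmax_attained (a := a) fp z.
by rewrite -weight_scale //; exact: weight_le_expmax.
Qed.

(* The element x = sum_i lambda_i p_i of V is encoded by hsc = 1 / tr(e^x + e^-x),
   hpos = hsc e^lambda and hneg = hsc e^-lambda; hsc = 0 gives the horofunctions,
   with I and J the supports of hpos and hneg. *)
Record hpoint n := HPoint {
  hfr : 'I_n -> V;
  hpos : 'I_n -> R;
  hneg : 'I_n -> R;
  hsc : R;
  hfrP : jframe junit hfr;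
  hpos_ge0 : forall i, 0 <= hpos i;
  hneg_ge0 : forall i, 0 <= hneg i;
  hsc_ge0 : 0 <= hsc;
  hsum1 : \sum_i (hpos i + hneg i) = 1;
  hposneg : forall i, hpos i * hneg i = hsc ^+ 2
}.

Definition hval n (k : hpoint n) : V := \sum_i (hpos k i - hneg k i) *: hfr k i.

Definition hmax n (k : hpoint n) z : R :=
  Num.max (expmax (hfr k) (hpos k) (- z)) (expmax (hfr k) (hneg k) z).

Definition hfun n (k : hpoint n) : {ptws V -> R} :=
  fun z => ln (hmax k z) - ln (hmax k 0).

(** The symmetry x -> -x of the whole picture; it carries statements about the positive part over to
    the negative part. *)
Definition hswap n (k : hpoint n) : hpoint n.
Proof.
apply: (@HPoint n (hfr k) (hneg k) (hpos k) (hsc k) (hfrP k) (hneg_ge0 k)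
  (hpos_ge0 k) (hsc_ge0 k)).
- by rewrite -(hsum1 k); apply: eq_bigr => i _; rewrite addrC.
- by move=> i; rewrite mulrC hposneg.
Defined.

Lemma hmax_swap n (k : hpoint n) z : hmax (hswap k) z = hmax k (- z).
Proof. by rewrite /hmax /= opprK maxC. Qed.

Lemma hpos_le1 n (k : hpoint n) i : hpos k i <= 1.
Proof.
rewrite -(hsum1 k) (bigD1 i) //= -addrA lerDl addr_ge0 ?hneg_ge0 // sumr_ge0 // => j _.
by rewrite addr_ge0 ?hpos_ge0 ?hneg_ge0.
Qed.

Lemma hneg_le1 n (k : hpoint n) i : hneg k i <= 1.
Proof. exact: (hpos_le1 (hswap k)). Qed.

Lemma hmax_gt0 n (k : hpoint n) z : 0 < hmax k z.
Proof.
have [i ki] : exists i, hpos k i + hneg k i != 0.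
  apply: contrapT => nex; have := hsum1 k; rewrite big1 => [/eqP|i _].
    by rewrite eq_sym oner_eq0.
  by apply: contrapT => /eqP ki; apply: nex; exists i.
have [pp _ _] := hfrP k; have si := jprim_state (pp i).
have pos (a : 'I_n -> R) y : a i != 0 -> 0 < expmax (hfr k) a y.
  move=> ai; apply: lt_le_trans (weight_le_expmax (hfrP k) y si).
  apply/weight_gt0 => j aj; rewrite (jframe_tip _ _ (hfrP k)).
  by case: eqP => // ij; rewrite ij aj eqxx in ai.
rewrite lt_max; have [a0|a0] := eqVneq (hpos k i) 0; last by rewrite pos.
by rewrite [X in _ || X]pos ?orbT //; rewrite a0 add0r in ki.
Qed.

Lemma weight_pos_le n (k : hpoint n) z w : state_space w ->
  weight (hfr k) (hpos k) (- z) w <= hmax k z.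
Proof.
by move=> sw; rewrite le_max (weight_le_expmax (hfrP k)).
Qed.

Lemma weight_neg_le n (k : hpoint n) z w : state_space w ->
  weight (hfr k) (hneg k) z w <= hmax k z.
Proof.
by move=> sw; rewrite le_max (weight_le_expmax (hfrP k) z sw) orbT.
Qed.

Lemma hmax_le n (k : hpoint n) z M :
  (forall w, state_space w -> weight (hfr k) (hpos k) (- z) w <= M) ->
  (forall w, state_space w -> weight (hfr k) (hneg k) z w <= M) ->
  hmax k z <= M.
Proof.
move=> h1 h2; rewrite ge_max; apply/andP; split.
  by have [w sw <-] := expmax_attained (a := hpos k) (hfrP k) (- z); exact: h1.
by have [w sw <-] := expmax_attained (a := hneg k) (hfrP k) z; exact: h2.
Qed.

Section Cvg.
Context {T : Type} {n : nat}.
Implicit Types (k : T -> hpoint n) (l : hpoint n).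

(** There is no condition on [hsc]: its square is the common product of the coefficients, so its
    limit is determined. *)
Definition hcvg (F : set_system T) k l : Prop :=
  [/\ forall i, jcvg F (fun t => hfr (k t) i) (hfr l i),
      forall i, hpos (k t) i @[t --> F] --> hpos l i &
      forall i, hneg (k t) i @[t --> F] --> hneg l i].

Lemma hcvg_val (F : set_system T) k l : Filter F -> hcvg F k l ->
  jcvg F (fun t => hval (k t)) (hval l).
Proof.
move=> FF [fl pl nl]; apply: jcvg_sum => i; apply: jcvgZ => //.
by apply: cvgB; [exact: pl|exact: nl].
Qed.

Lemma hcvg_max (F : set_system T) k l z : Filter F -> hcvg F k l ->
  hmax (k t) z @[t --> F] --> hmax l z.
Proof.
move=> FF [fl pl nl].
have H1 : expmax (hfr (k t)) (hpos (k t)) (- z) @[t --> F] --> expmax (hfr l) (hpos l) (-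
  z).
  apply: expmax_cvg => // [t||t i]; rewrite ?hpos_ge0 ?hpos_le1 //; exact: hfrP.
have H2 : expmax (hfr (k t)) (hneg (k t)) z @[t --> F] --> expmax (hfr l) (hneg l) z.
  apply: expmax_cvg => // [t||t i]; rewrite ?hneg_ge0 ?hneg_le1 //; exact: hfrP.
exact: cvg_maxr H1 H2.
Qed.

Lemma hcvg_fun (F : set_system T) k l : Filter F -> hcvg F k l ->
  hfun (k t) @[t --> F] --> hfun l.
Proof.
move=> FF kl; apply/cvg_ptwsE => z.
have H y : ln (hmax (k t) y) @[t --> F] --> ln (hmax l y).
  by apply: cvg_fun_ln; [exact: hmax_gt0|exact: hcvg_max].
by apply: cvgB; exact: H.
Qed.

Lemma hcompact (U : set_system T) k : UltraFilter U -> exists l, hcvg U k l.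
Proof.
move=> UU.
have Hq i : exists l : V, jcvg U (fun t => hfr (k t) i) l.
  have [|l _ kl] := @ultra_jcvg_state R V T U (fun t => hfr (k t) i) UU; last by exists l.
  by apply: nearW => t; apply: jprim_state; have [] := hfrP (k t).
have [q qP] := choice Hq.
have Ha i : exists a : R, 0 <= a /\ hpos (k t) i @[t --> U] --> a.
  have [|l /andP[l0 l1] kl] := @ultra_cvg_bounded R T U (fun t => hpos (k t) i) 0 1 UU;
    last by exists l.
  by apply: nearW => t; rewrite hpos_ge0 hpos_le1.
have [a aP] := choice Ha.
have Hb i : exists b : R, 0 <= b /\ hneg (k t) i @[t --> U] --> b.
  have [|l /andP[l0 l1] kl] := @ultra_cvg_bounded R T U (fun t => hneg (k t) i) 0 1 UU;
    last by exists l.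
  by apply: nearW => t; rewrite hneg_ge0 hneg_le1.
have [b bP] := choice Hb.
have sum1 : \sum_i (a i + b i) = 1.
  have H : \sum_i (hpos (k t) i + hneg (k t) i) @[t --> U] --> \sum_i (a i + b i).
    by apply: cvg_rsum => i; apply: cvgD; [case: (aP i)|case: (bP i)].
  apply: (cvg_unique (@Rhausdorff R) H).
  have -> : (fun t => \sum_i (hpos (k t) i + hneg (k t) i)) = fun=> 1.
    by apply: funext => t; exact: hsum1.
  exact: cvg_cst.
have qq i : q i • q i = q i.
  apply: (jcvg_unique _ (jcvg_mul (qP i) (qP i))).
  have -> : (fun t => hfr (k t) i • hfr (k t) i) = fun t => hfr (k t) i.
    by apply: funext => t; have [pp _ _] := hfrP (k t); exact: jprim_idem.
  exact: qP.
have qo i j : i != j -> q i • q j = 0.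
  move=> ij; apply: (jcvg_unique _ (jcvg_mul (qP i) (qP j))).
  have -> : (fun t => hfr (k t) i • hfr (k t) j) = fun t => 0.
    by apply: funext => t; have [_ po _] := hfrP (k t); exact: po.
  exact: jcvg_cst.
have qe : \sum_i q i = junit.
  have H : jcvg U (fun t => \sum_i hfr (k t) i) (\sum_i q i) by exact: jcvg_sum.
  apply: (jcvg_unique _ H).
  have -> : (fun t => \sum_i hfr (k t) i) = fun t => junit.
    by apply: funext => t; have [_ _ ->] := hfrP (k t).
  exact: jcvg_cst.
have q1 i : jtrace (q i) = 1.
  rewrite -tip1 tipC; apply: (cvg_unique (@Rhausdorff R) (qP i junit)).
  have -> : (fun t => ⟪hfr (k t) i, junit⟫) = fun t => 1.
    by apply: funext => t; rewrite tipC tip1 jtrace_prim //; have [] := hfrP (k t).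
  exact: cvg_cst.
have trace_idem c : c • c = c -> c != 0 -> 1 <= jtrace (c : V).
  move=> cc c0; have [r [f [_ [ff _]]]] := jspectral cc cc.
  have [i0 _] := jframe_inhabited ff c0; have := jtrace_frame (fun=> 1) ff.
  under eq_bigr do rewrite scale1r.
  by have [_ _ ->] := ff; rewrite sumr_const card_ord => ->;
    case: r f ff i0 => [f _ []//|r *]; rewrite ler1n.
have fq : jframe junit q.
  split=> // i; split=> //.
    by apply: contraTneq isT => qi; have := q1 i;
      rewrite qi -(scale0r 0) jtraceZ mul0r => /esym/eqP; rewrite oner_eq0.
  move=> c d cc dd E; have [->|c0] := eqVneq c 0; first by left.
  have [->|d0] := eqVneq d 0; first by right.
  have := lerD (trace_idem c cc c0) (trace_idem d dd d0).
  by rewrite -jtraceD -E q1 gerDl ler10.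
have [i0 _] := jframe_inhabited fq junit_neq0.
(* Any index serves: the products a i * b i are limits of products that do not depend on the
   index. *)
pose s := Num.sqrt (a i0 * b i0).
have ab i : a i * b i = s ^+ 2.
  rewrite sqr_sqrtr; last by rewrite mulr_ge0 //; [case: (aP i0)|case: (bP i0)].
  have H j : hpos (k t) j * hneg (k t) j @[t --> U] --> a j * b j.
    by apply: cvgM; [case: (aP j)|case: (bP j)].
  apply: (cvg_unique (@Rhausdorff R) (H i)).
  have -> : (fun t => hpos (k t) i * hneg (k t) i) = fun t => hpos (k t) i0 * hneg (k t) i0.
    by apply: funext => t; rewrite !hposneg.
  exact: H.
exists (@HPoint n q a b s fq (fun i => (aP i).1) (fun i => (bP i).1) (sqrtr_ge0 _) sum1 ab).
by split=> i /=; [exact: qP|case: (aP i)|case: (bP i)].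
Qed.

End Cvg.

End HPoint.

(** * From elements of the dual ball to functions; interior and boundary data *)

Section HEquiv.
Context {R : realType} {V : euclideanJordanType R} {n : nat}.
Implicit Types (x y z w : V) (k l : @hpoint R V n) (p : 'I_n -> V).
Implicit Types (I J K : {set 'I_n}) (alpha : 'I_n -> R).

Lemma jframe_ord0 p : jframe junit p -> exists i : 'I_n, True.
Proof. by move=> fp; exact: jframe_inhabited fp junit_neq0. Qed.

Lemma sumr_gt0_jframe p (F : 'I_n -> R) : jframe junit p -> (forall i, 0 < F i) ->
  0 < \sum_i F i.
Proof.
move=> fp F0; have [i _] := jframe_ord0 fp.
rewrite (bigD1 i) //= ltr_pwDl ?F0 // sumr_ge0 // => j _; exact: ltW.
Qed.

Lemma hadd_sqrt k i :
  hpos k i + hneg k i = Num.sqrt ((hpos k i - hneg k i) ^+ 2 + 4 * hsc k ^+ 2).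
Proof.
rewrite -(@hposneg _ _ _ k i) (_ : _ + _ = (hpos k i + hneg k i) ^+ 2); last by ring.
by rewrite sqrtr_sqr ger0_norm // addr_ge0 ?hpos_ge0 ?hneg_ge0.
Qed.

(** The sum of sqrt(w^2 + 4 s^2) over the eigenvalues w of [hval] is strictly increasing in s and
    equals 1 at s = [hsc]; it depends on the data only through [hval] and s. *)
Lemma hval_hsc_le k l : hval k = hval l -> hsc l <= hsc k.
Proof.
move=> E; rewrite leNgt; apply/negP => lt.
pose F s (w : R) := Num.sqrt (w ^+ 2 + 4 * s ^+ 2).
have H (m : @hpoint R V n) : \sum_i F (hsc m) (hpos m i - hneg m i) = 1.
  rewrite -(hsum1 m); apply: eq_bigr => i _. by rewrite hadd_sqrt.
have := jframe_sum_funcalc (F (hsc k)) (hfrP k) (hfrP l) E; rewrite H => E1.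
have [i0 _] := jframe_ord0 (hfrP k).
have : \sum_i F (hsc k) (hpos l i - hneg l i) < \sum_i F (hsc l) (hpos l i - hneg l i).
  apply: ltr_sum; first by apply/hasP; exists i0 => //; rewrite mem_index_enum.
  move=> i _; rewrite /F ltr_sqrt.
    by rewrite ltrD2l ltr_pM2l // ltr_pXn2r // nnegrE hsc_ge0.
  by rewrite ltr_wpDl ?sqr_ge0 // mulr_gt0 // exprn_gt0 // (le_lt_trans (hsc_ge0 k)).
by rewrite -E1 H ltxx.
Qed.

Lemma hval_hsc k l : hval k = hval l -> hsc k = hsc l.
Proof. by move=> E; apply/le_anti; rewrite !hval_hsc_le. Qed.

Definition hposv k := \sum_i hpos k i *: hfr k i.
Definition hnegv k := \sum_i hneg k i *: hfr k i.

Lemma hvalE k : hval k = hposv k - hnegv k.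
Proof. by rewrite -sumrB; apply: eq_bigr => i _; rewrite scalerBl. Qed.

(** With w the difference and s^2 the product of the two coefficients, the positive one is (w +
    sqrt(w^2 + 4 s^2)) / 2, a function of [hval] once s is known. *)
Lemma hval_posv k l : hval k = hval l -> hposv k = hposv l.
Proof.
move=> E; pose F (w : R) := (w + Num.sqrt (w ^+ 2 + 4 * hsc k ^+ 2)) / 2.
have H (m : @hpoint R V n) : hval k = hval m ->
  hposv m = \sum_i F (hpos m i - hneg m i) *: hfr m i.
  move=> /hval_hsc sm; apply: eq_bigr => i _; congr (_ *: _).
  by rewrite /F sm -hadd_sqrt; field.
by rewrite (H k) // (H l) //; exact: jframe_funcalc (hfrP k) (hfrP l) E.
Qed.

Lemma hval_negv k l : hval k = hval l -> hnegv k = hnegv l.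
Proof.
move=> E; have : hposv k - hval k = hposv l - hval l by rewrite E (hval_posv E).
by rewrite !hvalE !opprB !addrA !(addrC (hposv _)) !addrK.
Qed.

Lemma hval_max k l z : hval k = hval l -> hmax k z = hmax l z.
Proof.
move=> E; rewrite /hmax (expmax_ext _ (hfrP k) (hfrP l) (hval_posv E)).
by rewrite (expmax_ext _ (hfrP k) (hfrP l) (hval_negv E)).
Qed.

Lemma hval_fun k l : hval k = hval l -> hfun k = hfun l.
Proof. by move=> E; apply: funext => z; rewrite /hfun !(hval_max _ E). Qed.

Lemma internal_metric_inj x y : internal_metric x = internal_metric y -> x = y.
Proof.
move=> E; apply/eqP; rewrite -subr_eq0; apply/eqP/unorm_eq0.
have := congr1 (fun h => h x) E; have := congr1 (fun h => h y) E.
rewrite /internal_metric !subrr !unorm0 -(unormN (y - x)) opprB.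
by have := unorm_ge0 (x - y); lra.
Qed.

Lemma internal_metric_ge y z : - unorm y <= internal_metric y z.
Proof. by rewrite /internal_metric lerDr unorm_ge0. Qed.

(** For [hsc k] > 0, the element y encoded by k, recovered from [hpos] = [hsc] e^y. *)
Definition hpt k : V := \sum_i ln (hpos k i / hsc k) *: hfr k i.

Lemma hpos_gt0 k i : 0 < hsc k -> 0 < hpos k i.
Proof.
move=> s0; rewrite lt_neqAle hpos_ge0 andbT; apply/eqP => p0.
have := hposneg k i; rewrite -p0 mul0r => /esym/eqP.
by rewrite sqrf_eq0 gt_eqF.
Qed.

Lemma hneg_gt0 k i : 0 < hsc k -> 0 < hneg k i.
Proof. exact: (@hpos_gt0 (hswap k)). Qed.

Lemma hpt_swap k : 0 < hsc k -> hpt (hswap k) = - hpt k.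
Proof.
move=> s0; rewrite /hpt -sumrN; apply: eq_bigr => i _; rewrite -scaleNr /=.
have p0 := hpos_gt0 i s0; have n0 := hneg_gt0 i s0.
rewrite -lnV ?posrE ?divr_gt0 //; congr (ln _ *: _).
rewrite invf_div; apply/eqP.
rewrite eqr_div ?(lt0r_neq0 s0) ?(lt0r_neq0 p0) // mulrC.
by rewrite hposneg expr2.
Qed.

Lemma weight_interior k z w : 0 < hsc k -> state_space w ->
  weight (hfr k) (hpos k) (- z) w = hsc k * expR ⟪w, hpt k - z⟫.
Proof.
move=> s0 sw; rewrite weight_supported; last first.
  by move=> i pi0; have := hpos_gt0 i s0; rewrite pi0 ltxx.
rewrite -[hsc k in RHS]lnK ?posrE // -expRD; congr expR.
rewrite tipBr tipNr /hpt tip_sumr.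
have -> : ln (hsc k) = \sum_i ln (hsc k) * ⟪w, hfr k i⟫.
  by rewrite -mulr_sumr (state_tip_sum (hfrP k) sw) mulr1.
rewrite addrA -big_split /= addrC; congr (_ + _); apply: eq_bigr => i _.
by rewrite tipZr -mulrDl ln_div ?posrE ?hpos_gt0 // addrCA subrr addr0.
Qed.

(** With y = [hpt k], the two families of weights are hsc e^(-⟪z - y, w⟫) and hsc e^⟪z - y, w⟫, and
    the norm of z - y is the maximum of |⟪z - y, w⟫| over the states. *)
Lemma hmax_interior k z : 0 < hsc k -> hmax k z = hsc k * expR (unorm (z - hpt k)).
Proof.
move=> s0.
have W1 w : state_space w -> weight (hfr k) (hpos k) (- z) w = hsc k * expR (- ⟪z - hpt
  k, w⟫).
  by move=> sw; rewrite weight_interior // -(opprB z) tipNr tipC.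
have W2 w : state_space w -> weight (hfr k) (hneg k) z w = hsc k * expR ⟪z - hpt k, w⟫.
  move=> sw; have := @weight_interior (hswap k) (- z) w s0 sw; rewrite opprK /= => ->.
  by rewrite hpt_swap // addrC tipC.
have := unormP (z - hpt k) => -[[c pc cE] mx].
apply/le_anti/andP; split.
  by apply: hmax_le => w sw; rewrite ?W1 ?W2 // ler_pM2l // ler_expR
    (le_trans _ (mx w sw)) // ?ler_norm // -normrN ler_norm.
have sc := jprim_state pc; rewrite -cE.
have [c0|c0] := leP 0 ⟪z - hpt k, c⟫.
  by rewrite ger0_norm // -W2 //; exact: weight_neg_le.
by rewrite ltr0_norm // -W1 //; exact: weight_pos_le.
Qed.

Lemma hfun_interior k : 0 < hsc k -> hfun k = internal_metric (hpt k).
Proof.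
move=> s0; apply: funext => z; rewrite /hfun !hmax_interior //.
rewrite !lnM ?posrE ?expR_gt0 // !expRK sub0r unormN /internal_metric.
by rewrite opprD addrACA subrr add0r.
Qed.

Lemma hval_interior k : 0 < hsc k ->
  hval k = phi_point (hfr k) (fun i => ln (hpos k i / hsc k)).
Proof.
move=> s0; rewrite /phi_point.
have E1 i : expR (ln (hpos k i / hsc k)) = hpos k i / hsc k.
  by rewrite lnK // posrE divr_gt0 // hpos_gt0.
have E2 i : expR (- ln (hpos k i / hsc k)) = hneg k i / hsc k.
  rewrite expRN E1 invf_div; have p0 := hpos_gt0 i s0.
  apply/eqP; rewrite eqr_div ?(lt0r_neq0 s0) ?(lt0r_neq0 p0) //.
  by rewrite [X in _ == X]mulrC hposneg expr2.
under eq_bigr do rewrite E1 E2 -mulrDl.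
rewrite -mulr_suml hsum1 mul1r invrK scaler_sumr; apply: eq_bigr => i _.
by rewrite E1 E2 -mulrBl scalerA mulrCA divff ?mulr1 // gt_eqF.
Qed.

Section Interior.
Context {p : 'I_n -> V} (fp : jframe junit p) (lam : 'I_n -> R).

Let D := \sum_i (expR (lam i) + expR (- lam i)).

Let D0 : 0 < D.
Proof. by apply: (sumr_gt0_jframe fp) => i; rewrite addr_gt0 ?expR_gt0. Qed.

Definition hinterior : @hpoint R V n.
Proof.
apply: (@HPoint R V n p (fun i => expR (lam i) / D) (fun i => expR (- lam i) / D) D^-1 fp).
- by move=> i; rewrite divr_ge0 ?expR_ge0 // ltW.
- by move=> i; rewrite divr_ge0 ?expR_ge0 // ltW.
- by rewrite invr_ge0 ltW.
- under eq_bigr do rewrite -mulrDl.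
  by rewrite -mulr_suml divff // gt_eqF.
- by move=> i; rewrite mulrACA expRxMexpNx_1 mul1r expr2.
Defined.

Lemma hinterior_sc : 0 < hsc hinterior.
Proof. by rewrite /= invr_gt0. Qed.

Let hinterior_lam i : ln (hpos hinterior i / hsc hinterior) = lam i.
Proof. by rewrite /= invrK divfK ?expRK // gt_eqF. Qed.

Lemma hinterior_fun : hfun hinterior = internal_metric (\sum_i lam i *: p i).
Proof.
rewrite hfun_interior ?hinterior_sc //; congr internal_metric; apply: eq_bigr => i _.
by rewrite hinterior_lam.
Qed.

Lemma hinterior_val : hval hinterior = phi_point p lam.
Proof.
rewrite hval_interior ?hinterior_sc // /phi_point.
congr (_^-1 *: _); apply: eq_bigr => i _; by rewrite hinterior_lam.
Qed.

End Interior.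

(** The coefficients, over the whole frame, of the exponential of - sum_i alpha_i p_i computed in
    V(p_I). *)
Definition horo_pos (I : {set 'I_n}) (alpha : 'I_n -> R) i : R :=
  if i \in I then expR (- alpha i) else 0.

Lemma horo_pos_ge0 I alpha i : 0 <= horo_pos I alpha i.
Proof. by rewrite /horo_pos; case: ifP => // _; exact: expR_ge0. Qed.

Lemma sum_horo_pos I alpha : \sum_i horo_pos I alpha i = \sum_(i in I) expR (- alpha i).
Proof. by rewrite [RHS]big_mkcond. Qed.

Lemma sumZ_horo_pos I alpha p :
  \sum_i horo_pos I alpha i *: p i = \sum_(i in I) expR (- alpha i) *: p i.
Proof.
by rewrite [RHS]big_mkcond; apply: eq_bigr => i _; rewrite /horo_pos; case: ifP;
  rewrite ?scale0r.
Qed.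

Lemma expmax_horo I alpha p z i : jframe junit p -> i \in I ->
  expmax p (horo_pos I alpha) z = expR (max_eigenvalue (psum p I)
    (quad (psum p I) z - \sum_(i in I) alpha i *: p i)).
Proof.
move=> fp iI; have ai : horo_pos I alpha i != 0 by rewrite /horo_pos iI gt_eqF ?expR_gt0.
have supp : [set i | horo_pos I alpha i != 0]%SET = I.
  by apply/setP => j; rewrite inE /horo_pos; case: ifP; rewrite ?eqxx // gt_eqF ?expR_gt0.
have [-> _] := expmax_support fp z ai; rewrite supp.
congr (expR (max_eigenvalue _ (_ + _))); rewrite -sumrN; apply: eq_bigr => j jI.
by rewrite /horo_pos jI expRK scaleNr.
Qed.

Section Boundary.
Context {p : 'I_n -> V} {I J : {set 'I_n}} {alpha : 'I_n -> R}
  (H : horo_data p I J alpha).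

Let fp : jframe junit p.
Proof. by case: H => /(jordan_frameE _ (jmul1 _)). Qed.

Let S := \sum_i (horo_pos I alpha i + horo_pos J alpha i).

Let S0 : 0 < S.
Proof.
have [_ _ _ _ [i iIJ ai]] := H; rewrite /S (bigD1 i) //= ltr_pwDl //; last first.
  by rewrite sumr_ge0 // => j _; rewrite addr_ge0 ?horo_pos_ge0.
rewrite inE in iIJ; case/orP: iIJ => iI.
  by rewrite ltr_pwDl ?horo_pos_ge0 // /horo_pos iI expR_gt0.
by rewrite ltr_wpDl ?horo_pos_ge0 // /horo_pos iI expR_gt0.
Qed.

Definition hboundary : @hpoint R V n.
Proof.
apply: (@HPoint R V n p (fun i => S^-1 * horo_pos I alpha i)
  (fun i => S^-1 * horo_pos J alpha i) 0 fp).
- by move=> i; rewrite mulr_ge0 ?horo_pos_ge0 // invr_ge0 ltW.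
- by move=> i; rewrite mulr_ge0 ?horo_pos_ge0 // invr_ge0 ltW.
- by [].
- under eq_bigr do rewrite -mulrDr.
  by rewrite -mulr_sumr mulVf // gt_eqF.
- move=> i; rewrite expr0n /=; have [_ dIJ _ _ _] := H.
  rewrite /horo_pos; case: ifP => iI; last by rewrite mulr0 mul0r.
  by rewrite (disjointFr dIJ iI) !mulr0.
Defined.

Lemma hboundary_val : hval hboundary = phi_horo p I J alpha.
Proof.
rewrite hvalE /hposv /hnegv /= /phi_horo.
under eq_bigr do rewrite -scalerA.
under [X in _ - X]eq_bigr do rewrite -scalerA.
rewrite -!scaler_sumr -scalerBr !sumZ_horo_pos; congr (_^-1 *: _).
by rewrite /S big_split /= !sum_horo_pos.
Qed.

Let hmaxE z : hmax hboundary z = S^-1 *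
  Num.max (expmax p (horo_pos I alpha) (- z)) (expmax p (horo_pos J alpha) z).
Proof.
rewrite /hmax /= !expmax_scale ?invr_gt0 //; try exact: horo_pos_ge0.
by rewrite maxr_pMr // invr_ge0 ltW.
Qed.

Let expmax_horo0 K : (forall i, 0 <= horo_pos K alpha i <= 1) ->
  expmax p (horo_pos K alpha) 0 <= 1.
Proof.
move=> K1; have [w sw <-] := expmax_attained (a := horo_pos K alpha) fp 0.
apply: le_trans (weight_le_bound fp _ _ sw _) _ => [i|i|].
- by case/andP: (K1 i).
- by case/andP: (K1 i).
- by rewrite unorm0 expR0.
Qed.

(** The normalization min alpha = 0 enters here: the largest coefficient before division by S is 1.
    Hence [hfun], which subtracts the value at 0, gives (∗) without an additive constant. *)
Let hmax0 : hmax hboundary 0 = S^-1.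
Proof.
rewrite hmaxE oppr0 -[RHS]mulr1; congr (_ * _).
have [_ _ _ a0 [i iIJ ai]] := H; have [pp _ _] := fp.
have K1 K : K \subset (I :|: J)%SET -> forall i, 0 <= horo_pos K alpha i <= 1.
  move=> /fintype.subsetP sK j; rewrite horo_pos_ge0 /horo_pos /=; case: ifP => // jK.
  by rewrite expR_le1 oppr_le0 a0 // sK.
have one K : i \in K -> 1 <= expmax p (horo_pos K alpha) 0.
  move=> iK; apply: le_trans (weight_le_expmax fp _ (jprim_state (pp i))).
  rewrite weight_supported; last first.
    move=> j; rewrite /horo_pos; case: ifP => [_ /eqP|jK _];
      first by rewrite gt_eqF ?expR_gt0.
    by rewrite (jframe_tip _ _ fp); case: eqP => // ij; rewrite -ij iK in jK.
  rewrite (tipC _ 0) tip0l add0r (bigD1 i) //= big1 ?addr0.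
    by rewrite /horo_pos iK ai oppr0 expR0 ln1 mul0r expR0.
  by move=> j ji; rewrite (jframe_tip _ _ fp) eq_sym (negbTE ji) mulr0.
apply/le_anti/andP; split.
  by rewrite ge_max !expmax_horo0 //; apply: K1;
    [exact: finset.subsetUr|exact: finset.subsetUl].
rewrite inE in iIJ; rewrite le_max.
by case/orP: iIJ => /one ->; rewrite ?orbT.
Qed.

Lemma hboundary_fun : hfun hboundary = horo_fun p I J alpha.
Proof.
apply: funext => z; rewrite /hfun hmax0 hmaxE.
have lnmax (u v : R) : ln (Num.max (expR u) (expR v)) = Num.max u v.
  have [uv|vu] := leP u v; first by rewrite max_r ?expRK // ler_expR.
  by rewrite max_l ?expRK // ler_expR ltW.
have lnS (X : R) : 0 < X -> ln (S^-1 * X) - ln S^-1 = ln X.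
  by move=> X0; rewrite lnM ?posrE ?invr_gt0 // addrAC subrr add0r.
have [_ _ IJ0 _ _] := H; rewrite /horo_fun.
have [J0|Jn0] := eqVneq J finset.set0.
  have [I0|/set0Pn[i iI]] := eqVneq I finset.set0.
    by rewrite I0 J0 finset.setU0 eqxx in IJ0.
  rewrite (@expmax_horo I alpha p _ i) // (@expmax0 _ _ _ _ fp (horo_pos J alpha));
    last first.
    by move=> j; rewrite /horo_pos J0 inE.
  rewrite max_l ?expR_ge0 // lnS ?expR_gt0 // expRK.
  by rewrite quadN.
have [j jJ] := set0Pn _ Jn0.
rewrite (@expmax_horo J alpha p _ j) //.
have [I0|/set0Pn[i iI]] := eqVneq I finset.set0.
  rewrite (@expmax0 _ _ _ _ fp (horo_pos I alpha)); last by move=> i;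
    rewrite /horo_pos I0 inE.
  by rewrite max_r ?expR_ge0 // lnS ?expR_gt0 // expRK.
by rewrite (@expmax_horo I alpha p _ i) // lnS ?lt_max ?expR_gt0 // lnmax quadN.
Qed.

End Boundary.

(** At each index at most one of the two coefficients is nonzero, so f is that coefficient.
    Measuring -ln f from its value at the maximizer m makes the minimum of alpha equal to 0. *)
Lemma hval_boundary k : hsc k = 0 -> exists I J alpha,
  [/\ horo_data (hfr k) I J alpha, hval k = phi_horo (hfr k) I J alpha,
      I = [set i | hpos k i != 0]%SET & J = [set i | hneg k i != 0]%SET].
Proof.
move=> s0; pose I : {set 'I_n} := [set i | hpos k i != 0]%SET.
pose J : {set 'I_n} := [set i | hneg k i != 0]%SET.
have pn i : hpos k i * hneg k i = 0 by rewrite hposneg s0 expr0n.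
pose f i := hpos k i + hneg k i.
have [i0 _] := jframe_ord0 (hfrP k).
have [m mf] := fin_argmax f i0.
have fm : 0 < f m.
  rewrite ltNge; apply/negP => fm; have := hsum1 k; rewrite big1 => [/eqP|i _].
    by rewrite eq_sym oner_eq0.
  by apply/le_anti; rewrite (le_trans (mf i) fm) addr_ge0 ?hpos_ge0 ?hneg_ge0.
have fI i : i \in I -> f i = hpos k i.
  rewrite inE => pi; rewrite /f; have /eqP := pn i.
  by rewrite mulf_eq0 (negbTE pi) => /eqP ->; rewrite addr0.
have fJ i : i \in J -> f i = hneg k i.
  rewrite inE => pi; rewrite /f; have /eqP := pn i.
  by rewrite mulf_eq0 (negbTE pi) orbF => /eqP ->; rewrite add0r.
have mIJ : m \in (I :|: J)%SET.
  rewrite !inE -negb_and; apply/negP => /andP[/eqP h1 /eqP h2].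
  by move: fm; rewrite /f h1 h2 addr0 ltxx.
have fIJ i : i \in (I :|: J)%SET -> 0 < f i.
  rewrite finset.in_setU => /orP[iI|iJ].
    by rewrite fI // lt_neqAle hpos_ge0 andbT eq_sym; move: iI; rewrite inE.
  by rewrite fJ // lt_neqAle hneg_ge0 andbT eq_sym; move: iJ; rewrite inE.
have II i : i \in I -> i \in (I :|: J)%SET by rewrite finset.in_setU => ->.
have JJ i : i \in J -> i \in (I :|: J)%SET by rewrite finset.in_setU orbC => ->.
pose alpha i := ln (f m) - ln (f i).
have expa i : i \in (I :|: J)%SET -> expR (- alpha i) = f i / f m.
  by move=> iIJ; rewrite opprB expRB !lnK ?posrE ?fIJ.
have E1 : \sum_(i in I) expR (- alpha i) = (\sum_i hpos k i) / f m.
  rewrite mulr_suml big_mkcond; apply: eq_bigr => i _ /=; case: ifPn => iI.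
    by rewrite expa ?II // (fI _ iI).
  by move: iI; rewrite inE negbK => /eqP ->; rewrite mul0r.
have E2 : \sum_(i in J) expR (- alpha i) = (\sum_i hneg k i) / f m.
  rewrite mulr_suml big_mkcond; apply: eq_bigr => i _ /=; case: ifPn => iI.
    by rewrite expa ?JJ // (fJ _ iI).
  by move: iI; rewrite inE negbK => /eqP ->; rewrite mul0r.
exists I, J, alpha; split=> //.
  split.
  - by apply/jordan_frameE; [exact: jmul1|exact: hfrP].
  - rewrite disjoint_subset; apply/fintype.subsetP => i; rewrite !inE negbK => pi.
    by have /eqP := pn i; rewrite mulf_eq0 (negbTE pi).
  - by apply/set0Pn; exists m.
  - by move=> i iIJ; rewrite subr_ge0 ler_ln ?posrE ?fIJ.
  - by exists m => //; rewrite /alpha subrr.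
rewrite /phi_horo E1 E2 -mulrDl -big_split /= hsum1 mul1r invrK scalerBr !scaler_sumr hvalE.
congr (_ - _); rewrite [RHS]big_mkcond; apply: eq_bigr => i _ /=; case: ifPn => iI.
- by rewrite expa ?II // scalerA (fI _ iI) mulrC divfK // gt_eqF.
- by move: iI; rewrite inE negbK => /eqP ->; rewrite scale0r.
- by rewrite expa ?JJ // scalerA (fJ _ iI) mulrC divfK // gt_eqF.
- by move: iI; rewrite inE negbK => /eqP ->; rewrite scale0r.
Qed.

End HEquiv.

(** * From functions back to elements of the dual ball *)

Section HInj.
Context {R : realType} {V : euclideanJordanType R} {n : nat}.
Implicit Types (x y z w : V) (k l : @hpoint R V n) (M c : R).

(** For [hsc k] = 0, chosen so that hpos e^-z and hneg e^z both equal e^-M on their supports. The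
    coefficient contains -M on the whole kernel of [hpos], also where [hneg] vanishes and ln 0 =
    0. *)
Definition htest k M : V :=
  \sum_i (if hpos k i != 0 then ln (hpos k i) + M else - (ln (hneg k i) + M)) *: hfr k i.

Lemma hmax_htest k M : hsc k = 0 -> hmax k (htest k M) <= expR (- M).
Proof.
move=> s0; have pn i : hpos k i * hneg k i = 0 by rewrite hposneg s0 expr0n.
have pow (a : R) : 0 <= a -> a * expR (- (ln a + M)) <= expR (- M).
  move=> a0; have [->|an0] := eqVneq a 0; first by rewrite mul0r expR_ge0.
  have ap : 0 < a by rewrite lt_neqAle eq_sym an0.
  by rewrite opprD expRD (expRN (ln a)) lnK ?posrE // mulrA divff // mul1r.
rewrite ge_max; apply/andP; split.
  rewrite /htest -sumrN; under eq_bigr do rewrite -scaleNr.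
  apply: expmax_diag_le; rewrite ?expR_gt0 //; [exact: hfrP|exact: hpos_ge0|].
  move=> i; have [->|pi] := eqVneq (hpos k i) 0; first by rewrite mul0r expR_ge0.
  exact/pow/hpos_ge0.
apply: expmax_diag_le; rewrite ?expR_gt0 //; [exact: hfrP|exact: hneg_ge0|].
move=> i; case: ifPn => [pi|_]; last exact/pow/hneg_ge0.
by have /eqP := pn i; rewrite mulf_eq0 (negbTE pi) => /eqP ->; rewrite mul0r expR_ge0.
Qed.

(** Internal metrics are bounded below by [internal_metric_ge], so this separates horofunctions from
    them. *)
Lemma hfun_unbounded k c : hsc k = 0 -> exists z, hfun k z < c.
Proof.
move=> s0; pose M := 1 - c - ln (hmax k 0); exists (htest k M).
have : ln (hmax k (htest k M)) <= - M.
  by rewrite -[leRHS]expRK ler_ln ?posrE ?expR_gt0 ?hmax_gt0 // hmax_htest.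
rewrite /hfun; move: (ln (hmax k (htest k M))) => u; rewrite /M.
by move: (ln (hmax k 0)) => v; lra.
Qed.

Lemma hfun_sc0 k l : hfun k = hfun l -> hsc k = 0 -> hsc l = 0.
Proof.
move=> E s0; apply/eqP; apply: contraT => l0.
have lp : 0 < hsc l by rewrite lt_neqAle eq_sym l0 hsc_ge0.
have [z] := hfun_unbounded (- unorm (hpt l)) s0; rewrite ltNge => /negP; case.
by rewrite E (hfun_interior lp) internal_metric_ge.
Qed.

(* Evaluate at [htest k M]: M -> +oo yields the inclusion of supports, M = 0 the
   inequality between the logarithms. *)
Lemma hmax_dominated k l c w : hsc k = 0 -> state_space w ->
  (forall z, hmax l z <= expR c * hmax k z) ->
  supported (hfr l) (hpos l) w ->
  supported (hfr k) (hpos k) w /\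
  \sum_i ln (hpos l i) * ⟪w, hfr l i⟫ <= c + \sum_i ln (hpos k i) * ⟪w, hfr k i⟫.
Proof.
move=> s0 sw lk sl; set D := \sum_i _.
pose W0 := \sum_(i | hpos k i == 0) ⟪w, hfr k i⟫.
pose C := \sum_i (if hpos k i != 0 then ln (hpos k i) else - ln (hneg k i)) * ⟪w, hfr k i⟫.
have H M : 2 * W0 * M + D <= c + C.
  have : weight (hfr l) (hpos l) (- htest k M) w <= expR (c - M).
    apply: le_trans (weight_pos_le _ _ sw) (le_trans (lk _) _).
    by rewrite expRD ler_wpM2l ?expR_ge0 // hmax_htest.
  rewrite weight_supported // ler_expR -/D tipNr.
  have -> : ⟪w, htest k M⟫ = C + M - 2 * W0 * M.
    have W0E : W0 = \sum_i (if hpos k i == 0 then ⟪w, hfr k i⟫ else 0).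
      by rewrite /W0 big_mkcond.
    have ME : M = \sum_i M * ⟪w, hfr k i⟫.
      by rewrite -mulr_sumr (state_tip_sum (hfrP k) sw) mulr1.
    rewrite mulrAC W0E {2}ME mulr_sumr -addrA -sumrB /C -big_split /= tip_sumr.
    by apply: eq_bigr => i _; rewrite tipZr; case: eqP => _ /=; ring.
  by lra.
have W0ge : 0 <= W0 by apply: sumr_ge0 => i _; exact: (state_tip_ge0 (hfrP k) _ sw).
have W00 : W0 = 0.
  apply/le_anti; rewrite W0ge andbT leNgt; apply/negP => Wp.
  (* For this M the inequality reads c + C + 1 <= c + C. *)
  have := H ((c + C - D + 1) / (2 * W0)).
  have -> : 2 * W0 * ((c + C - D + 1) / (2 * W0)) = c + C - D + 1.
    by rewrite mulrC divfK // mulf_neq0 ?gt_eqF.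
  by lra.
have sk : supported (hfr k) (hpos k) w.
  move=> i ki; apply: (psumr_eq0P _ W00); last exact/eqP.
  by move=> j _; exact: (state_tip_ge0 (hfrP k) _ sw).
split=> //; have := H 0; rewrite mulr0 add0r => /le_trans; apply.
rewrite lerD2l /C le_eqVlt; apply/orP; left; apply/eqP; apply: eq_bigr => i _.
by case: eqP => // ki; rewrite sk // !mulr0.
Qed.

(** Domination in both directions yields equal supports e and, on every state of V(e), logarithms
    that differ by c. Hence L' = L + c e for the two logarithms, and the eigenvalues are then
    matched through [jframe_eqP]. *)
Lemma hposv_scale k l c : hsc k = 0 -> hsc l = 0 ->
  (forall z, hmax l z = expR c * hmax k z) -> hposv l = expR c *: hposv k.
Proof.
move=> k0 l0 lk.
have kl z : hmax k z <= expR (- c) * hmax l z.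
  by rewrite lk mulrA expRN mulVf ?mul1r // gt_eqF ?expR_gt0.
have lk' z : hmax l z <= expR c * hmax k z by rewrite lk.
have dom1 w sw := @hmax_dominated k l c w k0 sw lk'.
have dom2 w sw := @hmax_dominated l k (- c) w l0 sw kl.
have pst i := jprim_state (let: And3 pp _ _ := hfrP k in pp i).
have qst i := jprim_state (let: And3 pp _ _ := hfrP l in pp i).
have self (m : @hpoint R V n) i : hpos m i != 0 -> supported (hfr m) (hpos m) (hfr m i).
  move=> mi j mj; rewrite (jframe_tip _ _ (hfrP m)); case: eqP => // ij.
  by rewrite ij mj eqxx in mi.
have orth0 i j : ⟪hfr k i, hfr l j⟫ = 0 -> hfr k i • hfr l j = 0.
  move=> ij; rewrite jmulC; apply: cone_orth => //; first by case: (pst i).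
  by have [qq _ _] := hfrP l; exact: jprim_idem.
pose I : {set 'I_n} := [set i | hpos k i != 0]%SET.
pose e := psum (hfr k) I.
have ee : e • e = e := psum_idem (hfrP k) I.
pose L := \sum_i ln (hpos k i) *: hfr k i; pose L' := \sum_i ln (hpos l i) *: hfr l i.
have tL w : ⟪w, L⟫ = \sum_i ln (hpos k i) * ⟪w, hfr k i⟫.
  by rewrite tip_sumr; apply: eq_bigr => i _; rewrite tipZr.
have tL' w : ⟪w, L'⟫ = \sum_i ln (hpos l i) * ⟪w, hfr l i⟫.
  by rewrite tip_sumr; apply: eq_bigr => i _; rewrite tipZr.
(* Here ln 0 = 0 keeps the kernel indices out of L. *)
have eL : e • L = L.
  rewrite jmul_sumr; apply: eq_bigr => i _; rewrite jmulZr (psum_mul1 (hfrP k)) inE.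
  by case: eqP => //= ->; rewrite ln0 // !scale0r.
have eL' : e • L' = L'.
  rewrite jmul_sumr; apply: eq_bigr => i _; rewrite jmulZr.
  have [->|li] := eqVneq (hpos l i) 0; first by rewrite ln0 // !scale0r.
  by congr (_ *: _); apply/(supportedE (hfrP k) (qst i));
    case: (dom1 _ (qst i) (self l i li)).
have LL : L' = L + c *: e.
  (* The difference D lies in V(e), so it vanishes once it pairs to 0 with the members of its own
     spectral frame, which are states of V(e). *)
  apply/eqP; rewrite -subr_eq0; apply/eqP; set D := _ - _.
  have eD : e • D = D by rewrite jmulBr jmulDr jmulZr eL eL' ee.
  have [r [f [d [ff DE]]]] := jspectral ee eD; have [ffp _ _] := ff.
  rewrite DE big1 // => i _; rewrite -(jframe_coef d i ff) -DE tipC.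
  have si := jprim_state (ffp i); have ef := jframe_unit_mul i ff.
  have sk : supported (hfr k) (hpos k) (f i) by apply/(supportedE (hfrP k) si).
  have [sl h2] := dom2 _ si sk; have [_ h1] := dom1 _ si sl.
  have fe : ⟪f i, e⟫ = 1.
    by rewrite tipC -[e]jmulr1 tip_selfadj ef state_tip1.
  rewrite /D tipBr tipDr tipZr fe tL tL' mulr1.
  suff -> : \sum_i0 ln (hpos l i0) * ⟪f i, hfr l i0⟫ =
      c + \sum_i0 ln (hpos k i0) * ⟪f i, hfr k i0⟫ by rewrite (addrC c) subrr scale0r.
  apply/le_anti; rewrite h1 /=; move: h2; set u := \sum_i0 _; set v := \sum_i0 _; lra.
rewrite /hposv scaler_sumr; under [RHS]eq_bigr do rewrite scalerA.
apply/jframe_eqP; [exact: hfrP|exact: hfrP|move=> i j].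
have [li|li] := eqVneq (hpos l i) 0; have [kj|kj] := eqVneq (hpos k j) 0.
- by right; rewrite li kj mulr0.
- left; rewrite jmulC; apply: orth0.
  by have [sl _] := dom2 _ (pst j) (self k j kj); exact: sl.
- left; rewrite jmulC; apply: orth0; rewrite tipC.
  by have [sl _] := dom1 _ (qst i) (self l i li); exact: sl.
have lp : 0 < hpos l i by rewrite lt_neqAle eq_sym li hpos_ge0.
have kp : 0 < hpos k j by rewrite lt_neqAle eq_sym kj hpos_ge0.
have h1 : ⟪L' • hfr l i, hfr k j⟫ = ln (hpos l i) * ⟪hfr l i, hfr k j⟫.
  by rewrite (jframe_sum_mul _ _ (hfrP l)) tipZl.
have h2 : ⟪L' • hfr l i, hfr k j⟫ = (ln (hpos k j) + c) * ⟪hfr l i, hfr k j⟫.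
  rewrite tip_selfadj LL jmulDl jmulZl (jframe_sum_mul _ _ (hfrP k)).
  by rewrite (psum_mul1 (hfrP k)) inE kj -scalerDl tipZr.
have [E|ne] := eqVneq (ln (hpos l i)) (ln (hpos k j) + c).
  by right; rewrite -[LHS]lnK ?posrE // E expRD lnK ?posrE // mulrC.
left; rewrite jmulC; apply: orth0; rewrite tipC.
have /eqP : (ln (hpos l i) - (ln (hpos k j) + c)) * ⟪hfr l i, hfr k j⟫ = 0.
  by rewrite mulrBl -h1 -h2 subrr.
by rewrite mulf_eq0 subr_eq0 (negbTE ne) => /eqP.
Qed.

Lemma jtrace_hposv k : jtrace (hposv k) + jtrace (hnegv k) = 1.
Proof.
rewrite /hposv /hnegv !(jtrace_frame _ (hfrP k)) -big_split; exact: hsum1.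
Qed.

(** In the interior the metrics determine their base points. On the boundary equal functions give
    proportional [hmax], hence both parts scale by the same e^c, and the total trace 1 forces e^c =
    1. *)
Lemma hfun_val k l : hfun k = hfun l -> hval k = hval l.
Proof.
move=> E; have [k0|kn0] := eqVneq (hsc k) 0; last first.
  have kp : 0 < hsc k by rewrite lt_neqAle eq_sym kn0 hsc_ge0.
  have lp : 0 < hsc l.
    rewrite lt_neqAle hsc_ge0 andbT; apply: contraNneq kn0 => l0.
    by rewrite (hfun_sc0 (esym E) (esym l0)).
  move: E; rewrite !hfun_interior // => /internal_metric_inj E.
  have tr (m : @hpoint R V n) : 0 < hsc m ->
      \sum_i (expR (ln (hpos m i / hsc m)) + expR (- ln (hpos m i / hsc m))) = (hsc m)^-1.
    move=> m0; rewrite -[RHS]mul1r -(hsum1 m) mulr_suml; apply: eq_bigr => i _.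
    have p0 := hpos_gt0 i m0.
    rewrite expRN lnK ?posrE ?divr_gt0 // invf_div mulrDl; congr (_ + _).
    apply/eqP; rewrite eqr_div ?(lt0r_neq0 m0) ?(lt0r_neq0 p0) //.
    by rewrite [X in _ == X]mulrC hposneg expr2.
  rewrite !hval_interior // /phi_point.
  by rewrite (jframe_sum_funcalc (fun r : R => expR r + expR (- r)) (hfrP k) (hfrP l) E)
     (jframe_funcalc (fun r : R => expR r - expR (- r)) (hfrP k) (hfrP l) E).
have l0 := hfun_sc0 E k0.
pose c := ln (hmax l 0) - ln (hmax k 0).
have lk z : hmax l z = expR c * hmax k z.
  have := congr1 (fun h => h z) E; rewrite /hfun /c.
  move: (hmax_gt0 k z) (hmax_gt0 l z); move: (hmax k z) (hmax l z) => s t s0 t0.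
  move: (ln (hmax k 0)) (ln (hmax l 0)) => u v E'.
  have ts : ln t = v - u + ln s by rewrite -[LHS](subrK v) -E'; ring.
  have lns : expR (ln s) = s by rewrite lnK.
  have lnt : expR (ln t) = t by rewrite lnK.
  by rewrite -lnt ts expRD lns.
have P := hposv_scale k0 l0 lk.
have N : hnegv l = expR c *: hnegv k.
  by apply: (@hposv_scale (hswap k) (hswap l) c k0 l0) => z; rewrite !hmax_swap.
have := jtrace_hposv l; rewrite P N !jtraceZ -mulrDr jtrace_hposv mulr1 => c1.
by rewrite !hvalE P N c1 !scale1r.
Qed.

End HInj.

(** * The dual ball *)

Section DualBall.
Context {R : realType} {V : euclideanJordanType R}.
Implicit Types (x y z w : V) (A B : set V).

Lemma convex_setE A : convex_set (A : set (convex_lmodType V)) <->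
  (forall x y (t : R), 0 <= t -> t <= 1 -> A x -> A y -> A (t *: x + (1 - t) *: y)).
Proof.
split=> [cA x y t t0 t1 Ax Ay|cA x y t].
  have := cA x y (Itv01 t0 t1) (mem_set Ax) (mem_set Ay); rewrite inE.
  by [].
rewrite !inE => Ax Ay; apply: cA => //.
Qed.

Lemma conv_convex A x y (t : R) : 0 <= t -> t <= 1 ->
  Defs.conv A x -> Defs.conv A y -> Defs.conv A (t *: x + (1 - t) *: y).
Proof.
move=> t0 t1 Ax Ay B [cB AB]; have /convex_setE := cB; apply=> //.
  exact: Ax.
exact: Ay.
Qed.

Lemma conv_min A B : (forall x y (t : R), 0 <= t -> t <= 1 -> B x -> B y ->
  B (t *: x + (1 - t) *: y)) -> A `<=` B -> Defs.conv A `<=` B.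
Proof. by move=> cB AB; apply: smallest_sub => //; exact/convex_setE. Qed.

Lemma sub_conv A : A `<=` Defs.conv A.
Proof. by move=> x Ax B [_]; apply. Qed.

Lemma cone_jtrace_ge0 x : cone x -> 0 <= jtrace x.
Proof. by move=> cx; rewrite -tip1 tipC cone_tip_idem // jmul1. Qed.

Lemma jtrace0 : jtrace (0 : V) = 0.
Proof. by rewrite -(scale0r 0) jtraceZ mul0r. Qed.

Lemma cone_jtrace_eq0 x : cone x -> jtrace x = 0 -> x = 0.
Proof.
move=> cx x0; rewrite -[LHS]jmul1; apply: cone_orth; rewrite ?jmul1 //.
by rewrite tipC tip1.
Qed.

(* [jball junit junit] is the dual ball, and [jball (psum p I) (psum p J)] the face
   [horo_face p I J]. *)
Definition jball e f x : Prop := exists a b,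
  [/\ cone a, cone b, e • a = a, f • b = b & jtrace a + jtrace b = 1 /\ x = a - b].

(** a - b is the combination of a / tr a and -b / tr b with coefficients tr a and tr b; if one trace
    is 0, the corresponding cone element is 0. *)
Lemma conv_jball e f :
  Defs.conv ([set x | e • x = x /\ state_space x] `|`
        [set x | f • x = x /\ neg_state_space x]) = jball e f.
Proof.
apply/seteqP; split.
  apply: conv_min.
    move=> _ _ t t0 t1 [a [b [ca cb ea fb [t_ab ->]]]] [c [d [cc cd ec fd [t_cd ->]]]].
    have t1' : 0 <= 1 - t by rewrite subr_ge0.
    exists (t *: a + (1 - t) *: c), (t *: b + (1 - t) *: d); split.
    - by apply: coneD; apply: coneZ.
    - by apply: coneD; apply: coneZ.
    - by rewrite jmulDr !jmulZr ea ec.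
    - by rewrite jmulDr !jmulZr fb fd.
    - rewrite !jtraceD !jtraceZ; split; first by nra.
      by rewrite !scalerBr opprD addrACA.
  move=> x [[ex [cx x1]]|[fx [y [cy y1] yx]]].
    exists x, 0; split=> //; [exact: cone0|exact: jmulr0|].
    by rewrite jtrace0 addr0 subr0 -tip1.
  exists 0, y; split=> //; [exact: cone0|exact: jmulr0| |].
    by rewrite -yx jmulNr in fx; exact: oppr_inj.
  by rewrite jtrace0 add0r sub0r -tip1.
move=> _ [a [b [ca cb ea fb [tab ->]]]].
have norm (c g : V) : cone c -> g • c = c -> 0 < jtrace c ->
    g • ((jtrace c)^-1 *: c) = (jtrace c)^-1 *: c /\ state_space ((jtrace c)^-1 *: c).
  move=> cc gc c0; split; first by rewrite jmulZr gc.
  by apply/state_spaceE; rewrite jtraceZ mulVf ?gt_eqF //; split=> //;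
     apply: coneZ; rewrite ?invr_ge0 ?ltW.
have a0 := cone_jtrace_ge0 ca; have b0 := cone_jtrace_ge0 cb.
have [a1|an] := eqVneq (jtrace a) 0.
  rewrite (cone_jtrace_eq0 ca a1) sub0r; apply: sub_conv; right => /=.
  rewrite jmulNr fb; split=> //; exists b => //; apply/state_spaceE.
  by rewrite -tab a1 add0r.
have [b1|bn] := eqVneq (jtrace b) 0.
  rewrite (cone_jtrace_eq0 cb b1) subr0; apply: sub_conv; left => /=.
  by split=> //; apply/state_spaceE; rewrite -tab b1 addr0.
have ap : 0 < jtrace a by rewrite lt_neqAle eq_sym an.
have bp : 0 < jtrace b by rewrite lt_neqAle eq_sym bn.
have -> : a - b = jtrace a *: ((jtrace a)^-1 *: a) +
    (1 - jtrace a) *: (- ((jtrace b)^-1 *: b)).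
  have -> : 1 - jtrace a = jtrace b by rewrite -tab addrAC subrr add0r.
  by rewrite scalerN !scalerA !divff // !scale1r.
have [ea1 sa] := norm _ _ ca ea ap; have [fb1 sb] := norm _ _ cb fb bp.
apply: conv_convex => //.
- by rewrite -tab lerDl.
- by apply: sub_conv; left.
- apply: sub_conv; right => /=; rewrite jmulNr fb1; split=> //.
  by exists ((jtrace b)^-1 *: b).
Qed.

Lemma dual_ballE : dual_ball V = jball junit junit.
Proof.
rewrite -conv_jball /dual_ball; congr (Defs.conv (_ `|` _)); apply/seteqP;
  split=> x //=; rewrite jmul1; by [|case].
Qed.

Lemma jball_sub e f x : jball e f x -> dual_ball V x.
Proof.
by rewrite dual_ballE => -[a [b [ca cb _ _ ab]]]; exists a, b; rewrite !jmul1.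
Qed.

Context {n : nat}.
Implicit Types (k : @hpoint R V n).

Lemma hval_dual_ball k : dual_ball V (hval k).
Proof.
rewrite dual_ballE; exists (hposv k), (hnegv k); rewrite !jmul1 jtrace_hposv hvalE.
split=> //; apply: (jframe_nonneg_cone (hfrP k)); [exact: hpos_ge0|exact: hneg_ge0].
Qed.

Lemma jball_spectral_sum x (p : 'I_n -> V) (l : 'I_n -> R) : jframe junit p ->
  x = \sum_i l i *: p i -> dual_ball V x -> \sum_i `|l i| <= 1.
Proof.
move=> fp xE; rewrite dual_ballE => -[a [b [ca cb _ _ [tab ab]]]].
have [pp _ pe] := fp; rewrite -tab -!tip1 -!pe !tip_suml -big_split /=.
apply: ler_sum => i _; rewrite -(jframe_coef l i fp) -xE ab tipBl.
rewrite (le_trans (ler_normB _ _)) // !ger0_norm ?(tipC (p i)) //;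
  apply: cone_tip_idem => //; exact: jprim_idem.
Qed.

(** Intermediate values between s = 0, where the sum is at most 1 by hypothesis, and s = 1/2, where
    the term at i0 alone is at least 1. *)
Lemma sqrt_sum_ivt (l : 'I_n -> R) (i0 : 'I_n) : \sum_i `|l i| <= 1 ->
  exists2 s, 0 <= s & \sum_i Num.sqrt (l i ^+ 2 + 4 * s ^+ 2) = 1.
Proof.
move=> l1; pose G s := \sum_i Num.sqrt (l i ^+ 2 + 4 * s ^+ 2) : R.
have G0 : G 0 <= 1.
  rewrite /G; apply: le_trans l1; apply: ler_sum => i _.
  by rewrite expr0n /= mulr0 addr0 sqrtr_sqr.
have G1 : 1 <= G (1 / 2).
  rewrite /G (bigD1 i0) //= -[leLHS]addr0 lerD //; last first.
    by apply: sumr_ge0 => i _; exact: sqrtr_ge0.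
  have -> : 4 * (1 / 2) ^+ 2 = 1 :> R by field.
  by rewrite -[leLHS]sqrtr1 ler_wsqrtr // lerDr sqr_ge0.
have cG : continuous G.
  move=> s; apply: cvg_rsum => i.
  apply: (@cvg_comp _ _ _ (fun s : R =>
    l i ^+ 2 + 4 * s ^+ 2) (@Num.sqrt R) (nbhs s) (nbhs (l i ^+ 2 + 4 * s ^+ 2)));
    last exact: sqrt_continuous.
  apply: cvgD; first exact: cvg_cst.
  by apply: cvgM; [exact: cvg_cst|apply: cvgM; exact: cvg_id].
have [|||s] := @IVT R G 0 (1 / 2) 1.
- by rewrite divr_ge0.
- exact: continuous_subspaceT.
- by rewrite ge_min G0 /= le_max G1 orbT.
by rewrite in_itv /= => /andP[s0 _] Gs; exists s.
Qed.

Lemma hval_surj (p0 : 'I_n -> V) x : jframe junit p0 -> dual_ball V x ->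
  exists k, hval k = x.
Proof.
move=> fp0 bx; have [r [p [l [fp xE]]]] := jspectralT x.
have rn := jframe_rank fp fp0; subst r.
have [i0 _] := jframe_ord0 fp.
have [s s0 sE] := sqrt_sum_ivt i0 (jball_spectral_sum fp xE bx).
(* (q + l) / 2 and (q - l) / 2 are the two nonnegative numbers with difference l and product s^2. *)
pose q i := Num.sqrt (l i ^+ 2 + 4 * s ^+ 2).
have lq i : `|l i| <= q i.
  by rewrite -sqrtr_sqr ler_wsqrtr // lerDl mulr_ge0 // sqr_ge0.
have qq i : q i ^+ 2 = l i ^+ 2 + 4 * s ^+ 2.
  by rewrite sqr_sqrtr // addr_ge0 ?sqr_ge0 // mulr_ge0 // sqr_ge0.
have P1 i : 0 <= (q i + l i) / 2.
  by apply: divr_ge0 => //; have := lq i; rewrite ler_norml => /andP[]; lra.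
have P2 i : 0 <= (q i - l i) / 2.
  by apply: divr_ge0 => //; have := lq i; rewrite ler_norml => /andP[]; lra.
have P3 : \sum_i ((q i + l i) / 2 + (q i - l i) / 2) = 1.
  by rewrite -[RHS]sE; apply: eq_bigr => i _; rewrite -/(q i); field.
have P4 i : (q i + l i) / 2 * ((q i - l i) / 2) = s ^+ 2.
  rewrite (_ : _ * _ = (q i ^+ 2 - l i ^+ 2) / 4); last by field.
  by rewrite qq; field.
exists (HPoint fp P1 P2 s0 P3 P4); rewrite xE; apply: eq_bigr => i _ /=.
by congr (_ *: _); field.
Qed.

End DualBall.

(** * The homeomorphism *)

Section Homeo.
Context {R : realType} {V : euclideanJordanType R} {n : nat} (p0 : 'I_n -> V)
  (fp0 : jframe junit p0).
Implicit Types (x y z w : V) (k l : @hpoint R V n) (h : {ptws V -> R}).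

Lemma hfun_internal y : exists2 k : @hpoint R V n, 0 < hsc k & hfun k = internal_metric y.
Proof.
have [r [p [l [fp ->]]]] := jspectralT y; have rn := jframe_rank fp fp0; subst r.
by exists (hinterior fp l); [exact: hinterior_sc|exact: hinterior_fun].
Qed.

Lemma ptws_unique (T : Type) (F : set_system T) (f : T -> {ptws V -> R}) h h' :
  ProperFilter F -> f t @[t --> F] --> h -> f t @[t --> F] --> h' -> h = h'.
Proof.
move=> PF /cvg_ptwsE H /cvg_ptwsE H'; apply: funext => z.
exact: (cvg_unique (@Rhausdorff R) (H z) (H' z)).
Qed.

(** The coefficients of a path in V whose internal metrics tend to the horofunction with data I, J,
    alpha. *)
Definition ray (I J : {set 'I_n}) (alpha : 'I_n -> R) (t : nat) (i : 'I_n) : R :=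
  if i \in I then t%:R - alpha i else if i \in J then - (t%:R - alpha i) else 0.

Section Ray.
Context {p : 'I_n -> V} {I J : {set 'I_n}} {alpha : 'I_n -> R}
  (H : horo_data p I J alpha).

Let fp : jframe junit p.
Proof. by case: H => /(jordan_frameE _ (jmul1 _)). Qed.

Lemma ray_cvg : hcvg \oo (fun t => hinterior fp (ray I J alpha t)) (hboundary H).
Proof.
(* Numerators and denominator are multiplied by e^-t, after which each term converges separately: to
   e^-alpha on the matching index set and to 0 elsewhere. *)
pose P t i : R := expR (ray I J alpha t i - t%:R);
  pose N t i : R := expR (- ray I J alpha t i - t%:R).
have e0 : (expR (- t%:R) : R) @[t --> \oo] --> (0 : R) by exact: cvgn_expR.
have [_ dIJ _ _ _] := H.
have far (c : R) : expR (- (t%:R - c) - t%:R) @[t --> \oo] --> (0 : R).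
  have -> : (fun t : nat => expR (- (t%:R - c) - t%:R)) = (fun t =>
    expR c * expR (- t%:R) * expR (- t%:R)).
    by apply: funext => t; rewrite -!expRD; congr expR; ring.
  by rewrite -(mulr0 (expR c * 0)); apply: cvgM => //; apply: cvgM => //; exact: cvg_cst.
have nearby (c : R) : expR (t%:R - c - t%:R) @[t --> \oo] --> expR (- c).
  have -> : (fun t : nat => expR (t%:R - c - t%:R)) = (fun=> expR (- c)).
    by apply: funext => t; congr expR; ring.
  exact: cvg_cst.
have Pl i : P t i @[t --> \oo] --> horo_pos I alpha i.
  rewrite /P /ray /horo_pos; have [iI|iI] := boolP (i \in I); first exact: nearby.
  have [iJ|iJ] := boolP (i \in J); first exact: far.
  by under eq_fun do rewrite sub0r.
have Nl i : N t i @[t --> \oo] --> horo_pos J alpha i.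
  rewrite /N /ray /horo_pos; have [iI|iI] := boolP (i \in I).
    by rewrite (disjointFr dIJ iI); exact: far.
  have [iJ|iJ] := boolP (i \in J); first by under eq_fun do rewrite opprK; exact: nearby.
  by under eq_fun do rewrite oppr0 sub0r.
pose S := \sum_i (horo_pos I alpha i + horo_pos J alpha i).
have Dl : \sum_i (P t i + N t i) @[t --> \oo] --> S.
  by apply: cvg_rsum => i; apply: cvgD; [exact: Pl|exact: Nl].
have S0 : S != 0.
  apply/eqP => S0; have := hsum1 (hboundary H); rewrite /= -/S S0 invr0.
  by rewrite big1 => [/esym/eqP|i _]; rewrite ?oner_eq0 // !mul0r addr0.
have scale t (f : R) : f / \sum_i (expR (ray I J alpha t i) + expR (- ray I J alpha t i)) =
    (\sum_i (P t i + N t i))^-1 * (f * expR (- t%:R)).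
  have -> : \sum_i (P t i + N t i) = expR (- t%:R) * \sum_i (expR (ray I J alpha t i) +
    expR (- ray I J alpha t i)).
    by rewrite mulr_sumr; apply: eq_bigr => i _; rewrite mulrDr -!expRD !(addrC (- t%:R)).
  by rewrite invfM (mulrC f (expR _)) mulrACA mulVf ?mul1r 1?mulrC // gt_eqF ?expR_gt0.
split=> i /=; first exact: jcvg_cst.
- under eq_fun do rewrite scale -expRD.
  by apply: cvgM; [exact: cvgV|exact: Pl].
- under eq_fun do rewrite scale -expRD.
  by apply: cvgM; [exact: cvgV|exact: Nl].
Qed.

Lemma ray_fun_cvg :
  internal_metric (\sum_i ray I J alpha t i *: p i) @[t --> \oo] --> horo_fun p I J alpha.
Proof.
rewrite -(hboundary_fun H).
have -> : (fun t => internal_metric (\sum_i ray I J alpha t i *: p i)) = fun t =>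
  hfun (hinterior fp (ray I J alpha t)).
  by apply: funext => t; rewrite hinterior_fun.
exact: hcvg_fun ray_cvg.
Qed.

End Ray.

Lemma hfun_data k : hsc k = 0 -> exists (I J : {set 'I_n}) alpha, exists H : horo_data
  (hfr k) I J alpha,
  [/\ hval k = hval (hboundary H), hfun k = horo_fun (hfr k) I J alpha,
   I = [set i | hpos k i != 0]%SET & J = [set i | hneg k i != 0]%SET].
Proof.
move=> k0; have [I [J [alpha [H E IE JE]]]] := hval_boundary k0.
exists I, J, alpha, H; split=> //; first by rewrite hboundary_val.
by rewrite -(hboundary_fun H); apply: hval_fun; rewrite hboundary_val.
Qed.

Lemma hfun_compactification k : horo_compactification V (hfun k).
Proof.
have [k0|kn0] := eqVneq (hsc k) 0; last first.
  apply: subset_closure; exists (hpt k) => //; rewrite hfun_interior //.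
  by rewrite lt_neqAle eq_sym kn0 hsc_ge0.
have [I [J [alpha [H [_ -> _ _]]]]] := hfun_data k0.
move=> W Wh; have NW := ray_fun_cvg H Wh.
have [t Wt] := @filter_ex _ \oo _ _ NW;
  exists (internal_metric (\sum_i ray I J alpha t i *: hfr k i)).
by split=> //; exists (\sum_i ray I J alpha t i *: hfr k i).
Qed.

(** An ultrafilter of internal metrics tending to h is lifted to data; a limit datum of the lift
    represents h. *)
Lemma compactification_hfun h : horo_compactification V h ->
  exists k : @hpoint R V n, hfun k = h.
Proof.
move=> ch; pose k0 := hinterior fp0 (fun=> 0).
have Hs g : exists k : @hpoint R V n, range internal_metric g -> hfun k = g.
  have [[y _ <-]|ng] := pselect (range (@internal_metric R V) g); last by exists k0.
  by have [k _ <-] := hfun_internal y; exists k.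
have [s sP] := choice Hs.
have [U [UU UA Uh]] := closure_ultra ch.
have [l kl] := @hcompact R V _ n U s UU.
exists l; have H1 : (fun g => g) t @[t --> U] --> hfun l.
  by apply: (eq_near_cvg _ _ (hcvg_fun _ kl)); apply: filterS UA => g gr; exact: sP.
exact: (ptws_unique _ H1 Uh).
Qed.

Lemma phi_graphE h w : phi_graph h w <-> exists k : @hpoint R V n, h = hfun k /\ w = hval k.
Proof.
split=> [[[x [r [p [lam [[fp xE] -> ->]]]]]|[r [p [I [J [alpha [H -> ->]]]]]]]|].
- move/(jordan_frameE _ (jmul1 _)): fp => fp; have rn := jframe_rank fp fp0; subst r.
  by exists (hinterior fp lam); rewrite hinterior_fun hinterior_val xE.
- have fp : jframe junit p by case: H => /(jordan_frameE _ (jmul1 _)).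
  have rn := jframe_rank fp fp0; subst r.
  by exists (hboundary H); rewrite hboundary_fun hboundary_val.
move=> [k [-> ->]]; have [k0|kn0] := eqVneq (hsc k) 0.
  have [I [J [alpha [H [vE fE _ _]]]]] := hfun_data k0.
  by right; exists n, (hfr k), I, J, alpha; split=> //; rewrite vE hboundary_val.
have kp : 0 < hsc k by rewrite lt_neqAle eq_sym kn0 hsc_ge0.
left; exists (hpt k), n, (hfr k), (fun i => ln (hpos k i / hsc k)).
split; [|exact: hfun_interior|exact: hval_interior].
by split=> //; apply/jordan_frameE; [exact: jmul1|exact: hfrP].
Qed.

Lemma phi_hfun k : phi (hfun k) = hval k.
Proof.
apply: xget_unique; first by apply/phi_graphE; exists k.
by move=> w /phi_graphE[l [/hfun_val E ->]].
Qed.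

(** The sections s and v are arbitrary. Continuity in either direction follows by lifting an
    ultrafilter through one of them: the limit datum l has the prescribed image in the source space,
    and [hfun_val] or [hval_fun] then fixes its image in the target. *)
Lemma phi_homeomorphism : homeomorphism_on (horo_compactification V)
  (dual_ball V : set (fdtop V)) phi.
Proof.
pose k0 := hinterior fp0 (fun=> 0).
have [s sP] : exists s : {ptws V -> R} ->
  @hpoint R V n, forall h, horo_compactification V h -> hfun (s h) = h.
  have Hs h : exists k : @hpoint R V n, horo_compactification V h -> hfun k = h.
    have [/compactification_hfun[k <-]|nh] := pselect (horo_compactification V h);
      first by exists k.
    by exists k0.
  by have [s sP] := choice Hs; exists s.
have [v vP] : exists v : V -> @hpoint R V n, forall x, dual_ball V x -> hval (v x) = x.
  have Hv x : exists k : @hpoint R V n, dual_ball V x -> hval k = x.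
    have [/(hval_surj fp0)[k <-]|nx] := pselect (dual_ball V x); first by exists k.
    by exists k0.
  by have [v vP] := choice Hv; exists v.
have phiE h : horo_compactification V h -> phi h = hval (s h).
  by move=> hh; rewrite -{1}(sP h hh) phi_hfun.
split.
- split.
  + by move=> h hh; rewrite phiE //; exact: hval_dual_ball.
  + move=> h h' /set_mem hh /set_mem hh'; rewrite !phiE // => /hval_fun.
    by rewrite !sP.
  + move=> x bx; exists (hfun (v x)); first exact: hfun_compactification.
    by rewrite phi_hfun vP.
- apply/subspace_continuousP => h0 hh0; apply: cvg_ultra => U UU FU.
  have [UA Uh] := within_nbhs_ultra FU.
  have [l kl] := @hcompact R V _ n U s UU.
  have lh : hfun l = h0.
    have H1 : (fun g => g) t @[t --> U] --> hfun l.
      by apply: (eq_near_cvg _ _ (hcvg_fun _ kl)); apply: filterS UA => g gr; exact: sP.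
    exact: (ptws_unique _ H1 Uh).
  have E : phi h0 = hval l by rewrite -lh phi_hfun.
  rewrite /from_subspace E.
  have E1 : jcvg U (fun t => hval (s t)) (hval l) by exact: hcvg_val kl.
  apply: (eq_near_cvg _ _ ((jcvgE _ _).2 E1)).
  by apply: filterS UA => g gr; exact: esym (phiE g gr).
exists (fun x => hfun (v x)).
  by move=> h hh; rewrite phiE // -[RHS](sP h hh); apply: hval_fun; rewrite vP //;
    exact: hval_dual_ball.
apply/subspace_continuousP => x0 bx0; apply: cvg_ultra => U UU FU.
have [UA Ux] := within_nbhs_ultra FU.
have [l kl] := @hcompact R V _ n U v UU.
have lx : hval l = x0.
  have E1 : jcvg U (fun t => hval (v t)) (hval l) by exact: hcvg_val kl.
  have E2 : jcvg U (fun t => hval (v t)) x0.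
    apply/jcvgE; apply: (@eq_near_cvg _ (fdtop V) U id _ _ _ _ Ux).
    by apply: filterS UA => g gr; rewrite vP.
  exact: (jcvg_unique _ E1 E2).
rewrite /from_subspace (_ : hfun (v x0) = hfun l); first exact: hcvg_fun kl.
by apply: hval_fun; rewrite vP.
Qed.

End Homeo.

(** * Faces of the dual ball *)

Section TopologicalFacts.
Context {R : realType} {V : euclideanJordanType R}.
Implicit Types (x y z w : V).

Lemma nbhs_segment x y (W : set V) : nbhs (x : fdtop V) W ->
  exists2 s : R, 0 < s & W (x + s *: y).
Proof.
move=> Wx; have H : jcvg \oo (fun m : nat => x + harmonic m *: y) x.
  rewrite -[x in jcvg _ _ x]addr0 -(scale0r y).
  by apply: jcvgD; [exact: jcvg_cst|apply: jcvgZ; [exact: cvg_harmonic|exact: jcvg_cst]].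
have /jcvgE H' := H; have NW := H' W Wx.
have [m Wm] := @filter_ex _ \oo _ _ NW.
by exists (harmonic m) => //; exact: harmonic_gt0.
Qed.

(** The norm is attained at states c t; along an ultrafilter these converge to a state, and the
    pairing is jointly continuous. *)
Lemma jcvg_unorm (T : Type) (F : set_system T) (f : T -> V) (l : V) : Filter F ->
  jcvg F f l -> unorm (f t - l) @[t --> F] --> (0 : R).
Proof.
move=> FF fl; apply: cvg_ultra => U UU FU.
have Hc t : exists c, state_space c /\ `|⟪f t - l, c⟫| = unorm (f t - l).
  by have [[c pc cE] _] := unormP (f t - l); exists c; split=> //; exact: jprim_state.
have [c cP] := choice Hc.
have [|d _ cd] := ultra_jcvg_state (f := c) UU; first by apply: nearW => t; case: (cP t).
have -> : (fun t => unorm (f t - l)) = fun t => `|⟪f t - l, c t⟫|.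
  by apply: funext => t; case: (cP t).
rewrite -(normr0 R) -(tip0l d) -(subrr l); apply: cvg_norm; apply: cvg_tip => //.
apply: jcvgD; last exact: jcvg_cst.
by move=> y W Wy; apply: FU; exact: fl.
Qed.

Lemma nbhs_unorm x (c : R) : 0 < c -> nbhs (x : fdtop V) [set y | unorm (y - x) < c].
Proof.
move=> c0; have /jcvgE H : (fun y : V =>
  y : fdtop V) y @[y --> nbhs (x : fdtop V)] --> (x : fdtop V).
  exact: cvg_id.
exact: (cvgr_lt _ (jcvg_unorm _ H) _ c0).
Qed.

Lemma unorm_diag_le n (p : 'I_n -> V) (k : 'I_n -> R) M : jframe junit p ->
  (forall i, `|k i| <= M) -> unorm (\sum_i k i *: p i) <= M.
Proof.
move=> fp kM; have [[c pc <-] _] := unormP (\sum_i k i *: p i).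
have sc := jprim_state pc; rewrite tip_suml (le_trans (ler_norm_sum _ _ _)) //.
rewrite -[M]mulr1 -(state_tip_sum fp sc) mulr_sumr; apply: ler_sum => i _.
by rewrite tipZl normrM tipC (ger0_norm (state_tip_ge0 fp i sc)) ler_wpM2r //
  (state_tip_ge0 fp).
Qed.

Lemma fin_pos_lower n (f : 'I_n -> R) :
  exists2 c : R, 0 < c & forall i, 0 < f i -> c <= f i.
Proof.
case: n f => [|n] f; first by exists 1 => // -[].
have [m mf] := fin_argmax (fun i => if 0 < f i then (f i)^-1 else 0) ord0.
set M := (if _ then _ else _) in mf.
have M0 : 0 <= M by rewrite /M; case: ifP => // fm; rewrite invr_ge0 ltW.
have M1 : 0 < M + 1 by rewrite ltr_wpDl.
exists (M + 1)^-1; first by rewrite invr_gt0.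
move=> i fi; have := mf i; rewrite fi => fM.
by rewrite -[f i]invrK lef_pV2 ?posrE ?invr_gt0 // (le_trans fM) // lerDl.
Qed.

End TopologicalFacts.

Section Faces.
Context {R : realType} {V : euclideanJordanType R} {e f : V}
  (ee : e • e = e) (ff : f • f = f) (ef : e • f = 0).
Implicit Types (x y z w a b : V).

Let fe : f • e = 0. Proof. by rewrite jmulC. Qed.

Let idemC c : c • c = c -> (junit - c) • (junit - c) = (junit - c : V).
Proof. by move=> cc; case: (idemB (jmul1 junit) cc (jmul1 c)). Qed.

Let tipe a g : e • a = a -> ⟪a, e • g⟫ = ⟪a, g⟫.
Proof. by move=> ea; rewrite -tip_selfadj ea. Qed.

Let tipf a g : f • a = a -> ⟪a, f • g⟫ = ⟪a, g⟫.
Proof. by move=> fa; rewrite -tip_selfadj fa. Qed.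

(** For a and b in the cone all four terms are nonnegative, and they vanish together exactly when a
    lives in V(e) and b in V(f), which are orthogonal. This is why e - f exposes the face. *)
Let gap a b : jtrace a + jtrace b = 1 ->
  1 - ⟪a - b, e - f⟫ = ⟪a, junit - e⟫ + ⟪a, f⟫ + ⟪b, junit - f⟫ + ⟪b, e⟫.
Proof.
move=> <-; rewrite tipBl !tipBr -!tip1 !(tipC junit); ring.
Qed.

Lemma jball_face_le x : dual_ball V x -> ⟪x, e - f⟫ <= 1.
Proof.
rewrite dual_ballE => -[a [b [ca cb _ _ [tab ->]]]].
by rewrite -subr_ge0 gap // !addr_ge0 ?cone_tip_idem // idemC.
Qed.

Lemma jball_face_rep a b : cone a -> cone b -> jtrace a + jtrace b = 1 ->
  ⟪a - b, e - f⟫ = 1 -> e • a = a /\ f • b = b.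
Proof.
move=> ca cb tab E; have := gap tab; rewrite E subrr => G.
have h1 := cone_tip_idem ca (idemC ee); have h2 := cone_tip_idem ca ff.
have h3 := cone_tip_idem cb (idemC ff); have h4 := cone_tip_idem cb ee.
have supp (g c : V) : g • g = g -> cone c -> ⟪c, junit - g⟫ = 0 -> g • c = c.
  move=> gg cc c0; have := cone_orth cc (idemC gg) c0.
  by rewrite jmulBl jmul1 => /eqP; rewrite subr_eq0 => /eqP.
by split; apply: supp => //; lra.
Qed.

Lemma jball_faceE x : jball e f x <-> dual_ball V x /\ ⟪x, e - f⟫ = 1.
Proof.
split=> [jx|[]].
  split; first exact: jball_sub jx.
  case: jx => a [b [ca cb ea fb [tab ->]]].
  apply/eqP; rewrite eq_sym -subr_eq0 gap // !tipBr.
  have af : ⟪a, f⟫ = 0 by rewrite -(tipe _ ea) ef tipC tip0l.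
  have be : ⟪b, e⟫ = 0 by rewrite -(tipf _ fb) fe tipC tip0l.
  rewrite -(tipe junit ea) -(tipf junit fb) !jmulr1 af be.
  by rewrite !subrr !addr0.
rewrite dual_ballE => -[a [b [ca cb _ _ [tab ->]]]] E.
by have [ea fb] := jball_face_rep ca cb tab E; exists a, b.
Qed.

Context {n : nat} (p0 : 'I_n -> V) (fp0 : jframe junit p0).
Implicit Types (k : @hpoint R V n).

Lemma jball_closed : closed (jball e f : set (fdtop V)).
Proof.
move=> x /closure_ultra[U [UU UA Ux]]; apply/jball_faceE.
have Hv y : exists k, dual_ball V y -> hval k = y.
  have [/(hval_surj fp0)[k <-]|ny] := pselect (dual_ball V y); first by exists k.
  by exists (hinterior fp0 (fun=> 0)).
have [v vP] := choice Hv.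
have /jcvgE Ux' : (fun y : V => y : fdtop V) y @[y --> U] --> (x : fdtop V) by exact: Ux.
have [l kl] := @hcompact R V _ n U v UU.
have E1 : jcvg U (fun t => hval (v t)) (hval l) by exact: hcvg_val kl.
have E2 : jcvg U (fun t => hval (v t)) x.
  apply/jcvgE; apply: (@eq_near_cvg _ (fdtop V) U id _ _ _ _ Ux).
  by apply: filterS UA => g /jball_sub bg; rewrite vP.
have lx : hval l = x := jcvg_unique _ E1 E2.
split; first by rewrite -lx; exact: hval_dual_ball.
apply: (cvg_unique (@Rhausdorff R) (Ux' (e - f))).
apply: cvg_near_cst; apply: filterS UA => g /jball_faceE[_]; exact.
Qed.

Lemma jball_is_face : is_face (jball e f) (dual_ball V).
Proof.
split; first exact: jball_sub.
  apply/convex_setE => x y t t0 t1; rewrite -conv_jball; exact: conv_convex.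
move=> x y t bx by_ t0 t1 /jball_faceE[_ E].
have hx := jball_face_le bx; have hy := jball_face_le by_.
move: E; rewrite tipDl !tipZl => E.
by split; apply/jball_faceE; split=> //; apply/le_anti; rewrite ?hx ?hy /=; nra.
Qed.

(** Moving from x to x + s x pushes the exposing functional above 1, so no neighbourhood of x stays
    in the ball. *)
Lemma jball_boundary : jball e f `<=` topological_boundary (dual_ball V).
Proof.
move=> x jx; have [bx E] := (jball_faceE x).1 jx; split; first exact: subset_closure.
move=> /(@nbhs_segment _ _ x x)[s s0 /jball_face_le].
by rewrite tipDl tipZl E mulr1 gerDl leNgt s0.
Qed.

(** In the affine hull positivity is lost, while supports and trace normalization survive;
    [supp_relint] has only positivity to restore. *)
Lemma jball_aff x : aff (jball e f) x -> exists a b,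
  [/\ e • a = a, f • b = b, jtrace a + jtrace b = 1 & x = a - b].
Proof.
move: x; apply: smallest_sub; last first.
  by move=> x [a [b [_ _ ea fb [tab ->]]]]; exists a, b.
move=> _ _ t [a [b [ea fb tab ->]]] [c [d [ec fd tcd ->]]].
exists (t *: a + (1 - t) *: c), (t *: b + (1 - t) *: d); split.
- by rewrite jmulDr !jmulZr ea ec.
- by rewrite jmulDr !jmulZr fb fd.
- rewrite !jtraceD !jtraceZ addrACA -!mulrDr tab tcd; ring.
- by rewrite !scalerBr opprD addrACA.
Qed.

Lemma aff_line x y (s : R) : jball e f x -> jball e f y ->
  aff (jball e f) (x + s *: (x - y)).
Proof.
move=> jx jy A [aA sA]; rewrite (_ : _ + _ = (1 + s) *: x + (1 - (1 + s)) *: y).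
  by apply: aA; exact: sA.
by rewrite opprD addrA subrr add0r scalerDl scale1r scaleNr scalerBr addrA.
Qed.

Definition hpos_supp k : V := psum (hfr k) [set i | hpos k i != 0]%SET.
Definition hneg_supp k : V := psum (hfr k) [set i | hneg k i != 0]%SET.

Lemma hpos_supp_idem k : hpos_supp k • hpos_supp k = hpos_supp k.
Proof. exact: psum_idem (hfrP k) _. Qed.

Lemma hpos_supp_mul k : hpos_supp k • hposv k = hposv k.
Proof.
rewrite psum_mul ?hfrP //; last exact: hfrP.
rewrite big_mkcond; apply: eq_bigr => i _ /=; rewrite inE.
by case: eqP => //= ->; rewrite scale0r.
Qed.

Lemma hposv_cone k : cone (hposv k).
Proof. by apply: (jframe_nonneg_cone (hfrP k)); exact: hpos_ge0. Qed.

Lemma hpos_supp_le k g : g • g = g -> g • hposv k = hposv k ->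
  g • hpos_supp k = hpos_supp k.
Proof.
move=> gg ga; have gC := idemC gg.
have a0 : ⟪hposv k, junit - g⟫ = 0.
  by rewrite -ga tip_selfadj jmulBr jmulr1 gg subrr tipC tip0l.
have [pp _ _] := hfrP k; have ci i := cone_idem (jprim_idem (pp i)).
move: a0; rewrite /hposv tip_suml => /psumr_eq0P H.
rewrite jmul_sumr; apply: eq_bigr => i; rewrite inE => ki.
have : hpos k i * ⟪hfr k i, junit - g⟫ = 0.
  rewrite -tipZl; apply: H => // j _; rewrite tipZl mulr_ge0 ?hpos_ge0 //.
  exact: cone_tip_idem.
move/eqP; rewrite mulf_eq0 (negbTE ki) /= => /eqP /(cone_orth (ci i) gC).
by rewrite jmulBl jmul1 => /eqP; rewrite subr_eq0 => /eqP.
Qed.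

(** The two parts lie in the orthogonal algebras V(e) and V(f), so their product is 0; but that
    product is [hsc]^2 times the unit. *)
Lemma jball_face_hval k : jball e f (hval k) ->
  [/\ e • hposv k = hposv k, f • hnegv k = hnegv k & hsc k = 0].
Proof.
move=> /jball_faceE[_ E]; rewrite hvalE in E.
have cN : cone (hnegv k) := hposv_cone (hswap k).
have [ea fb] := jball_face_rep (hposv_cone k) cN (jtrace_hposv k) E.
split=> //; have eb : e • hnegv k = 0.
  by rewrite jmulC; apply: (peirce10 ff).
have ab : hposv k • hnegv k = 0 by apply: (peirce10 ee).
move: ab; rewrite (jframe_mul _ _ (hfrP k)).
under eq_bigr do rewrite hposneg; rewrite -scaler_sumr.
have [_ _ ->] := hfrP k => /eqP; rewrite scaler_eq0 (negbTE junit_neq0) orbF.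
by rewrite sqrf_eq0 => /eqP.
Qed.

(** From a relative interior point x one can move a little away from y within the face; a positive
    value at y would become negative there. *)
Lemma relint_flat x y v : relint (jball e f) x -> jball e f y ->
  (forall z, jball e f z -> 0 <= ⟪z, v⟫) -> ⟪x, v⟫ = 0 -> ⟪y, v⟫ = 0.
Proof.
move=> [jx [W Wx WF]] jy v0 xv; apply/le_anti; rewrite v0 // andbT.
have [s s0 Ws] := nbhs_segment (x - y) Wx.
have := v0 _ (WF _ (conj Ws (aff_line s jx jy))).
by rewrite tipDl tipZl tipBl xv sub0r add0r mulrN oppr_ge0 pmulr_rle0.
Qed.

Lemma jtrace_idem_gt0 (g : V) : g • g = g -> g != 0 -> 0 < jtrace g.
Proof.
move=> gg g0; rewrite lt_neqAle cone_jtrace_ge0 ?andbT; last exact: cone_idem.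
by apply: contraNneq g0 => /esym/(cone_jtrace_eq0 (cone_idem gg)) ->.
Qed.

(** The defect g = e - [hpos_supp k] pairs nonnegatively with the face and to 0 with [hval k]. If g
    were nonzero, g / tr g would lie in the face and, by [relint_flat], ⟪g, g⟫ would be 0. *)
Lemma relint_pos_supp k : relint (jball e f) (hval k) -> hpos_supp k = e.
Proof.
move=> rk; have [ea fb k0] := jball_face_hval rk.1.
have eE := hpos_supp_le ee ea; have EE := hpos_supp_idem k.
have [gg Eg] := idemB ee EE eE; set g := e - hpos_supp k in gg Eg.
apply/eqP; rewrite eq_sym -subr_eq0 -/g; apply: contraT => g0; exfalso.
have eg : e • g = g by rewrite /g jmulBr ee eE.
have fg : f • g = 0 by rewrite jmulC; apply: (peirce10 ee).
have bg b : f • b = b -> ⟪b, g⟫ = 0 by move=> fb'; rewrite -(tipf _ fb') fg tipC tip0l.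
have tg := jtrace_idem_gt0 gg g0.
have jm : jball e f ((jtrace g)^-1 *: g).
  exists ((jtrace g)^-1 *: g), 0; split; [|exact: cone0| |exact: jmulr0|].
  - by apply: coneZ; [rewrite invr_ge0 ltW|exact: cone_idem].
  - by rewrite jmulZr eg.
  - by rewrite jtrace0 addr0 subr0 jtraceZ mulVf // gt_eqF.
have := @relint_flat _ _ g rk jm; rewrite tipZl => H.
have /eqP : (jtrace g)^-1 * ⟪g, g⟫ = 0.
  apply: H => [z [a [b [ca _ _ fb' [_ ->]]]]|].
    by rewrite tipBl (bg _ fb') subr0 cone_tip_idem.
  by rewrite hvalE tipBl (bg _ fb) subr0 -hpos_supp_mul tip_selfadj Eg tipC tip0l.
by rewrite mulf_eq0 invr_eq0 !gt_eqF // tip_gt0.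
Qed.

Lemma relint_neg_supp k : relint (jball e f) (hval k) -> hneg_supp k = f.
Proof.
move=> rk; have [ea fb k0] := jball_face_hval rk.1.
have fF := @hpos_supp_le (hswap k) f ff fb; have FF := hpos_supp_idem (hswap k).
have [gg Fg] := idemB ff FF fF; set g := f - hpos_supp (hswap k) in gg Fg.
apply/eqP; rewrite eq_sym -subr_eq0 -[_ - _]/g; apply: contraT => g0; exfalso.
have fg : f • g = g by rewrite /g jmulBr ff fF.
have eg : e • g = 0 by rewrite jmulC; apply: (peirce10 ff).
have ag a : e • a = a -> ⟪a, g⟫ = 0 by move=> ea'; rewrite -(tipe _ ea') eg tipC tip0l.
have tg := jtrace_idem_gt0 gg g0.
have jm : jball e f (- ((jtrace g)^-1 *: g)).
  exists 0, ((jtrace g)^-1 *: g); split; [exact: cone0| |exact: jmulr0| |].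
  - by apply: coneZ; [rewrite invr_ge0 ltW|exact: cone_idem].
  - by rewrite jmulZr fg.
  - by rewrite jtrace0 add0r sub0r jtraceZ mulVf // gt_eqF.
have E0 : ⟪- ((jtrace g)^-1 *: g), - g⟫ = (jtrace g)^-1 * ⟪g, g⟫.
  by rewrite tipNr tipNl opprK tipZl.
have := @relint_flat _ _ (- g) rk jm; rewrite E0 => H.
have /eqP : (jtrace g)^-1 * ⟪g, g⟫ = 0.
  apply: H => [z [a [b [_ cb ea' _ [_ ->]]]]|].
    by rewrite tipNr tipBl (ag _ ea') sub0r opprK cone_tip_idem.
  have E : hpos_supp (hswap k) • hnegv k = hnegv k := hpos_supp_mul (hswap k).
  by rewrite tipNr hvalE tipBl (ag _ ea) sub0r opprK -E tip_selfadj Fg tipC tip0l.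
by rewrite mulf_eq0 invr_eq0 !gt_eqF // tip_gt0.
Qed.

Lemma cone_lower_pos k (c : R) : (forall i, 0 < hpos k i -> c <= hpos k i) ->
  cone (hposv k - c *: hpos_supp k).
Proof.
move=> cP; rewrite (_ : _ - _ = \sum_i (hpos k i - if hpos k i != 0 then c else 0) *: hfr
  k i).
  apply: (jframe_nonneg_cone (hfrP k)) => i; rewrite subr_ge0.
  case: ifPn => ki; last exact: hpos_ge0.
  by apply: cP; rewrite lt_neqAle eq_sym ki hpos_ge0.
rewrite /hpos_supp /psum scaler_sumr [X in _ - X]big_mkcond -sumrB.
by apply: eq_bigr => i _ /=; rewrite inE scalerBl; case: ifP => // _; rewrite scale0r.
Qed.

(** Take c below all positive coefficients, so that [hposv k] >= c e and [hnegv k] >= c f. If y is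
    within c of [hval k], compression by [quad e] gives a - [hposv k] >= -c e, hence a >= 0;
    compression by [quad f] handles b. *)
Lemma supp_relint k : hpos_supp k = e -> hneg_supp k = f -> relint (jball e f) (hval k).
Proof.
move=> Ee Ff.
have ea : e • hposv k = hposv k by rewrite -Ee hpos_supp_mul.
have fb : f • hnegv k = hnegv k by rewrite -Ff; exact: hpos_supp_mul (hswap k).
have ca := hposv_cone k; have cb : cone (hnegv k) := hposv_cone (hswap k).
have jk : jball e f (hval k).
  by exists (hposv k), (hnegv k); rewrite jtrace_hposv hvalE.
split=> //.
have [c1 c10 c1P] := fin_pos_lower (hpos k); have [c2 c20 c2P] := fin_pos_lower (hneg k).
pose c := Num.min c1 c2.
have c0 : 0 < c by rewrite lt_min c10.
exists [set y | unorm (y - hval k) < c]; first exact: nbhs_unorm.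
move=> y [/= yc /jball_aff[a [b [ea' fb' tab yE]]]].
exists a, b; split=> //.
- have qy : quad e (y - hval k) = a - hposv k.
    have eb : e • b = 0 by rewrite jmulC; apply: (peirce10 ff).
    have eB : e • hnegv k = 0 by rewrite jmulC; apply: (peirce10 ff).
    rewrite yE hvalE quadD !quadN !quadD !quadN (quad_peirce1 ee ea') (quad_peirce1 ee ea).
    by rewrite (quad_peirce0 eb ee) (quad_peirce0 eB ee) subr0 subr0.
  have cq : cone (quad e (y - hval k + c *: junit)).
    apply: cone_quad => //; apply: cone_self_dual => d pd; have sd := jprim_state pd.
    rewrite tipDl tipZl state_tip1 // mulr1.
    have := (unormP (y - hval k)).2 d sd; rewrite ler_norml => /andP[h _].
    by move: h yc; lra.
  rewrite quadD quadZ qy in cq.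
  have qu : quad e junit = e by rewrite /quad ee !jmulr1 ee scaler_nat mulr2n addrK.
  rewrite qu in cq.
  have cl := @cone_lower_pos k c; rewrite Ee in cl.
  have -> : a = (hposv k - c *: e) + (a - hposv k + c *: e).
    by rewrite [RHS]addrC addrACA subrK subrr addr0.
  by apply: coneD => //; apply: cl => i /c1P; apply: le_trans; rewrite ge_min lexx.
- have qy : quad f (y - hval k) = - (b - hnegv k).
    have fa : f • a = 0 by rewrite jmulC; apply: (peirce10 ee).
    have fA : f • hposv k = 0 by rewrite jmulC; apply: (peirce10 ee).
    rewrite yE hvalE quadD !quadN !quadD !quadN (quad_peirce1 ff fb') (quad_peirce1 ff fb).
    by rewrite (quad_peirce0 fa ff) (quad_peirce0 fA ff) !sub0r opprB opprK addrC.
  have cq : cone (quad f (c *: junit - (y - hval k))).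
    apply: cone_quad => //; apply: cone_self_dual => d pd; have sd := jprim_state pd.
    rewrite tipBl tipZl state_tip1 // mulr1.
    have := (unormP (y - hval k)).2 d sd; rewrite ler_norml => /andP[_ h].
    by move: h yc; lra.
  rewrite quadD quadZ quadN qy opprK in cq.
  have qu : quad f junit = f by rewrite /quad ff !jmulr1 ff scaler_nat mulr2n addrK.
  rewrite qu in cq.
  have cl := @cone_lower_pos (hswap k) c; rewrite [hpos_supp _]Ff in cl.
  have -> : b = (hnegv k - c *: f) + (c *: f + (b - hnegv k)).
    by rewrite addrA subrK addrC subrK.
  by apply: coneD => //; apply: cl => i /c2P; apply: le_trans; rewrite ge_min lexx orbT.
Qed.

End Faces.

(** * Parts *)

Section Parts.
Context {R : realType} {V : euclideanJordanType R}.
Implicit Types (x y z w : V) (h : {ptws V -> R}).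

Lemma horo_faceE r (p : 'I_r -> V) (I J : {set 'I_r}) : jframe junit p ->
  horo_face p I J = jball (psum p I) (psum p J).
Proof.
move=> fp; rewrite -conv_jball /horo_face; congr (Defs.conv (_ `|` _));
  apply/seteqP; split=> x /= [px sx]; split=> //; move: px;
  by move/(peirce1E _ (psum_idem fp _)).
Qed.

Lemma psum_orth r (p : 'I_r -> V) (I J : {set 'I_r}) : jframe junit p ->
  [disjoint I & J]%B -> psum p I • psum p J = 0.
Proof.
move=> fp dIJ; rewrite jmul_sumr big1 // => j jJ.
by rewrite (psum_mul1 fp) (disjointFl dIJ jJ).
Qed.

Context {n : nat} (p0 : 'I_n -> V) (fp0 : jframe junit p0).
Implicit Types (k l : @hpoint R V n).

Lemma supported_ext k l w : state_space w -> hval k = hval l ->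
  supported (hfr k) (hpos k) w -> supported (hfr l) (hpos l) w.
Proof.
move=> sw E /(weight_gt0 _ _ 0) H; apply/(weight_gt0 _ _ 0).
by rewrite -(weight_ext _ (hfrP k) (hfrP l) sw (hval_posv E)).
Qed.

Lemma hpos_supp_mul_le k l :
  (forall w, state_space w -> supported (hfr k) (hpos k) w ->
    supported (hfr l) (hpos l) w) ->
  hpos_supp l • hpos_supp k = hpos_supp k.
Proof.
move=> H; rewrite [hpos_supp k]/hpos_supp jmul_sumr; apply: eq_bigr => i.
rewrite inE => ki; have [pp _ _] := hfrP k; have si := jprim_state (pp i).
apply/(supportedE (hfrP l) si)/H => // j kj; rewrite (jframe_tip _ _ (hfrP k)).
by case: eqP => // ij; rewrite ij kj eqxx in ki.
Qed.

Lemma hpos_supp_eq k l :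
  (forall w, state_space w -> supported (hfr k) (hpos k) w <-> supported (hfr l) (hpos l)
    w) ->
  hpos_supp k = hpos_supp l.
Proof.
move=> H; rewrite -(@hpos_supp_mul_le k l) => [|w sw]; last by case: (H w sw).
by rewrite jmulC (@hpos_supp_mul_le l k) // => w sw; case: (H w sw).
Qed.

(* The bound keeps the weight of [w] at the points of the net comparable to [hmax],
   which survives in the limit by [weight_usc]. *)
Lemma supported_of_bound (T : Type) (U : set_system T) (s : T ->
  @hpoint R V n) k l w (B : R) :
  UltraFilter U -> hcvg U s l -> (\forall t \near U, 0 < hsc (s t)) ->
  (\forall t \near U, unorm (hpt (s t)) + ln (hmax k (hpt (s t))) <= B) ->
  state_space w -> supported (hfr k) (hpos k) w -> supported (hfr l) (hpos l) w.
Proof.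
move=> UU sl s0 sB sw wk; pose D := \sum_i ln (hpos k i) * ⟪w, hfr k i⟫.
(* At the points y of the net the weight is hsc e^⟪w, y⟫, while ⟪w, y⟫ >= norm y + D - B and hsc
   e^(norm y) is [hmax] at 0, eventually above half its limit. The argument [- 0] keeps the form
   that [weight_interior] expects. *)
pose c := hmax l 0 / 2 * expR (D - B).
have c0 : 0 < c by rewrite mulr_gt0 ?expR_gt0 // divr_gt0 ?hmax_gt0.
apply/(weight_gt0 _ _ (- 0)); apply: (lt_le_trans c0).
have [fl pl nl] := sl.
apply: (weight_usc (p := fun t => hfr (s t)) (a := fun t => hpos (s t)) (z := - 0)
  (wt := fun=> w) _ _ fl pl) => //.
- by move=> t; exact: hfrP.
- by move=> t i; rewrite hpos_ge0 hpos_le1.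
- exact: jcvg_cst.
have H1 : \forall t \near U, hmax l 0 / 2 < hmax (s t) 0.
  have m0 := hmax_gt0 l 0.
  have ml : hmax (s t) 0 @[t --> U] --> hmax l 0 by exact: hcvg_max.
  by apply: (cvgr_gt _ ml); rewrite ltr_pdivrMr // ltr_pMr // ltr1n.
apply: filterS3 H1 s0 sB => t h1 st hB.
rewrite weight_interior // subr0.
have h2 : unorm (hpt (s t)) + D - B <= ⟪w, hpt (s t)⟫.
  have := weight_pos_le k (hpt (s t)) sw.
  rewrite weight_supported // -/D -[leRHS]lnK ?posrE ?hmax_gt0 // ler_expR tipNr.
  by move: hB; move: (ln _) => u; lra.
apply: (@le_trans _ _ (hmax (s t) 0 * expR (D - B))).
  by rewrite ler_wpM2r ?expR_ge0 // ltW.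
rewrite hmax_interior // sub0r unormN -mulrA -expRD ler_wpM2l ?(ltW st) // ler_expR.
by rewrite addrA.
Qed.

Lemma hcvg_swap (T : Type) (F : set_system T) (s : T -> @hpoint R V n) l :
  hcvg F s l -> hcvg F (fun t => hswap (s t)) (hswap l).
Proof. by case. Qed.

Lemma hmax_lipschitz k y z : hmax k y <= expR (unorm (y - z)) * hmax k z.
Proof.
apply: hmax_le => w sw.
  apply: le_trans (weightN_le _ _ (- y) (- z) sw) _.
  rewrite -opprD unormN ler_wpM2l ?expR_ge0 //; exact: weight_pos_le.
apply: le_trans (weightN_le _ _ y z sw) _.
rewrite ler_wpM2l ?expR_ge0 //; exact: weight_neg_le.
Qed.

Lemma hfun_geN k x : - unorm x <= hfun k x.
Proof.
have := hmax_lipschitz k 0 x; rewrite sub0r unormN => H.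
have : ln (hmax k 0) <= ln (expR (unorm x) * hmax k x).
  by rewrite ler_ln ?posrE ?mulr_gt0 ?expR_gt0 ?hmax_gt0.
rewrite lnM ?posrE ?expR_gt0 ?hmax_gt0 // expRK /hfun.
by move: (ln (hmax k 0)) (ln (hmax k x)) => u v; lra.
Qed.

(** The whole space as neighbourhood already gives a nonnegative infimum. A finite detour distance
    therefore bounds both costs. *)
Lemma detour_cost_ge0 h k : (0 <= detour_cost h (hfun k))%E.
Proof.
apply: (@le_trans _ _ (ereal_inf [set (unorm x + hfun k x)%:E |
    x in [set x | setT (internal_metric x : {ptws V -> R})]])).
  apply: le_ereal_inf_tmp => _ [x _ <-]; rewrite lee_fin.
  by have := hfun_geN k x; lra.
by apply: ereal_sup_ubound; exists setT => //; exact: filterT.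
Qed.

(** Every neighbourhood of h has infimum below C, so it contains an internal metric from the
    sublevel set. *)
Lemma detour_cost_witness h h' : (detour_cost h h' < +oo)%E ->
  exists C : R, closure [set internal_metric x | x in [set x | unorm x + h' x <= C]] h.
Proof.
move=> fin; have [C SC] : exists C : R, (detour_cost h h' < C%:E)%E.
  case: (detour_cost h h') fin => [r||] // _; last by exists 0; exact: ltNye.
  by exists (r + 1); rewrite lte_fin ltrDl.
exists C => W Wh.
have : (ereal_inf [set (unorm x + h' x)%:E | x in [set x | W (internal_metric x)]] <
  C%:E)%E.
  apply: le_lt_trans SC; apply: ereal_sup_ubound; exists W => //.
  by apply: (@filterS _ (nbhs h) _ W _ _ Wh) => t Wt _.
move=> /ereal_inf_lt[_ [x Wx <-]]; rewrite lte_fin => xC.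
by exists (internal_metric x); split=> //; exists x => //=; exact: ltW.
Qed.

(** The sublevel set accumulating at [hfun k] is lifted to data along an ultrafilter, whose limit
    datum represents [hfun k]. The second inclusion is the first one after [hswap]. *)
Lemma detour_supported k k' w : (detour_cost (hfun k) (hfun k') < +oo)%E -> state_space w ->
  (supported (hfr k') (hpos k') w -> supported (hfr k) (hpos k) w) /\
  (supported (hfr k') (hneg k') w -> supported (hfr k) (hneg k) w).
Proof.
move=> /detour_cost_witness[C /closure_ultra[U [UU UA Uh]]] sw.
have Hs (g : {ptws V -> R}) : exists s : @hpoint R V n,
    (exists2 x, unorm x + hfun k' x <= C & internal_metric x = g) ->
    [/\ 0 < hsc s, hfun s = g & unorm (hpt s) + hfun k' (hpt s) <= C].
  have [[x xC <-]|ng] := pselect (exists2 x, unorm x + hfun k' x <= C & internal_metric x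
    = g).
    have [s s0 sE] := hfun_internal fp0 x; exists s => _.
    have xE : hpt s = x by apply: internal_metric_inj; rewrite -sE hfun_interior.
    by rewrite xE.
  by exists (hinterior fp0 (fun=> 0)).
have [s sP] := choice Hs.
have near_s : \forall g \near U, [/\ 0 < hsc (s g), hfun (s g) = g &
    unorm (hpt (s g)) + hfun k' (hpt (s g)) <= C].
  by apply: filterS UA => g [x xC xg]; apply: sP; exists x.
have [l sl] := @hcompact R V _ n U s UU.
have lk : hval l = hval k.
  apply: hfun_val; have H1 : (fun g => g) g @[g --> U] --> hfun l.
    by apply: (eq_near_cvg _ _ (hcvg_fun _ sl)); apply: filterS near_s => g [].
  exact: (ptws_unique _ H1 Uh).
have s0 : \forall g \near U, 0 < hsc (s g) by apply: filterS near_s => g [].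
pose B := C + ln (hmax k' 0).
have sB : \forall g \near U, unorm (hpt (s g)) + ln (hmax k' (hpt (s g))) <= B.
  by apply: filterS near_s => g [_ _]; rewrite /hfun addrA lerBlDr.
split=> wk.
  exact: (supported_ext sw lk (supported_of_bound UU sl s0 sB sw wk)).
have lk' : hval (hswap l) = hval (hswap k).
  rewrite !hvalE; have := hval_posv lk; have := hval_negv lk.
  by rewrite /hposv /hnegv /= => -> ->.
have sB' : \forall g \near U, unorm (hpt (hswap (s g))) + ln (hmax (hswap k') (hpt (hswap
  (s g)))) <= B.
  by apply: filterS2 s0 sB => g g0; rewrite hmax_swap (hpt_swap g0) unormN opprK.
exact: (supported_ext (k := hswap l) (l := hswap k) sw lk'
  (supported_of_bound (k := hswap k') UU (hcvg_swap sl) s0 sB' sw wk)).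
Qed.

Section RayBound.
Context {p : 'I_n -> V} {I J : {set 'I_n}} {alpha : 'I_n -> R}
  (H : horo_data p I J alpha).

Let fp : jframe junit p.
Proof. by case: H => /(jordan_frameE _ (jmul1 _)). Qed.

Let A := \sum_i `|alpha i|.

Let alpha_le i : `|alpha i| <= A.
Proof. by rewrite /A (bigD1 i) //= lerDl sumr_ge0. Qed.

(** Once t exceeds every alpha i, the inequalities alpha i >= 0 on I and J put all coefficients
    between -t and t. *)
Let ray_unorm (t : nat) : A <= t%:R -> unorm (\sum_i ray I J alpha t i *: p i) <= t%:R.
Proof.
move=> At; have [_ _ _ a0 _] := H; apply: unorm_diag_le => // i; rewrite /ray.
have ai := alpha_le i; have ai' := ler_norm (alpha i).
case: ifP => iI.
  have := a0 i; rewrite finset.in_setU iI => /(_ isT) h.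
  by rewrite ler_norml; apply/andP; split; lra.
case: ifP => iJ; last by rewrite normr0.
have := a0 i; rewrite finset.in_setU iJ orbT => /(_ isT) h.
by rewrite ler_norml; apply/andP; split; lra.
Qed.

(** The frame q of the weight need not be p; only the support projections agree. A supported state
    lives in V(p_K), where y has eigenvalues d i at most M, and the powers of c i contribute factors
    at most 1. *)
Let weight_supp_le m (q : 'I_m -> V) (c : 'I_m -> R) (K : {set 'I_n}) (d : 'I_n ->
  R) M y w :
  jframe junit q -> (forall i, 0 <= c i <= 1) ->
  psum q [set i | c i != 0]%SET = psum p K ->
  psum p K • y = \sum_(i in K) d i *: p i -> (forall i, i \in K -> d i <= M) ->
  state_space w -> weight q c y w <= expR M.
Proof.
move=> fq c01 cK Ky dM sw.
have [s|/weight_unsupported ->] := pselect (supported q c w); last exact: expR_ge0.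
have Kw : psum p K • w = w by rewrite -cK; exact/(supportedE fq sw).
rewrite weight_supported // ler_expR.
have h1 : \sum_i ln (c i) * ⟪w, q i⟫ <= 0.
  apply: sumr_le0 => i _; rewrite mulr_le0_ge0 ?(state_tip_ge0 fq i sw) //.
  by apply: ln_le0; case/andP: (c01 i).
have h2 : ⟪w, y⟫ <= M.
  rewrite -Kw tip_selfadj Ky tip_sumr.
  have w1 : \sum_(i in K) ⟪w, p i⟫ = 1.
    by rewrite -tip_sumr -[X in ⟪_, X⟫]/(psum p K) -[psum p K]jmulr1 -tip_selfadj Kw tipC
      state_tip1.
  rewrite -[M]mulr1 -w1 mulr_sumr; apply: ler_sum => i iK.
  by rewrite tipZr ler_wpM2r ?(state_tip_ge0 fp i sw) // dM.
by move: h1 h2; move: (\sum_i _) => u; lra.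
Qed.

Let hmax_ray_le k (t : nat) : hpos_supp k = psum p I -> hneg_supp k = psum p J ->
  hmax k (\sum_i ray I J alpha t i *: p i) <= expR (A - t%:R).
Proof.
have [_ dIJ _ _ _] := H.
have aA i : alpha i <= A := le_trans (ler_norm _) (alpha_le i).
move=> EI EJ; apply: hmax_le => w sw.
  apply: (weight_supp_le (d := fun i => alpha i - t%:R) (hfrP k) _ EI _ _ sw).
  - by move=> i; rewrite hpos_ge0 hpos_le1.
  - rewrite jmulNr psum_mul // -sumrN; apply: eq_bigr => i iI.
    by rewrite /ray iI -scaleNr opprB.
  - by move=> i _; rewrite lerD2r.
apply: (weight_supp_le (d := fun i => alpha i - t%:R) (hfrP k) _ EJ _ _ sw).
- by move=> i; rewrite hneg_ge0 hneg_le1.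
- rewrite psum_mul //; apply: eq_bigr => i iJ.
  by rewrite /ray (disjointFl dIJ iJ) iJ opprB.
- by move=> i _; rewrite lerD2r.
Qed.

(** Along the ray the norm is at most t and ln [hmax] at most A - t, so the sum defining the cost is
    bounded by A - ln (hmax k 0); the ray enters every neighbourhood of its limit. *)
Lemma detour_cost_fin k : hpos_supp k = psum p I -> hneg_supp k = psum p J ->
  (detour_cost (horo_fun p I J alpha) (hfun k) < +oo)%E.
Proof.
move=> EI EJ; apply: (@le_lt_trans _ _ (A - ln (hmax k 0))%:E); last exact: ltry.
apply: ge_ereal_sup => _ [W WW <-].
have NW := ray_fun_cvg H WW.
have NA : \forall t \near \oo, A <= (t%:R : R) by exact: nbhs_infty_ger.
have [t [Wt At]] := @filter_ex _ \oo _ _ (@filterI _ \oo _ _ _ NW NA).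
set y := \sum_i ray I J alpha t i *: p i in Wt.
(* W is a neighbourhood only within the compactification, so membership there has to be supplied. *)
have Wy : W (internal_metric y).
  by apply: Wt; have [k' _ <-] := hfun_internal fp0 y; exact: hfun_compactification.
apply: (@le_trans _ _ (unorm y + hfun k y)%:E).
  by apply: ereal_inf_lbound; exists y.
rewrite lee_fin /hfun addrA lerD2r.
have h1 := ray_unorm At; rewrite -/y in h1.
have h2 : ln (hmax k y) <= A - t%:R.
  by rewrite -[leRHS]expRK ler_ln ?posrE ?expR_gt0 ?hmax_gt0 // hmax_ray_le.
by move: h1 h2; move: (ln _) => u; lra.
Qed.

End RayBound.

Lemma hboundary_supp (p : 'I_n -> V) (I J : {set 'I_n}) (alpha : 'I_n -> R)
    (H : horo_data p I J alpha) :
  hpos_supp (hboundary H) = psum p I /\ hneg_supp (hboundary H) = psum p J.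
Proof.
pose c := (\sum_i (horo_pos I alpha i + horo_pos J alpha i))^-1.
have c0 : c != 0.
  apply: contra_eq_neq (hsum1 (hboundary H)) => c0.
  rewrite /= -/c c0 big1 => [|i _]; last by rewrite !mul0r addr0.
  by rewrite eq_sym oner_eq0.
have E K : [set i | c * horo_pos K alpha i != 0]%SET = K.
  apply/setP => i; rewrite inE mulf_eq0 (negbTE c0) /horo_pos.
  by case: ifP; rewrite ?eqxx // gt_eqF ?expR_gt0.
by split; rewrite /hpos_supp /hneg_supp /= -/c E.
Qed.

Lemma detour_dist_fin h h' : (0 <= detour_cost h h')%E -> (0 <= detour_cost h' h)%E ->
  (detour_dist h h' < +oo)%E ->
  (detour_cost h h' < +oo)%E /\ (detour_cost h' h < +oo)%E.
Proof.
by move=> h1 h2 h12; split; apply: le_lt_trans h12; [exact: leeDl|exact: leeDr].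
Qed.

Lemma phi_part (p : 'I_n -> V) (I J : {set 'I_n}) (alpha : 'I_n -> R) :
  horo_data p I J alpha -> phi @` part (horo_fun p I J alpha) = relint (horo_face p I J).
Proof.
move=> H; have fp : jframe junit p by case: H => /(jordan_frameE _ (jmul1 _)).
have [_ dIJ _ _ _] := H.
rewrite horo_faceE //; set e := psum p I; set f := psum p J.
have ee : e • e = e := psum_idem fp I; have ff : f • f = f := psum_idem fp J.
have ef : e • f = 0 := psum_orth fp dIJ.
have [EI EJ] := hboundary_supp H; have hE := hboundary_fun H.
have K0 : hsc (hboundary H) = 0 by [].
apply/seteqP; split=> [_ [h [[hc hi] hd] <-]|x rx].
  have [k kE] := compactification_hfun fp0 hc; rewrite -kE (phi_hfun fp0).
  rewrite -hE -kE in hd.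
  have [d1 d2] := detour_dist_fin (detour_cost_ge0 _ k) (detour_cost_ge0 _ _) hd.
  have S1 w sw := @detour_supported _ _ w d1 sw.
  have S2 w sw := @detour_supported _ _ w d2 sw.
  apply: supp_relint => //.
    rewrite /e -EI; apply: hpos_supp_eq => w sw.
    by split; [exact: (S1 w sw).1|exact: (S2 w sw).1].
  rewrite /f -EJ; apply: (@hpos_supp_eq (hswap k) (hswap (hboundary H))) => w sw.
  by split; [exact: (S1 w sw).2|exact: (S2 w sw).2].
have [k kE] := hval_surj fp0 (jball_sub rx.1); rewrite -kE in rx *.
have Ek := relint_pos_supp ee ff ef rx; have Fk := relint_neg_supp ee ff ef rx.
have [_ _ k0] := jball_face_hval ee ff ef rx.1.
exists (hfun k); last exact: (phi_hfun fp0).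
split.
  split; first exact: hfun_compactification.
  move=> [y _ yE]; have [z] := hfun_unbounded (- unorm y) k0.
  by rewrite -yE ltNge internal_metric_ge.
(* The reverse cost needs a ray towards [hfun k], hence its own representation by a horofunction
   with index sets I' and J' whose projections are again e and f. *)
have [I' [J' [alpha' [H' [_ kf I'E J'E]]]]] := hfun_data k0.
have d1 : (detour_cost (horo_fun p I J alpha) (hfun k) < +oo)%E by exact: detour_cost_fin.
have d2 : (detour_cost (hfun k) (horo_fun p I J alpha) < +oo)%E.
  rewrite -hE kf; apply: (detour_cost_fin H').
    by rewrite EI I'E -/(hpos_supp k) Ek.
  by rewrite EJ J'E -/(hneg_supp k) Fk.
by rewrite /detour_dist lte_add_pinfty.
Qed.

Lemma horo_fun_boundary (p : 'I_n -> V) (I J : {set 'I_n}) (alpha : 'I_n -> R) :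
  horo_data p I J alpha -> horo_boundary V (horo_fun p I J alpha).
Proof.
move=> H; rewrite -(hboundary_fun H); split; first exact: hfun_compactification.
move=> [y _ yE]; have [z] := @hfun_unbounded _ _ _ (hboundary H) (- unorm y) erefl.
by rewrite -yE ltNge internal_metric_ge.
Qed.

Lemma horo_face_closed_boundary_face (p : 'I_n -> V) (I J : {set 'I_n}) :
  jframe junit p -> [disjoint I & J]%B ->
  closed_boundary_face (horo_face p I J) (dual_ball V).
Proof.
move=> fp dIJ; have ef := psum_orth fp dIJ; rewrite horo_faceE //.
have ee := psum_idem fp I; have ff := psum_idem fp J.
by split; [exact: jball_closed fp0|exact: jball_is_face|exact: jball_boundary].
Qed.

End Parts.

Theorem theorem4p5 (R : realType) (V : euclideanJordanType R) :
  (forall h : {ptws V -> R}, horo_compactification V h ->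
     exists! w : V, phi_graph h w) /\
  homeomorphism_on (horo_compactification V) (dual_ball V : set (fdtop V))
    phi /\
  (forall (r : nat) (p : 'I_r -> V) (I J : {set 'I_r}) (alpha : 'I_r -> R),
     horo_data p I J alpha ->
     [/\ horo_boundary V (horo_fun p I J alpha),
         closed_boundary_face (horo_face p I J) (dual_ball V) &
         phi @` part (horo_fun p I J alpha) = relint (horo_face p I J)]).
Proof.
have [n [p0 fp0]] := @jframe_exists R V.
split.
  move=> h hh; have [k kE] := compactification_hfun fp0 hh; exists (hval k); split.
    by apply/(phi_graphE fp0); exists k.
  by move=> w /(phi_graphE fp0)[l [lE ->]]; apply: hfun_val; rewrite kE.
split; first exact: (phi_homeomorphism fp0).
move=> r p I J alpha H; have fp : jframe junit p by case: H => /(jordan_frameE _ (jmul1 _)).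
split; first exact: horo_fun_boundary H.
  by apply: (horo_face_closed_boundary_face fp) => //; case: H.
exact: (phi_part fp H).
Qed.
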